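(* Let $c\ge 2$ be an integer. (1) For every integer $k\ge 1$, the product $$\zeta_{(c)}(s)=(1-c^{1-s})\zeta(s)=\sum_{j=0}^{k-1}\frac{(-1)^j}{c^{j+1}}\left(\sum_{i=0}^{c-2}(c+i)\,\Delta_c^j (i+1)^{-s}-(c-1)^2\,\Delta_c^j c^{-s}\right)+\lim_{N\to\infty}\sum_{n=1}^{cN}\frac{(-1)^k}{c^k}\,a_{c,n}\,\Delta_c^k n^{-s}\qquad(\ast)$$ provides the analytic continuation of $\zeta(s)$ on the punctured half plane $\operatorname{Re}(s)>1-k$, $s\ne 1$, where the infinite series converges absolutely and uniformly on compact sets to a holomorphic function. (2) Moreover, except that the convergence will not be absolute in the strip $-k<\operatorname{Re}(s)\le 1-k$, this remains true for $k\ge 0$ and $\operatorname{Re}(s)>-k$, $s\neq 1$. That is, for every integer $k\ge 0$, $(\ast)$ provides the analytic continuation of $\zeta(s)$ on $\operatorname{Re}(s)>-k$, $s\ne1$, where the infinite series (taken as $\lim_{N\to\infty}\sum_{n=1}^{cN}$) converges uniformly on compact sets to a holomorphic function, but the convergence is not absolute in the strip $-k<\operatorname{Re}(s)\le 1-k$. (3) Especially, taking $k=1$, for $\operatorname{Re}(s)>-1$, $s\ne 1$, $$\zeta_{(c)}(s)=(1-c^{1-s})\zeta(s)=\frac1c\left(\sum_{i=0}^{c-2}(c+i)(i+1)^{-s}-(c-1)^2c^{-s}-\lim_{N\to\infty}\sum_{n=1}^{cN}a_{c,n}\sum_{i=1}^{c}a_{c,i}(n+i)^{-s}\right).$$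
   Context: $\zeta(s)$ denotes the Riemann zeta function, given by $\sum_{n\ge1}n^{-s}$ for $\operatorname{Re}(s)>1$ and meromorphically continued to $\mathbb{C}$ with a simple pole at $s=1$, and $\zeta_{(c)}(s)=(1-c^{1-s})\zeta(s)$. For integers $c\ge 2$ and $n\ge1$, set $a_{c,n}=1-c$ if $n\equiv 0\pmod c$ and $a_{c,n}=1$ otherwise. For a sequence $(b_n)_{n\ge1}$ of complex numbers, the generalized difference operators are defined by $\Delta_c^0 b_n=b_n$ and $\Delta_c^k b_n=\sum_{i=1}^{c}a_{c,i}\,\Delta_c^{k-1}b_{n+i}$ for $k\ge1$. The symbol $\Delta_c^k n^{-s}$ means $\Delta_c^k b_n$ for the sequence $b_n=n^{-s}$ ($s$ fixed); $\Delta_c^j(i+1)^{-s}$ and $\Delta_c^j c^{-s}$ are the values of $\Delta_c^j n^{-s}$ at $n=i+1$ and $n=c$. An empty sum (over $j$, when $k=0$) is $0$.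
   Formalization: In (2), non-absolute convergence in the strip -k < Re(s) ≤ 1-k is claimed at every point except s = 1-k when k ≥ 1: there n^{-s} = n^{k-1} is a polynomial of degree k-1, so Δ_c^k n^{-s} = 0, all terms vanish and the series converges absolutely. *)

(* Defs.v *)
From Stdlib Require Import Reals List.
From Coquelicot Require Import Coquelicot.
Open Scope C_scope.

Definition Cexp (z : C) : C :=
  (exp (Re z) * cos (Im z), exp (Re z) * sin (Im z))%R.

(* [npow n s] is n^s with the real logarithm of [n]; it is only meaningful for
   n >= 1, and n^{-s} is written [npow n (- s)]. *)
Definition npow (n : nat) (s : C) : C := Cexp (s * RtoC (ln (INR n))).

Definition acoef (c n : nat) : C :=
  if Nat.eqb (Nat.modulo n c) 0 then 1 - RtoC (INR c) else 1.

(* A sequence (b_n)_{n>=1} is a total function whose value at 0 is never used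
   when n >= 1. *)
Fixpoint gdiff (c k : nat) (b : nat -> C) (n : nat) : C :=
  match k with
  | O => b n
  | S k' => sum_n_m (fun i => acoef c i * gdiff c k' b (n + i)) 1 c
  end.

Definition gdiff_pow (c k : nat) (s : C) (n : nat) : C :=
  gdiff c k (fun m => npow m (- s)) n.

(* [sum_n f m] includes the term of index [m]. *)
Definition sum_lt (k : nat) (f : nat -> C) : C :=
  match k with
  | O => 0
  | S m => sum_n f m
  end.

Definition head_sum (c k : nat) (s : C) : C :=
  sum_lt k (fun j =>
    (-1) ^ j / RtoC (INR c) ^ (j + 1) *
    (sum_lt (c - 1) (fun i => RtoC (INR (c + i)) * gdiff_pow c j s (i + 1))
     - (RtoC (INR c) - 1) ^ 2 * gdiff_pow c j s c)).

Definition tail_term (c k : nat) (s : C) (n : nat) : C :=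
  (-1) ^ k / RtoC (INR c) ^ k * acoef c n * gdiff_pow c k s n.

Definition tail_sum (c k M : nat) (s : C) : C :=
  sum_n_m (tail_term c k s) 1 M.

Definition punctured_half_plane (x : R) (s : C) : Prop :=
  (x < Re s)%R /\ s <> 1.

(* Meant for open [U]: the derivative at a point of [U] is taken over a full
   neighbourhood in C. *)
Definition holomorphic_on (U : C -> Prop) (f : C -> C) : Prop :=
  forall s, U s -> @ex_derive C_AbsRing C_NormedModule f s.

Definition compact_set (K : C -> Prop) : Prop :=
  forall (I : Type) (V : I -> C -> Prop),
    (forall i, open (V i)) ->
    (forall z, K z -> exists i, V i z) ->
    exists l : list I, forall z, K z -> exists i, In i l /\ V i z.

Definition unif_cvg_on_compacts (U : C -> Prop) (F : nat -> C -> C)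
    (f : C -> C) : Prop :=
  forall K : C -> Prop, compact_set K -> (forall z, K z -> U z) ->
  forall eps : R, (0 < eps)%R ->
  exists N0 : nat, forall N : nat, (N0 <= N)%nat ->
  forall z, K z -> (Cmod (F N z - f z) < eps)%R.

(* By the identity theorem these conditions determine [zeta] on C \ {1}; the
   value of [zeta] at 1 is left unspecified. *)
Definition is_riemann_zeta (zeta : C -> C) : Prop :=
  (forall s : C, (1 < Re s)%R ->
     is_series (fun n : nat => npow (S n) (- s)) (zeta s)) /\
  holomorphic_on (fun s => s <> 1) zeta /\
  (exists r : C, r <> 0 /\
     filterlim (fun s : C => (s - 1) * zeta s) (locally' (RtoC 1)) (locally r)).

Definition zeta_c (zeta : C -> C) (c : nat) (s : C) : C :=
  (1 - npow c (1 - s)) * zeta s.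

(* Main.v *)
Require Import Defs.
From Stdlib Require Import Reals Lra Lia List.
From Coquelicot Require Import Coquelicot.
Open Scope C_scope.

(** Write [D] for the operator [Delta_c]. Its weights are [c]-periodic and sum
    to zero over a period, so [D] behaves like a derivative: applied to a smooth
    function of a real variable it gains one power of decay. Since the derivative
    of [x^(-s)] is [-s x^(-(s+1))], induction on [k] gives
    [|D^k n^(-s)| <= A n^(-Re s - k)] with [A] uniform for bounded [s]
    ([pdiff_upper]). Hence the series of the [a_n D^k n^(-s)] converges
    absolutely for [Re s > 1 - k]. Grouping [c] consecutive terms turns
    [sum a_(cm+i) D^k (cm+i)^(-s)] into [D^(k+1) (cm)^(-s)], one power better,
    which gives the convergence for [Re s > -k]. Keeping the next term of the
    expansion shows that [D^k n^(-s)] is asymptotic to a nonzero multiple of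
    [n^(-s-k)] as long as no factor of [s (s+1) ... (s+k-1)] vanishes
    ([pdiff_asymptotic]); when [Re s + k <= 1] the absolute values then dominate a
    multiple of the harmonic series.

    The identity is elementary for [Re s > 1]. For [k = 0] it is the splitting of
    the Dirichlet series according to divisibility by [c]. Passing from [k] to
    [k + 1] is a summation by parts: for the [c]-periodic weights the
    autocorrelation [sum_i a_i a_(m-i)] equals [-c a_m], so the series of
    [a_n D b_n] is [-c] times the series of [a_n b_n], up to terms at both ends
    ([summation_by_parts]). The lower end supplies the new term of the head and
    the upper end tends to zero.

    To reach [Re s > -k], both sides must be known to be holomorphic and the
    identity theorem must be applied. Holomorphy is mere complex
    differentiability here, so the classical chain is developed: Goursat's theorem for
    rectangles by bisection ([goursat]), Cauchy's formula
    ([cauchy_formula]), the theorem of Weierstrass on uniform limits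
    ([weierstrass]), and an identity theorem on squares
    ([identity_theorem_square]). The last one avoids power series: if [f]
    vanishes near [p], then [f(w) / (w - p)^n] is still holomorphic for every
    [n], and the bound that Cauchy's formula gives for it makes [f] vanish on a disc
    about [p]. Finitely many such discs lead from [Re s > 1] to any point of
    the punctured half plane ([identity_punctured_half_plane]). *)

(** * Complex differentiability by difference quotients *)


Definition cont_at (f : C -> C) (s : C) : Prop :=
  forall eps : R, (0 < eps)%R -> exists d : R, (0 < d)%R /\
  forall w, (Cmod (w - s) < d)%R -> (Cmod (f w - f s) < eps)%R.

(** Caratheodory's form of the derivative: [q] is the difference quotient, and
    [q s] the derivative. Products, quotients and compositions become algebra on
    difference quotients, and [q] is the function to which Cauchy's formula
    applies the integral theorem. *)
Definition diff_at (f : C -> C) (s : C) : Prop :=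
  exists q : C -> C, cont_at q s /\
  exists d : R, (0 < d)%R /\
  forall w, (Cmod (w - s) < d)%R -> f w = f s + q w * (w - s).

Lemma Cmod_minus_sym (a b : C) : Cmod (a - b) = Cmod (b - a).
Proof. rewrite <- Cmod_opp. f_equal. ring. Qed.

Lemma Cmod_self_minus (a : C) : Cmod (a - a) = 0%R.
Proof. replace (a - a) with (RtoC 0) by ring. apply Cmod_0. Qed.

Lemma Cmod_minus_pos (a b : C) : a <> b -> (0 < Cmod (a - b))%R.
Proof.
  intros H. apply Cmod_gt_0. intros E. apply H.
  replace a with (a - b + b) by ring. rewrite E. ring.
Qed.

Lemma cont_at_ext_loc (f g : C -> C) (s : C) (d : R) :
  (0 < d)%R -> (forall w, (Cmod (w - s) < d)%R -> f w = g w) ->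
  cont_at f s -> cont_at g s.
Proof.
  intros Hd E Hf eps He. destruct (Hf eps He) as [d1 [Hd1 H1]].
  exists (Rmin d d1). split; [now apply Rmin_pos|].
  intros w Hw. rewrite <- !E.
  - apply H1. eapply Rlt_le_trans; [apply Hw|apply Rmin_r].
  - now rewrite Cmod_self_minus.
  - eapply Rlt_le_trans; [apply Hw|apply Rmin_l].
Qed.

Lemma cont_at_const (a s : C) : cont_at (fun _ => a) s.
Proof.
  intros eps He. exists 1%R. split; [lra|]. intros w _. now rewrite Cmod_self_minus.
Qed.

Lemma cont_at_id (s : C) : cont_at (fun w => w) s.
Proof. intros eps He. exists eps. auto. Qed.

Lemma cont_at_plus (f g : C -> C) (s : C) :
  cont_at f s -> cont_at g s -> cont_at (fun w => f w + g w) s.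
Proof.
  intros Hf Hg eps He.
  destruct (Hf (eps / 2)%R) as [d1 [Hd1 H1]]; [lra|].
  destruct (Hg (eps / 2)%R) as [d2 [Hd2 H2]]; [lra|].
  exists (Rmin d1 d2). split; [now apply Rmin_pos|]. intros w Hw.
  replace (f w + g w - (f s + g s)) with ((f w - f s) + (g w - g s)) by ring.
  eapply Rle_lt_trans; [apply Cmod_triangle|].
  assert (A1 := H1 w (Rlt_le_trans _ _ _ Hw (Rmin_l _ _))).
  assert (A2 := H2 w (Rlt_le_trans _ _ _ Hw (Rmin_r _ _))). lra.
Qed.

Lemma cont_at_mult (f g : C -> C) (s : C) :
  cont_at f s -> cont_at g s -> cont_at (fun w => f w * g w) s.
Proof.
  intros Hf Hg eps He.
  set (A := (Cmod (f s) + 1)%R). set (B := (Cmod (g s) + 1)%R).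
  assert (HA : (1 <= A)%R) by (unfold A; generalize (Cmod_ge_0 (f s)); lra).
  assert (HB : (1 <= B)%R) by (unfold B; generalize (Cmod_ge_0 (g s)); lra).
  assert (E1 : (0 < eps / (2 * A))%R) by (apply Rdiv_lt_0_compat; lra).
  assert (E2 : (0 < Rmin 1 (eps / (2 * B)))%R)
    by (apply Rmin_pos; [lra|apply Rdiv_lt_0_compat; lra]).
  destruct (Hg _ E1) as [d1 [Hd1 H1]].
  destruct (Hf _ E2) as [d2 [Hd2 H2]].
  destruct (Hg 1%R ltac:(lra)) as [d3 [Hd3 H3]].
  exists (Rmin d1 (Rmin d2 d3)). split; [repeat apply Rmin_pos; assumption|].
  intros w Hw.
  assert (A1 := H1 w (Rlt_le_trans _ _ _ Hw (Rmin_l _ _))).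
  assert (Hw' := Rlt_le_trans _ _ _ Hw (Rmin_r _ _)).
  assert (A2 := H2 w (Rlt_le_trans _ _ _ Hw' (Rmin_l _ _))).
  assert (A3 := H3 w (Rlt_le_trans _ _ _ Hw' (Rmin_r _ _))).
  assert (A2' := Rlt_le_trans _ _ _ A2 (Rmin_r _ _)).
  replace (f w * g w - f s * g s)
    with ((f w - f s) * g w + f s * (g w - g s)) by ring.
  eapply Rle_lt_trans; [apply Cmod_triangle|]. rewrite !Cmod_mult.
  assert (Gw : (Cmod (g w) <= B)%R).
  { unfold B. replace (g w) with (g s + (g w - g s)) by ring.
    eapply Rle_trans; [apply Cmod_triangle|]. lra. }
  assert (P1 : (Cmod (f w - f s) * Cmod (g w) <= eps / (2 * B) * B)%R).
  { apply Rmult_le_compat; try apply Cmod_ge_0; lra. }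
  assert (P2 : (Cmod (f s) * Cmod (g w - g s) <= A * Cmod (g w - g s))%R).
  { apply Rmult_le_compat_r; [apply Cmod_ge_0|unfold A; lra]. }
  assert (P3 : (A * Cmod (g w - g s) < A * (eps / (2 * A)))%R).
  { apply Rmult_lt_compat_l; lra. }
  replace (eps / (2 * B) * B)%R with (eps / 2)%R in P1 by (field; lra).
  replace (A * (eps / (2 * A)))%R with (eps / 2)%R in P3 by (field; lra).
  lra.
Qed.

Lemma Cmod_triangle_inv (a b : C) : (Cmod a - Cmod b <= Cmod (a - b))%R.
Proof.
  assert (H := Cmod_triangle (a - b) b).
  replace (a - b + b) with a in H by ring. lra.
Qed.

Lemma cont_at_lower (f : C -> C) (s : C) : cont_at f s -> f s <> 0 ->
  exists d : R, (0 < d)%R /\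
  forall w, (Cmod (w - s) < d)%R -> (Cmod (f s) / 2 < Cmod (f w))%R.
Proof.
  intros Hf H0. assert (P := proj1 (Cmod_gt_0 _) H0).
  destruct (Hf (Cmod (f s) / 2)%R) as [d [Hd H]]; [lra|].
  exists d. split; [assumption|]. intros w Hw. specialize (H w Hw).
  rewrite Cmod_minus_sym in H. generalize (Cmod_triangle_inv (f s) (f w)). lra.
Qed.

Lemma cont_at_inv (f : C -> C) (s : C) :
  cont_at f s -> f s <> 0 -> cont_at (fun w => / f w) s.
Proof.
  intros Hf H0 eps He. assert (P := proj1 (Cmod_gt_0 _) H0).
  destruct (cont_at_lower f s Hf H0) as [d1 [Hd1 H1]].
  set (m := Cmod (f s)) in *.
  destruct (Hf (eps * (m * m / 2))%R) as [d2 [Hd2 H2]].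
  { apply Rmult_lt_0_compat; [assumption|]. nra. }
  exists (Rmin d1 d2). split; [now apply Rmin_pos|]. intros w Hw.
  assert (A1 := H1 w (Rlt_le_trans _ _ _ Hw (Rmin_l _ _))).
  assert (A2 := H2 w (Rlt_le_trans _ _ _ Hw (Rmin_r _ _))).
  assert (Hw0 : f w <> 0). { apply Cmod_gt_0. lra. }
  replace (/ f w - / f s) with (- (f w - f s) / (f w * f s)) by now field.
  rewrite Cmod_div by now apply Cmult_neq_0. rewrite Cmod_opp, Cmod_mult. fold m.
  apply Rlt_div_l; [apply Rmult_lt_0_compat; lra|].
  eapply Rlt_le_trans; [apply A2|]. apply Rmult_le_compat_l; [lra|]. nra.
Qed.

Lemma cont_at_comp (f g : C -> C) (s : C) :
  cont_at f s -> cont_at g (f s) -> cont_at (fun w => g (f w)) s.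
Proof.
  intros Hf Hg eps He. destruct (Hg eps He) as [d [Hd H]].
  destruct (Hf d Hd) as [d' [Hd' H']]. exists d'. split; [assumption|].
  intros w Hw. apply H, H', Hw.
Qed.

Lemma diff_at_cont (f : C -> C) (s : C) : diff_at f s -> cont_at f s.
Proof.
  intros [q [Hq [d [Hd E]]]].
  apply (cont_at_ext_loc (fun w => f s + q w * (w + (- s))) f s d Hd).
  - intros w Hw. rewrite (E w Hw). ring.
  - apply cont_at_plus; [apply cont_at_const|].
    apply cont_at_mult; [assumption|].
    apply cont_at_plus; [apply cont_at_id|apply cont_at_const].
Qed.

Lemma diff_at_ext_loc (f g : C -> C) (s : C) (d : R) :
  (0 < d)%R -> (forall w, (Cmod (w - s) < d)%R -> f w = g w) ->
  diff_at f s -> diff_at g s.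
Proof.
  intros Hd E [q [Hq [d1 [Hd1 H]]]]. exists q. split; [assumption|].
  exists (Rmin d d1). split; [now apply Rmin_pos|]. intros w Hw.
  rewrite <- !E.
  - apply H. eapply Rlt_le_trans; [apply Hw|apply Rmin_r].
  - now rewrite Cmod_self_minus.
  - eapply Rlt_le_trans; [apply Hw|apply Rmin_l].
Qed.

Lemma diff_at_ext (f g : C -> C) (s : C) :
  (forall w, f w = g w) -> diff_at f s -> diff_at g s.
Proof. intros E. apply (diff_at_ext_loc f g s 1); [lra|auto]. Qed.

Lemma diff_at_const (a s : C) : diff_at (fun _ => a) s.
Proof.
  exists (fun _ => 0). split; [apply cont_at_const|].
  exists 1%R. split; [lra|]. intros w _. ring.
Qed.

Lemma diff_at_id (s : C) : diff_at (fun w => w) s.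
Proof.
  exists (fun _ => 1). split; [apply cont_at_const|].
  exists 1%R. split; [lra|]. intros w _. ring.
Qed.

Lemma diff_at_plus (f g : C -> C) (s : C) :
  diff_at f s -> diff_at g s -> diff_at (fun w => f w + g w) s.
Proof.
  intros [q1 [Hq1 [d1 [Hd1 H1]]]] [q2 [Hq2 [d2 [Hd2 H2]]]].
  exists (fun w => q1 w + q2 w). split; [now apply cont_at_plus|].
  exists (Rmin d1 d2). split; [now apply Rmin_pos|]. intros w Hw.
  rewrite (H1 w), (H2 w).
  - ring.
  - eapply Rlt_le_trans; [apply Hw|apply Rmin_r].
  - eapply Rlt_le_trans; [apply Hw|apply Rmin_l].
Qed.

Lemma diff_at_mult (f g : C -> C) (s : C) :
  diff_at f s -> diff_at g s -> diff_at (fun w => f w * g w) s.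
Proof.
  intros Hf Hg. assert (Cg := diff_at_cont g s Hg).
  destruct Hf as [q1 [Hq1 [d1 [Hd1 H1]]]]. destruct Hg as [q2 [Hq2 [d2 [Hd2 H2]]]].
  exists (fun w => q1 w * g w + f s * q2 w). split.
  - apply cont_at_plus; apply cont_at_mult; auto using cont_at_const.
  - exists (Rmin d1 d2). split; [now apply Rmin_pos|]. intros w Hw.
    rewrite (H1 w), (H2 w).
    + ring.
    + eapply Rlt_le_trans; [apply Hw|apply Rmin_r].
    + eapply Rlt_le_trans; [apply Hw|apply Rmin_l].
Qed.

Lemma diff_at_opp (f : C -> C) (s : C) :
  diff_at f s -> diff_at (fun w => - f w) s.
Proof.
  intros H. apply (diff_at_ext (fun w => (-1) * f w)); [intros; ring|].
  now apply diff_at_mult; [apply diff_at_const|].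
Qed.

Lemma diff_at_minus (f g : C -> C) (s : C) :
  diff_at f s -> diff_at g s -> diff_at (fun w => f w - g w) s.
Proof.
  intros Hf Hg. apply diff_at_plus; [assumption|now apply diff_at_opp].
Qed.

Lemma diff_at_inv (f : C -> C) (s : C) :
  diff_at f s -> f s <> 0 -> diff_at (fun w => / f w) s.
Proof.
  intros Hf H0. assert (Cf := diff_at_cont f s Hf).
  destruct (cont_at_lower f s Cf H0) as [d2 [Hd2 H2]].
  destruct Hf as [q [Hq [d1 [Hd1 H1]]]].
  exists (fun w => - 1 * (q w * (/ f w * / f s))). split.
  - apply cont_at_mult; [apply cont_at_const|].
    apply cont_at_mult; [assumption|].
    apply cont_at_mult; [now apply cont_at_inv|apply cont_at_const].
  - exists (Rmin d1 d2). split; [now apply Rmin_pos|]. intros w Hw.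
    assert (A2 := H2 w (Rlt_le_trans _ _ _ Hw (Rmin_r _ _))).
    assert (A1 := H1 w (Rlt_le_trans _ _ _ Hw (Rmin_l _ _))).
    assert (Hw0 : f w <> 0).
    { apply Cmod_gt_0. generalize (Cmod_ge_0 (f s)). lra. }
    transitivity (/ f s - (f w - f s) * (/ f w * / f s)); [now field|].
    rewrite A1 at 1. ring.
Qed.

Lemma diff_at_comp (f g : C -> C) (s : C) :
  diff_at f s -> diff_at g (f s) -> diff_at (fun w => g (f w)) s.
Proof.
  intros Hf. assert (Cf := diff_at_cont f s Hf).
  destruct Hf as [q1 [Hq1 [d1 [Hd1 H1]]]]. intros [q2 [Hq2 [d2 [Hd2 H2]]]].
  exists (fun w => q2 (f w) * q1 w). split.
  - apply cont_at_mult; [now apply cont_at_comp|assumption].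
  - destruct (Cf d2 Hd2) as [d3 [Hd3 H3]].
    exists (Rmin d1 d3). split; [now apply Rmin_pos|]. intros w Hw.
    assert (A1 := H1 w (Rlt_le_trans _ _ _ Hw (Rmin_l _ _))).
    assert (A2 := H2 _ (H3 w (Rlt_le_trans _ _ _ Hw (Rmin_r _ _)))).
    rewrite A2 at 1. rewrite A1 at 2. ring.
Qed.

Lemma diff_at_pow (f : C -> C) (n : nat) (s : C) :
  diff_at f s -> diff_at (fun w => f w ^ n) s.
Proof.
  intros Hf. induction n as [|n IH]; simpl; [apply diff_at_const|].
  now apply diff_at_mult.
Qed.

Lemma ex_derive_of_diff_at (f : C -> C) (s : C) :
  diff_at f s -> @ex_derive C_AbsRing C_NormedModule f s.
Proof.
  intros [q [Hq [d [Hd E]]]]. exists (q s). split.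
  { apply is_linear_scal_l. }
  intros x Hx.
  apply (@is_filter_lim_locally_unique C_AbsRing (AbsRing_NormedModule C_AbsRing)) in Hx.
  subst x.
  intros eps. destruct (Hq eps (cond_pos eps)) as [d' [Hd' H']].
  assert (Hm : (0 < Rmin d d')%R) by now apply Rmin_pos.
  exists (mkposreal _ Hm). intros w Hw.
  assert (Hw' : (Cmod (w - s) < Rmin d d')%R) by exact Hw.
  change (Cmod (f w - f s - (w - s) * q s) <= eps * Cmod (w - s))%R.
  rewrite (E w) by (eapply Rlt_le_trans; [apply Hw'|apply Rmin_l]).
  replace (f s + q w * (w - s) - f s - (w - s) * q s)
    with ((q w - q s) * (w - s)) by ring.
  rewrite Cmod_mult. apply Rmult_le_compat_r; [apply Cmod_ge_0|].
  left. apply H'. eapply Rlt_le_trans; [apply Hw'|apply Rmin_r].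
Qed.

Lemma diff_at_of_ex_derive (f : C -> C) (s : C) :
  @ex_derive C_AbsRing C_NormedModule f s -> diff_at f s.
Proof.
  intros [l [_ H]]. specialize (H s (fun P HP => HP)).
  exists (fun w => if Ceq_dec w s then l else (f w - f s) / (w - s)). split.
  - intros eps He. assert (He2 : (0 < eps / 2)%R) by lra.
    destruct (H (mkposreal _ He2)) as [d Hd]. exists d. split; [apply cond_pos|].
    intros w Hw. destruct (Ceq_dec s s) as [_|N]; [|now elim N].
    destruct (Ceq_dec w s) as [->|N]; [now rewrite Cmod_self_minus|].
    specialize (Hd w Hw).
    change (Cmod (f w - f s - (w - s) * l) <= eps / 2 * Cmod (w - s))%R in Hd.
    assert (P := Cmod_minus_pos _ _ N).
    assert (N' : w - s <> 0) by now apply Cmod_gt_0.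
    replace ((f w - f s) / (w - s) - l) with ((f w - f s - (w - s) * l) / (w - s))
      by now field.
    rewrite Cmod_div by assumption. apply Rlt_div_l; [assumption|]. nra.
  - exists 1%R. split; [lra|]. intros w _.
    destruct (Ceq_dec w s) as [->|N]; [ring|]. field.
    apply Cmod_gt_0. now apply Cmod_minus_pos.
Qed.

(** * Integrals around a rectangle *)

Definition CInt (f : R -> C) (a b : R) : C := @RInt C_R_CompleteNormedModule f a b.

Notation ex_CInt := (@ex_RInt C_R_NormedModule).

Lemma continuous_of_cont (f : R -> C) (x : R) :
  (forall eps : R, (0 < eps)%R -> exists d : R, (0 < d)%R /\
    forall t, (Rabs (t - x) < d)%R -> (Cmod (f t - f x) < eps)%R) ->
  @continuous R_UniformSpace C_R_NormedModule f x.
Proof.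
  intros H P [eps HP]. destruct (H eps (cond_pos eps)) as [d [Hd Hf]].
  exists (mkposreal d Hd). intros t Ht. apply HP.
  apply C_NormedModule_mixin_compat1. apply Hf, Ht.
Qed.

Lemma Cmod_Ci : Cmod Ci = 1%R.
Proof. unfold Cmod; simpl. transitivity (sqrt 1); [f_equal; ring|apply sqrt_1]. Qed.

Lemma Cmod_hor (x x' y : R) : Cmod ((x', y) - (x, y)) = Rabs (x' - x).
Proof.
  replace ((x', y) - (x, y)) with (RtoC (x' - x)); [apply Cmod_R|].
  apply injective_projections; simpl; ring.
Qed.

Lemma Cmod_ver (x y y' : R) : Cmod ((x, y') - (x, y)) = Rabs (y' - y).
Proof.
  replace ((x, y') - (x, y)) with (Ci * RtoC (y' - y)).
  - rewrite Cmod_mult, Cmod_R, Cmod_Ci. ring.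
  - apply injective_projections; simpl; ring.
Qed.

Lemma continuous_hor (f : C -> C) (x y : R) : cont_at f (x, y) ->
  @continuous R_UniformSpace C_R_NormedModule (fun t => f (t, y)) x.
Proof.
  intros H. apply continuous_of_cont. intros eps He.
  destruct (H eps He) as [d [Hd Hf]]. exists d. split; [assumption|].
  intros t Ht. apply Hf. now rewrite Cmod_hor.
Qed.

Lemma continuous_ver (f : C -> C) (x y : R) : cont_at f (x, y) ->
  @continuous R_UniformSpace C_R_NormedModule (fun t => f (x, t)) y.
Proof.
  intros H. apply continuous_of_cont. intros eps He.
  destruct (H eps He) as [d [Hd Hf]]. exists d. split; [assumption|].
  intros t Ht. apply Hf. now rewrite Cmod_ver.
Qed.

Lemma CInt_const (k : C) (a b : R) : CInt (fun _ => k) a b = RtoC (b - a) * k.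
Proof.
  unfold CInt. rewrite RInt_const.
  apply injective_projections; simpl; unfold scal; simpl; unfold mult; simpl; ring.
Qed.

Lemma CInt_plus (f g : R -> C) (a b : R) : ex_CInt f a b -> ex_CInt g a b ->
  CInt (fun x => f x + g x) a b = CInt f a b + CInt g a b.
Proof. intros Hf Hg. exact (@RInt_plus C_R_CompleteNormedModule f g a b Hf Hg). Qed.

Lemma ex_CInt_minus (f g : R -> C) (a b : R) : ex_CInt f a b -> ex_CInt g a b ->
  ex_CInt (fun x => f x - g x) a b.
Proof. intros Hf Hg. exact (@ex_RInt_minus C_R_NormedModule f g a b Hf Hg). Qed.

(** The integral is only linear over the reals by construction; for a complex
    factor the two components are recombined. *)
Lemma is_CInt_mult (k : C) (f : R -> C) (a b : R) (l : C) :
  @is_RInt C_R_NormedModule f a b l ->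
  @is_RInt C_R_NormedModule (fun x => k * f x) a b (k * l).
Proof.
  intros H.
  assert (H1 := @is_RInt_fct_extend_fst R_NormedModule R_NormedModule f a b l H).
  assert (H2 := @is_RInt_fct_extend_snd R_NormedModule R_NormedModule f a b l H).
  destruct k as [k1 k2]. destruct l as [l1 l2]. simpl in H1, H2.
  apply (@is_RInt_fct_extend_pair R_NormedModule R_NormedModule).
  - exact (@is_RInt_minus R_NormedModule _ _ _ _ _ _
      (is_RInt_scal _ _ _ k1 _ H1) (is_RInt_scal _ _ _ k2 _ H2)).
  - exact (@is_RInt_plus R_NormedModule _ _ _ _ _ _
      (is_RInt_scal _ _ _ k1 _ H2) (is_RInt_scal _ _ _ k2 _ H1)).
Qed.

Lemma ex_CInt_mult (k : C) (f : R -> C) (a b : R) :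
  ex_CInt f a b -> ex_CInt (fun x => k * f x) a b.
Proof. intros [l H]. exists (k * l). now apply is_CInt_mult. Qed.

Lemma CInt_mult (k : C) (f : R -> C) (a b : R) : ex_CInt f a b ->
  CInt (fun x => k * f x) a b = k * CInt f a b.
Proof.
  intros H. apply (@is_RInt_unique C_R_CompleteNormedModule).
  apply is_CInt_mult. now apply (@RInt_correct C_R_CompleteNormedModule).
Qed.

Lemma CInt_ext (f g : R -> C) (a b : R) : (a <= b)%R ->
  (forall x, (a <= x <= b)%R -> f x = g x) -> CInt f a b = CInt g a b.
Proof.
  intros Hab H. apply (@RInt_ext C_R_CompleteNormedModule).
  rewrite Rmin_left, Rmax_right by assumption. intros x Hx. apply H. lra.
Qed.

Lemma CInt_Chasles (f : R -> C) (a b c : R) : ex_CInt f a b -> ex_CInt f b c ->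
  CInt f a c = CInt f a b + CInt f b c.
Proof.
  intros H1 H2. symmetry. exact (@RInt_Chasles C_R_CompleteNormedModule f a b c H1 H2).
Qed.

Lemma Cmod_CInt_le (f : R -> C) (a b M : R) : (a <= b)%R -> ex_CInt f a b ->
  (forall x, (a <= x <= b)%R -> (Cmod (f x) <= M)%R) ->
  (Cmod (CInt f a b) <= (b - a) * M)%R.
Proof.
  intros Hab H HM.
  assert (N : forall z : C_R_NormedModule, norm z = Cmod z).
  { intros z. unfold norm; simpl. unfold prod_norm, Cmod. f_equal.
    change ((Rabs (fst z)) ^ 2 + (Rabs (snd z)) ^ 2 = fst z ^ 2 + snd z ^ 2)%R.
    now rewrite !pow2_abs. }
  rewrite <- N. apply (@norm_RInt_le_const C_R_NormedModule f a b); try assumption.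
  - intros x Hx. rewrite N. now apply HM.
  - now apply (@RInt_correct C_R_CompleteNormedModule).
Qed.

Lemma ex_CInt_cont (f : R -> C) (a b : R) : (a <= b)%R ->
  (forall x, (a <= x <= b)%R -> @continuous R_UniformSpace C_R_NormedModule f x) ->
  ex_CInt f a b.
Proof.
  intros Hab H. apply (@ex_RInt_continuous C_R_CompleteNormedModule).
  rewrite Rmin_left, Rmax_right by assumption. exact H.
Qed.

Lemma Re_CInt (f : R -> C) (a b : R) : ex_CInt f a b ->
  is_RInt (fun x => Re (f x)) a b (Re (CInt f a b)).
Proof.
  intros H. apply (@is_RInt_fct_extend_fst R_NormedModule R_NormedModule f a b).
  now apply (@RInt_correct C_R_CompleteNormedModule).
Qed.

Lemma Im_CInt (f : R -> C) (a b : R) : ex_CInt f a b ->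
  is_RInt (fun x => Im (f x)) a b (Im (CInt f a b)).
Proof.
  intros H. apply (@is_RInt_fct_extend_snd R_NormedModule R_NormedModule f a b).
  now apply (@RInt_correct C_R_CompleteNormedModule).
Qed.

Definition in_rect (a b c d : R) (w : C) : Prop :=
  (a <= Re w <= b /\ c <= Im w <= d)%R.

Definition on_edge (a b c d : R) (w : C) : Prop :=
  in_rect a b c d w /\ (Im w = c \/ Im w = d \/ Re w = a \/ Re w = b).

(** The contour integral along the counterclockwise boundary of the rectangle
    with abscissas [a], [b] and ordinates [c], [d]. Pairing opposite sides under one
    integral makes the interior cuts cancel when rectangles are glued. *)
Definition rect_int (f : C -> C) (a b c d : R) : C :=
  CInt (fun x => f (x, c) - f (x, d)) a b + Ci * CInt (fun y => f (b, y) - f (a, y)) c d.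

Definition cont_edge (f : C -> C) (a b c d : R) : Prop :=
  forall w, on_edge a b c d w -> cont_at f w.

Lemma ex_CInt_hor (f : C -> C) (a b y : R) : (a <= b)%R ->
  (forall x, (a <= x <= b)%R -> cont_at f (x, y)) -> ex_CInt (fun x => f (x, y)) a b.
Proof. intros Hab H. apply ex_CInt_cont; [assumption|]. intros x Hx. now apply continuous_hor, H. Qed.

Lemma ex_CInt_ver (f : C -> C) (x c d : R) : (c <= d)%R ->
  (forall y, (c <= y <= d)%R -> cont_at f (x, y)) -> ex_CInt (fun y => f (x, y)) c d.
Proof. intros Hab H. apply ex_CInt_cont; [assumption|]. intros y Hy. now apply continuous_ver, H. Qed.

Ltac edge :=
  unfold on_edge, in_rect, Re, Im; simpl; repeat split; try lra;
  first [left; lra | right; left; lra | right; right; left; lra | right; right; right; lra].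

Lemma ex_CInt_edges (f : C -> C) (a b c d : R) : (a <= b)%R -> (c <= d)%R ->
  cont_edge f a b c d ->
  ex_CInt (fun x => f (x, c) - f (x, d)) a b /\ ex_CInt (fun y => f (b, y) - f (a, y)) c d.
Proof.
  intros Hab Hcd H. split; apply ex_CInt_minus.
  - apply (ex_CInt_hor f); [assumption|]. intros t Ht. apply H. edge.
  - apply (ex_CInt_hor f); [assumption|]. intros t Ht. apply H. edge.
  - apply (ex_CInt_ver f); [assumption|]. intros t Ht. apply H. edge.
  - apply (ex_CInt_ver f); [assumption|]. intros t Ht. apply H. edge.
Qed.

Lemma rect_int_lin (f g : C -> C) (k : C) (a b c d : R) : (a <= b)%R -> (c <= d)%R ->
  cont_edge f a b c d -> cont_edge g a b c d ->
  rect_int (fun w => f w + k * g w) a b c d = rect_int f a b c d + k * rect_int g a b c d.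
Proof.
  intros Hab Hcd Hf Hg. unfold rect_int.
  destruct (ex_CInt_edges f a b c d) as [F1 F2]; auto.
  destruct (ex_CInt_edges g a b c d) as [G1 G2]; auto.
  rewrite (CInt_ext _ (fun x => (f (x, c) - f (x, d)) + k * (g (x, c) - g (x, d))) a b)
    by (auto; intros; ring).
  rewrite (CInt_ext _ (fun y => (f (b, y) - f (a, y)) + k * (g (b, y) - g (a, y))) c d)
    by (auto; intros; ring).
  rewrite !CInt_plus, !CInt_mult by auto using ex_CInt_mult. ring.
Qed.

Lemma rect_int_ext (f g : C -> C) (a b c d : R) : (a <= b)%R -> (c <= d)%R ->
  (forall w, on_edge a b c d w -> f w = g w) -> rect_int f a b c d = rect_int g a b c d.
Proof.
  intros Hab Hcd H. unfold rect_int.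
  rewrite (CInt_ext _ (fun x => g (x, c) - g (x, d)) a b),
    (CInt_ext _ (fun y => g (b, y) - g (a, y)) c d); auto;
    intros t Ht; now rewrite !H by edge.
Qed.

Lemma Cmod_rect_int_le (f : C -> C) (a b c d M : R) : (a <= b)%R -> (c <= d)%R ->
  cont_edge f a b c d -> (forall w, on_edge a b c d w -> (Cmod (f w) <= M)%R) ->
  (Cmod (rect_int f a b c d) <= 2 * ((b - a) + (d - c)) * M)%R.
Proof.
  intros Hab Hcd H HM. unfold rect_int.
  destruct (ex_CInt_edges f a b c d) as [F1 F2]; auto.
  eapply Rle_trans; [apply Cmod_triangle|]. rewrite Cmod_mult.
  rewrite Cmod_Ci.
  assert (T : forall u v, on_edge a b c d u -> on_edge a b c d v ->
    (Cmod (f u - f v) <= 2 * M)%R).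
  { intros u v Hu Hv. eapply Rle_trans; [apply Cmod_triangle|]. rewrite Cmod_opp.
    generalize (HM u Hu) (HM v Hv). lra. }
  assert (B1 := Cmod_CInt_le _ a b (2 * M) Hab F1 ltac:(intros t Ht; apply T; edge)).
  assert (B2 := Cmod_CInt_le _ c d (2 * M) Hcd F2 ltac:(intros t Ht; apply T; edge)).
  lra.
Qed.

(** Differences of an affine function between opposite sides are constant. *)
Lemma rect_int_affine (k l : C) (a b c d : R) :
  rect_int (fun w => k + l * w) a b c d = 0.
Proof.
  unfold rect_int.
  assert (E1 : CInt (fun x => k + l * (x, c) - (k + l * (x, d))) a b
    = CInt (fun _ => l * (Ci * RtoC (c - d))) a b).
  { apply (@RInt_ext C_R_CompleteNormedModule). intros x _.
    apply injective_projections; simpl; ring. }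
  assert (E2 : CInt (fun y => k + l * (b, y) - (k + l * (a, y))) c d
    = CInt (fun _ => l * RtoC (b - a)) c d).
  { apply (@RInt_ext C_R_CompleteNormedModule). intros x _.
    apply injective_projections; simpl; ring. }
  rewrite E1, E2, !CInt_const, !RtoC_minus. ring.
Qed.

Lemma rect_int_split_ver (f : C -> C) (a m b c d : R) :
  (a <= m <= b)%R -> (c <= d)%R ->
  (forall w, in_rect a b c d w -> cont_at f w) ->
  rect_int f a b c d = rect_int f a m c d + rect_int f m b c d.
Proof.
  intros Hm Hcd H. unfold rect_int.
  assert (X : forall p q, (a <= p)%R -> (p <= q)%R -> (q <= b)%R ->
    ex_CInt (fun x => f (x, c) - f (x, d)) p q).
  { intros p q H1 H2 H3. apply ex_CInt_minus; apply (ex_CInt_hor f); try assumption;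
      intros t Ht; apply H; edge. }
  assert (Y : forall p, (a <= p <= b)%R -> ex_CInt (fun y => f (p, y)) c d).
  { intros p Hp. apply (ex_CInt_ver f); try assumption; intros t Ht; apply H; edge. }
  rewrite (CInt_Chasles _ a m b) by (apply X; lra).
  rewrite (CInt_ext _ (fun y => (f (b, y) - f (m, y)) + (f (m, y) - f (a, y))) c d)
    by (auto; intros; ring).
  rewrite CInt_plus by (apply ex_CInt_minus; apply Y; lra). ring.
Qed.

Lemma rect_int_split_hor (f : C -> C) (a b c m d : R) :
  (a <= b)%R -> (c <= m <= d)%R ->
  (forall w, in_rect a b c d w -> cont_at f w) ->
  rect_int f a b c d = rect_int f a b c m + rect_int f a b m d.
Proof.
  intros Hcd Hm H. unfold rect_int.
  assert (X : forall p q, (c <= p)%R -> (p <= q)%R -> (q <= d)%R ->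
    ex_CInt (fun y => f (b, y) - f (a, y)) p q).
  { intros p q H1 H2 H3. apply ex_CInt_minus; apply (ex_CInt_ver f); try assumption;
      intros t Ht; apply H; edge. }
  assert (Y : forall p, (c <= p <= d)%R -> ex_CInt (fun x => f (x, p)) a b).
  { intros p Hp. apply (ex_CInt_hor f); try assumption; intros t Ht; apply H; edge. }
  rewrite (CInt_Chasles _ c m d) by (apply X; lra).
  rewrite (CInt_ext _ (fun x => (f (x, c) - f (x, m)) + (f (x, m) - f (x, d))) a b)
    by (auto; intros; ring).
  rewrite CInt_plus by (apply ex_CInt_minus; apply Y; lra). ring.
Qed.

(** * Goursat's theorem *)

Lemma nested_intervals (x l : nat -> R) : (forall n, 0 <= l n)%R ->
  (forall n, x n <= x (S n) /\ x (S n) + l (S n) <= x n + l n)%R ->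
  exists X : R, forall n, (x n <= X <= x n + l n)%R.
Proof.
  intros Hl H.
  assert (M : forall n k, (x n <= x (n + k)%nat /\ x (n + k)%nat + l (n + k)%nat <= x n + l n)%R).
  { intros n k. induction k as [|k IH]; [rewrite Nat.add_0_r; lra|].
    rewrite Nat.add_succ_r. specialize (H (n + k)%nat). lra. }
  assert (B : forall n m, (x m <= x n + l n)%R).
  { intros n m. destruct (Nat.le_ge_cases n m) as [L|L].
    - replace m with (n + (m - n))%nat by lia.
      generalize (M n (m - n)%nat) (Hl (n + (m - n))%nat). lra.
    - generalize (M m (n - m)%nat). replace (m + (n - m))%nat with n by lia.
      generalize (Hl n). lra. }
  destruct (completeness (fun t => exists n, t = x n)) as [X [U L]].
  - exists (x 0%nat + l 0%nat)%R. intros t [n ->]. apply B.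
  - exists (x 0%nat). now exists 0%nat.
  - exists X. intros n. split; [apply U; now exists n|].
    apply L. intros t [m ->]. apply B.
Qed.

Lemma Cmod_le_Re_Im (z : C) : (Cmod z <= Rabs (Re z) + Rabs (Im z))%R.
Proof.
  replace z with (RtoC (Re z) + Ci * RtoC (Im z)) at 1.
  - eapply Rle_trans; [apply Cmod_triangle|]. rewrite Cmod_mult, !Cmod_R, Cmod_Ci. lra.
  - destruct z. apply injective_projections; simpl; ring.
Qed.

Lemma in_rect_dist (a b c d : R) (u v : C) :
  in_rect a b c d u -> in_rect a b c d v -> (Cmod (u - v) <= (b - a) + (d - c))%R.
Proof.
  intros [U1 U2] [V1 V2]. eapply Rle_trans; [apply Cmod_le_Re_Im|].
  unfold Re, Im in *. simpl. apply Rplus_le_compat; apply Rabs_le; lra.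
Qed.

(** [p] is the lower left corner of a rectangle with sides [w] and [h]; the result
    is that of a quarter whose contour integral still exceeds [e] times its area.
    One exists because the area is additive and the modulus of the integral is
    subadditive, so the last quarter can be taken by default. *)
Definition bisect (f : C -> C) (e w h : R) (p : R * R) : R * R :=
  let (x, y) := p in
  let bad x y := Rlt_dec (e * ((w / 2) * (h / 2)))
                   (Cmod (rect_int f x (x + w / 2) y (y + h / 2))) in
  if bad x y then (x, y)
  else if bad (x + w / 2)%R y then (x + w / 2, y)%R
  else if bad x (y + h / 2)%R then (x, y + h / 2)%R
  else (x + w / 2, y + h / 2)%R.

Lemma bisect_spec (f : C -> C) (e w h x y : R) : (0 < w)%R -> (0 < h)%R ->
  (forall z, in_rect x (x + w) y (y + h) z -> cont_at f z) ->
  (e * (w * h) < Cmod (rect_int f x (x + w) y (y + h)))%R ->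
  let x' := fst (bisect f e w h (x, y)) in
  let y' := snd (bisect f e w h (x, y)) in
  (e * ((w / 2) * (h / 2)) < Cmod (rect_int f x' (x' + w / 2) y' (y' + h / 2)))%R /\
  (x <= x' <= x + w / 2)%R /\ (y <= y' <= y + h / 2)%R.
Proof.
  intros Hw Hh Hc Hbad. unfold bisect.
  destruct Rlt_dec as [B1|B1]; [simpl; repeat split; lra|].
  destruct Rlt_dec as [B2|B2]; [simpl; repeat split; lra|].
  destruct Rlt_dec as [B3|B3]; [simpl; repeat split; lra|].
  simpl. repeat split; try lra. apply Rnot_le_lt. intros B4. apply Rnot_lt_le in B1, B2, B3.
  rewrite (rect_int_split_ver f x (x + w / 2) (x + w)) in Hbad; try assumption; try lra.
  rewrite (rect_int_split_hor f x (x + w / 2) y (y + h / 2) (y + h)),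
    (rect_int_split_hor f (x + w / 2) (x + w) y (y + h / 2) (y + h)) in Hbad; try lra;
    try (intros z [Z1 Z2]; apply Hc; split; lra).
  replace (x + w / 2 + w / 2)%R with (x + w)%R in * by field.
  replace (y + h / 2 + h / 2)%R with (y + h)%R in * by field.
  assert (T := Cmod_triangle
    (rect_int f x (x + w / 2) y (y + h / 2) + rect_int f x (x + w / 2) (y + h / 2) (y + h))
    (rect_int f (x + w / 2) (x + w) y (y + h / 2) + rect_int f (x + w / 2) (x + w) (y + h / 2) (y + h))).
  assert (T1 := Cmod_triangle (rect_int f x (x + w / 2) y (y + h / 2))
     (rect_int f x (x + w / 2) (y + h / 2) (y + h))).
  assert (T2 := Cmod_triangle (rect_int f (x + w / 2) (x + w) y (y + h / 2))
     (rect_int f (x + w / 2) (x + w) (y + h / 2) (y + h))).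
  nra.
Qed.

Fixpoint corner (f : C -> C) (e w h : R) (p : R * R) (n : nat) : R * R :=
  match n with
  | O => p
  | S m => bisect f e (w / 2 ^ m) (h / 2 ^ m) (corner f e w h p m)
  end.

(** Near [p] the function is affine up to [eps] times the distance to [p], and
    affine functions integrate to zero; the perimeter contributes the second
    factor of the square. *)
Lemma goursat_local (f : C -> C) (p : C) (eps : R) : diff_at f p -> (0 < eps)%R ->
  exists r : R, (0 < r)%R /\ forall a b c d : R, (a <= b)%R -> (c <= d)%R ->
  in_rect a b c d p -> ((b - a) + (d - c) < r)%R -> cont_edge f a b c d ->
  (Cmod (rect_int f a b c d) <= eps * ((b - a) + (d - c)) ^ 2)%R.
Proof.
  intros [q [Hq [r1 [Hr1 E]]]] He.
  destruct (Hq (eps / 2)%R) as [r2 [Hr2 H2]]; [lra|].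
  exists (Rmin r1 r2). split; [now apply Rmin_pos|].
  intros a b c d Hab Hcd Hp Hr Hf. set (L := ((b - a) + (d - c))%R) in *.
  set (k := f p - q p * p).
  assert (Haff : cont_edge (fun w => k + q p * w) a b c d).
  { intros w _. apply cont_at_plus; [apply cont_at_const|].
    apply cont_at_mult; [apply cont_at_const|apply cont_at_id]. }
  assert (Eq : rect_int f a b c d
    = rect_int (fun w => f w + (-1) * (k + q p * w)) a b c d).
  { rewrite rect_int_lin by assumption. rewrite rect_int_affine. ring. }
  rewrite Eq.
  replace (eps * L ^ 2)%R with (2 * L * (eps / 2 * L))%R by field.
  apply Cmod_rect_int_le; try assumption.
  - intros w Hw. apply cont_at_plus; [now apply Hf|].
    apply cont_at_mult; [apply cont_at_const|now apply Haff].
  - intros w [Hw _]. assert (D := in_rect_dist a b c d w p Hw Hp). fold L in D.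
    rewrite (E w) by (generalize (Rmin_l r1 r2); lra).
    replace (f p + q w * (w - p) + -1 * (k + q p * w)) with ((q w - q p) * (w - p))
      by (unfold k; ring).
    rewrite Cmod_mult. apply Rmult_le_compat; try apply Cmod_ge_0; [|assumption].
    left. apply H2. generalize (Rmin_r r1 r2). lra.
Qed.

Lemma pow2_pos (n : nat) : (0 < 2 ^ n)%R.
Proof. apply pow_lt. lra. Qed.

Lemma div_pow2_small (w r : R) : (0 < r)%R -> (0 <= w)%R -> exists n : nat, (w / 2 ^ n < r)%R.
Proof.
  intros Hr Hw. destruct (pow_lt_1_zero (/ 2) ltac:(rewrite Rabs_pos_eq; lra) (r / (w + 1)))
    as [N HN]; [apply Rdiv_lt_0_compat; lra|].
  exists N. specialize (HN N ltac:(lia)).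
  rewrite Rabs_pos_eq in HN by (apply pow_le; lra). rewrite pow_inv in HN.
  apply Rlt_div_r in HN; [|lra]. unfold Rdiv.
  assert (0 < / 2 ^ N)%R by (apply Rinv_0_lt_compat, pow2_pos). nra.
Qed.

(** If the integral were not zero, it would exceed some multiple [e] of the area;
    bisection would keep this inequality down to a point, against
    [goursat_local]. *)
Lemma goursat (f : C -> C) (a b c d : R) : (a < b)%R -> (c < d)%R ->
  (forall w, in_rect a b c d w -> diff_at f w) -> rect_int f a b c d = 0.
Proof.
  intros Hab Hcd Hf.
  assert (Hcont : forall w, in_rect a b c d w -> cont_at f w)
    by (intros w Hw; now apply diff_at_cont, Hf).
  destruct (Ceq_dec (rect_int f a b c d) 0) as [Z|NZ]; [assumption|exfalso].
  apply Cmod_gt_0 in NZ.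
  set (W := (b - a)%R). set (H := (d - c)%R).
  assert (HW : (0 < W)%R) by (unfold W; lra). assert (HH : (0 < H)%R) by (unfold H; lra).
  set (e := (Cmod (rect_int f a b c d) / (2 * (W * H)))%R).
  assert (HWH : (0 < W * H)%R) by now apply Rmult_lt_0_compat.
  assert (He : (0 < e)%R) by (apply Rdiv_lt_0_compat; lra).
  assert (He' : (e * (W * H) < Cmod (rect_int f a b c d))%R).
  { unfold e. replace (_ * _)%R with (Cmod (rect_int f a b c d) / 2)%R by (field; lra). lra. }
  set (x := fun n => fst (corner f e W H (a, c) n)).
  set (y := fun n => snd (corner f e W H (a, c) n)).
  set (w := fun n => (W / 2 ^ n)%R). set (h := fun n => (H / 2 ^ n)%R).
  assert (Pw : forall n, (0 < w n)%R) by (intros n; apply Rdiv_lt_0_compat, pow2_pos; lra).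
  assert (Ph : forall n, (0 < h n)%R) by (intros n; apply Rdiv_lt_0_compat, pow2_pos; lra).
  assert (Sw : forall n, w (S n) = (w n / 2)%R).
  { intros n. unfold w. simpl. field. generalize (pow2_pos n). lra. }
  assert (Sh : forall n, h (S n) = (h n / 2)%R).
  { intros n. unfold h. simpl. field. generalize (pow2_pos n). lra. }
  assert (step : forall n, (a <= x n /\ x n + w n <= b)%R -> (c <= y n /\ y n + h n <= d)%R ->
    (e * (w n * h n) < Cmod (rect_int f (x n) (x n + w n) (y n) (y n + h n)))%R ->
    (e * (w (S n) * h (S n)) <
      Cmod (rect_int f (x (S n)) (x (S n) + w (S n)) (y (S n)) (y (S n) + h (S n))))%R /\
    (x n <= x (S n) <= x n + w (S n))%R /\ (y n <= y (S n) <= y n + h (S n))%R).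
  { intros n Hx Hy B. rewrite Sw, Sh.
    unfold x, y. simpl. fold (w n) (h n).
    rewrite (surjective_pairing (corner f e W H (a, c) n)). fold (x n) (y n).
    apply bisect_spec; auto. intros z [Z1 Z2]. simpl in Z1, Z2. apply Hcont. split; lra. }

  assert (inv : forall n, (a <= x n /\ x n + w n <= b)%R /\ (c <= y n /\ y n + h n <= d)%R /\
    (e * (w n * h n) < Cmod (rect_int f (x n) (x n + w n) (y n) (y n + h n)))%R).
  { induction n as [|n [I1 [I2 I3]]].
    - unfold x, y, w, h. simpl. rewrite !Rdiv_1_r.
      replace (a + W)%R with b by (unfold W; ring).
      replace (c + H)%R with d by (unfold H; ring). repeat split; try lra.
    - destruct (step n I1 I2 I3) as [S1 [S2 S3]]. repeat split; try assumption;
      rewrite ?Sw, ?Sh in *; lra. }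
  destruct (nested_intervals x w) as [X HX]; [intros n; left; apply Pw| |].
  { intros n. destruct (inv n) as [I1 [I2 I3]]. destruct (step n I1 I2 I3) as [_ [S2 _]].
    rewrite Sw in *. lra. }
  destruct (nested_intervals y h) as [Y HY]; [intros n; left; apply Ph| |].
  { intros n. destruct (inv n) as [I1 [I2 I3]]. destruct (step n I1 I2 I3) as [_ [_ S3]].
    rewrite Sh in *. lra. }
  (* All pieces have the same aspect ratio; with this constant the local estimate
     is exactly [e] times the area of a piece. *)
  set (eps := (e * (W * H) / (W + H) ^ 2)%R).
  assert (P2 : (0 < (W + H) ^ 2)%R) by (apply pow_lt; lra).
  assert (Heps : (0 < eps)%R)
    by (apply Rdiv_lt_0_compat; [now apply Rmult_lt_0_compat|assumption]).
  assert (Hp : diff_at f (X, Y)).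
  { apply Hf. destruct (inv 0%nat) as [I1 [I2 _]].
    generalize (HX 0%nat) (HY 0%nat). unfold in_rect, Re, Im; simpl. lra. }
  destruct (goursat_local f (X, Y) eps Hp Heps) as [r [Hr L]].
  destruct (div_pow2_small (W + H) r Hr ltac:(lra)) as [n Hn].
  destruct (inv n) as [I1 [I2 I3]].
  assert (Q := L (x n) (x n + w n)%R (y n) (y n + h n)%R).
  assert (Es : (x n + w n - x n + (y n + h n - y n) = (W + H) / 2 ^ n)%R).
  { unfold w, h. field. generalize (pow2_pos n). lra. }
  rewrite Es in Q.
  apply (Rlt_not_le _ _ I3). clear I3.
  replace (e * (w n * h n))%R with (eps * ((W + H) / 2 ^ n) ^ 2)%R.
  - apply Q; try assumption.
    + generalize (Pw n). lra.
    + generalize (Ph n). lra.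
    + split; [apply HX|apply HY].
    + intros z [[Z1 Z2] _]. apply Hcont. split; lra.
  - unfold eps, w, h. field. split; [generalize (pow2_pos n); lra|lra].
Qed.

(** Goursat's theorem removes everything but a small square about [z], over
    which the integral is at most a constant times its side. *)
Lemma goursat_removable (f : C -> C) (a b c d : R) (z : C) :
  (a < Re z < b)%R -> (c < Im z < d)%R ->
  (forall w, in_rect a b c d w -> w <> z -> diff_at f w) -> cont_at f z ->
  rect_int f a b c d = 0.
Proof.
  intros Hx Hy Hf Hz. set (x := Re z) in *. set (y := Im z) in *.
  assert (Hcont : forall w, in_rect a b c d w -> cont_at f w).
  { intros w Hw. destruct (Ceq_dec w z) as [->|N]; [assumption|now apply diff_at_cont, Hf]. }
  destruct (Hz 1%R ltac:(lra)) as [r [Hr Hloc]].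
  set (M := (Cmod (f z) + 1)%R).
  assert (HM : (1 <= M)%R) by (unfold M; generalize (Cmod_ge_0 (f z)); lra).
  assert (B : forall e, (0 < e)%R -> (Cmod (rect_int f a b c d) <= e)%R).
  { intros e He.
    (* [t] is half the side of the small square. *)
    set (t := Rmin (Rmin (r / 8) (e / (16 * M)))
                (Rmin (Rmin ((x - a) / 2) ((b - x) / 2)) (Rmin ((y - c) / 2) ((d - y) / 2)))).
    assert (Ht : (0 < t /\ t <= r / 8 /\ t <= e / (16 * M) /\ t <= (x - a) / 2 /\
      t <= (b - x) / 2 /\ t <= (y - c) / 2 /\ t <= (d - y) / 2)%R).
    { assert (0 < e / (16 * M))%R by (apply Rdiv_lt_0_compat; lra).
      unfold t. repeat split.
      - repeat apply Rmin_pos; lra.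
      - eapply Rle_trans; [apply Rmin_l|apply Rmin_l].
      - eapply Rle_trans; [apply Rmin_l|apply Rmin_r].
      - eapply Rle_trans; [apply Rmin_r|]. eapply Rle_trans; [apply Rmin_l|apply Rmin_l].
      - eapply Rle_trans; [apply Rmin_r|]. eapply Rle_trans; [apply Rmin_l|apply Rmin_r].
      - eapply Rle_trans; [apply Rmin_r|]. eapply Rle_trans; [apply Rmin_r|apply Rmin_l].
      - eapply Rle_trans; [apply Rmin_r|]. eapply Rle_trans; [apply Rmin_r|apply Rmin_r]. }
    destruct Ht as [T0 [T1 [T2 [T3 [T4 [T5 T6]]]]]]. clearbody t.
    assert (Z : forall a' b' c' d', (a <= a' < b')%R -> (b' <= b)%R -> (c <= c' < d')%R ->
      (d' <= d)%R -> (b' < x \/ x < a' \/ d' < y \/ y < c')%R ->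
      rect_int f a' b' c' d' = 0).
    { intros a' b' c' d' H1 H2 H3 H4 H5. apply goursat; [lra|lra|].
      intros w [W1 W2]. apply Hf; [split; lra|]. intros ->. fold x in W1. fold y in W2. lra. }
    rewrite (rect_int_split_ver f a (x - t) b c d) by (assumption || lra).
    rewrite (Z a (x - t)%R c d) by lra.
    rewrite (rect_int_split_ver f (x - t) (x + t) b c d)
      by (lra || (intros w [W1 W2]; apply Hcont; split; lra)).
    rewrite (Z (x + t)%R b c d) by lra.
    rewrite (rect_int_split_hor f (x - t) (x + t) c (y - t) d)
      by (lra || (intros w [W1 W2]; apply Hcont; split; lra)).
    rewrite (Z (x - t)%R (x + t)%R c (y - t)%R) by lra.
    rewrite (rect_int_split_hor f (x - t) (x + t) (y - t) (y + t) d)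
      by (lra || (intros w [W1 W2]; apply Hcont; split; lra)).
    rewrite (Z (x - t)%R (x + t)%R (y + t)%R d) by lra.
    rewrite !Cplus_0_l, !Cplus_0_r.
    eapply Rle_trans; [apply (Cmod_rect_int_le f _ _ _ _ M); try lra|].
    - intros w [[W1 W2] _]. apply Hcont; split; lra.
    - intros w [W _].
      assert (D := in_rect_dist _ _ _ _ w z W ltac:(split; fold x; fold y; lra)).
      assert (L := Hloc w ltac:(lra)). unfold M.
      generalize (Cmod_triangle_inv (f w) (f z)). lra.
    - apply (Rmult_le_compat_l (16 * M)) in T2; [|lra].
      replace (16 * M * (e / (16 * M)))%R with e in T2 by (field; lra). nra. }
  destruct (Ceq_dec (rect_int f a b c d) 0) as [E|N]; [assumption|].
  apply Cmod_gt_0 in N. generalize (B (Cmod (rect_int f a b c d) / 2)%R ltac:(lra)). lra.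
Qed.

Lemma interior_not_edge (a b c d : R) (z w : C) :
  (a < Re z < b)%R -> (c < Im z < d)%R -> on_edge a b c d w -> w <> z.
Proof. intros Hx Hy [_ H] ->. lra. Qed.

Lemma diff_at_pole (z w : C) : w <> z -> diff_at (fun u => / (u - z)) w.
Proof.
  intros N. apply diff_at_inv.
  - apply diff_at_minus; [apply diff_at_id|apply diff_at_const].
  - apply Cmod_gt_0. now apply Cmod_minus_pos.
Qed.

(** This is [2 i pi] for [z] inside the rectangle. Cauchy's formula divides by
    it, so it has to be nonzero, see [winding_neq_0]. *)
Definition winding (a b c d : R) (z : C) : C := rect_int (fun w => / (w - z)) a b c d.

(** The difference quotient of [f] at [z] is holomorphic off [z] and continuous
    at [z], so its integral vanishes. *)
Lemma cauchy_formula (f : C -> C) (a b c d : R) (z : C) :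
  (a < Re z < b)%R -> (c < Im z < d)%R ->
  (forall w, in_rect a b c d w -> diff_at f w) ->
  rect_int (fun w => f w * / (w - z)) a b c d = f z * winding a b c d z.
Proof.
  intros Hx Hy Hf.
  destruct (Hf z ltac:(split; lra)) as [q [Hq [r [Hr E]]]].
  set (g := fun w => if Ceq_dec w z then q z else (f w - f z) * / (w - z)).
  assert (G : rect_int g a b c d = 0).
  { apply (goursat_removable g a b c d z Hx Hy).
    - intros w Hw N. apply (diff_at_ext_loc (fun w => (f w - f z) * / (w - z)) g w (Cmod (w - z))).
      + now apply Cmod_minus_pos.
      + intros u Hu. unfold g. destruct (Ceq_dec u z) as [->|_]; [|reflexivity].
        rewrite Cmod_minus_sym in Hu. lra.
      + apply diff_at_mult; [|now apply diff_at_pole].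
        apply diff_at_minus; [now apply Hf|apply diff_at_const].
    - apply (cont_at_ext_loc q g z r Hr); [|assumption].
      intros w Hw. unfold g. destruct (Ceq_dec w z) as [->|N]; [reflexivity|].
      rewrite (E w Hw). field. apply Cmod_gt_0. now apply Cmod_minus_pos. }
  assert (P : forall w, on_edge a b c d w -> cont_at (fun u => / (u - z)) w).
  { intros w Hw. apply diff_at_cont, diff_at_pole. now apply (interior_not_edge a b c d). }
  rewrite (rect_int_ext g (fun w => f w * / (w - z) + (- f z) * / (w - z))) in G; try lra.
  - rewrite rect_int_lin in G; try lra.
    + unfold winding. rewrite <- (Cplus_0_l (f z * _)), <- G. ring.
    + intros w Hw. apply cont_at_mult; [apply diff_at_cont, Hf, Hw|now apply P].
    + exact P.
  - intros w Hw. unfold g.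
    assert (N := interior_not_edge a b c d z w Hx Hy Hw).
    destruct (Ceq_dec w z) as [->|_]; [now elim N|ring].
Qed.

Lemma Re_inv (u : C) : Re (/ u) = (Re u / (Re u ^ 2 + Im u ^ 2))%R.
Proof. reflexivity. Qed.

Lemma Im_inv (u : C) : Im (/ u) = (- Im u / (Re u ^ 2 + Im u ^ 2))%R.
Proof. reflexivity. Qed.

Lemma sumsq_pos (u v : R) : (u <> 0 \/ v <> 0 -> 0 < u * (u * 1) + v * (v * 1))%R.
Proof.
  intros H. generalize (Rle_0_sqr u) (Rle_0_sqr v). unfold Rsqr.
  destruct H as [H|H]; generalize (Rsqr_pos_lt _ H); unfold Rsqr; lra.
Qed.

Lemma sumsq_le (u v U V : R) : (- U <= u <= U -> - V <= v <= V ->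
  u * (u * 1) + v * (v * 1) <= U ^ 2 + V ^ 2)%R.
Proof. intros Hu Hv. nra. Qed.

(** The imaginary part is positive: each side sees [z] on its left, so its
    contribution has a nonnegative integrand, and that of the bottom side is
    bounded below. *)
Lemma winding_neq_0 (a b c d : R) (z : C) :
  (a < Re z < b)%R -> (c < Im z < d)%R -> winding a b c d z <> 0.
Proof.
  intros Hx Hy E.
  assert (P : cont_edge (fun u => / (u - z)) a b c d).
  { intros w Hw. apply diff_at_cont, diff_at_pole. now apply (interior_not_edge a b c d). }
  destruct (ex_CInt_edges _ a b c d ltac:(lra) ltac:(lra) P) as [E1 E2].
  assert (I1 := Im_CInt _ _ _ E1). assert (R2 := Re_CInt _ _ _ E2).
  set (D := (((b - a) ^ 2 + (d - c) ^ 2))%R).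
  assert (HD : (0 < D)%R) by (unfold D; nra).
  set (h := fun x => / ((x, c) - z) - / ((x, d) - z)) in *.
  set (v := fun y => / ((b, y) - z) - / ((a, y) - z)) in *.
  assert (L1 : (forall x, a < x < b -> (Im z - c) / D <= Im (h x))%R ->
    ((b - a) * ((Im z - c) / D) <= Im (CInt h a b))%R).
  { exact (is_RInt_le (fun _ => (Im z - c) / D)%R _ a b _ _ ltac:(lra)
      (is_RInt_const a b ((Im z - c) / D)%R) I1). }
  assert (L2 : (forall y, c < y < d -> 0 <= Re (v y))%R ->
    ((d - c) * 0 <= Re (CInt v c d))%R).
  { exact (is_RInt_le (fun _ => 0)%R _ c d _ _ ltac:(lra) (is_RInt_const c d 0%R) R2). }
  assert (F : Im (winding a b c d z) = (Im (CInt h a b) + Re (CInt v c d))%R).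
  { unfold winding, rect_int. fold h v. unfold Im, Re. simpl. ring. }
  rewrite E in F.
  assert (A1 : ((b - a) * ((Im z - c) / D) <= Im (CInt h a b))%R).
  { apply L1. intros x Hx'.
    change (Im (h x)) with (Im (/ ((x, c) - z))%C - Im (/ ((x, d) - z))%C)%R.
    rewrite !Im_inv. unfold Re, Im in *; simpl.
    assert (Q1 : ((snd z - c) / D <= - (c + - snd z) /
      ((x + - fst z) * ((x + - fst z) * 1) + (c + - snd z) * ((c + - snd z) * 1)))%R).
    { replace (- (c + - snd z))%R with (snd z - c)%R by ring.
      apply Rmult_le_compat_l; [lra|]. apply Rinv_le_contravar; [apply sumsq_pos; lra|].
      unfold D. apply sumsq_le; lra. }
    assert (Q2 : (0 <= (d + - snd z) /
      ((x + - fst z) * ((x + - fst z) * 1) + (d + - snd z) * ((d + - snd z) * 1)))%R).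
    { apply Rlt_le, Rdiv_lt_0_compat; [lra|apply sumsq_pos; lra]. }
    unfold Rdiv in *. lra. }
  assert (A2 : ((d - c) * 0 <= Re (CInt v c d))%R).
  { apply L2. intros y Hy'.
    change (Re (v y)) with (Re (/ ((b, y) - z))%C - Re (/ ((a, y) - z))%C)%R.
    rewrite !Re_inv. unfold Re, Im in *; simpl.
    assert (Q1 : (0 <= (b + - fst z) /
      ((b + - fst z) * ((b + - fst z) * 1) + (y + - snd z) * ((y + - snd z) * 1)))%R)
      by (apply Rlt_le, Rdiv_lt_0_compat; [lra|apply sumsq_pos; lra]).
    assert (Q2 : (0 <= (fst z - a) /
      ((a + - fst z) * ((a + - fst z) * 1) + (y + - snd z) * ((y + - snd z) * 1)))%R)
      by (apply Rlt_le, Rdiv_lt_0_compat; [lra|apply sumsq_pos; lra]).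
    unfold Rdiv in *. lra. }
  assert (0 < (b - a) * ((Im z - c) / D))%R.
  { apply Rmult_lt_0_compat; [lra|]. apply Rdiv_lt_0_compat; lra. }
  replace (Im 0) with 0%R in F by reflexivity. lra.
Qed.

(** * Cauchy transforms and uniform limits *)

Lemma Rabs_Cmod_minus (u v : C) : (Rabs (Cmod u - Cmod v) <= Cmod (u - v))%R.
Proof.
  apply Rabs_le. assert (H1 := Cmod_triangle_inv u v). assert (H2 := Cmod_triangle_inv v u).
  rewrite (Cmod_minus_sym v u) in H2. lra.
Qed.

Lemma segment_bounded (g : R -> C) (a b : R) : (a <= b)%R ->
  (forall x, (a <= x <= b)%R -> forall e, (0 < e)%R -> exists r, (0 < r)%R /\
     forall t, (Rabs (t - x) < r)%R -> (Cmod (g t - g x) < e)%R) ->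
  exists M : R, forall x, (a <= x <= b)%R -> (Cmod (g x) <= M)%R.
Proof.
  intros Hab H. destruct (continuity_ab_maj (fun x => Cmod (g x)) a b Hab) as [m [Hm _]].
  - intros x Hx e He. destruct (H x Hx e He) as [r [Hr H']].
    exists r. split; [assumption|]. intros t [_ Ht].
    eapply Rle_lt_trans; [apply Rabs_Cmod_minus|]. now apply H'.
  - exists (Cmod (g m)). exact Hm.
Qed.

Lemma edge_bounded (f : C -> C) (a b c d : R) : (a <= b)%R -> (c <= d)%R ->
  cont_edge f a b c d ->
  exists M : R, (0 < M)%R /\ forall w, on_edge a b c d w -> (Cmod (f w) <= M)%R.
Proof.
  intros Hab Hcd H.
  assert (X : forall y, (y = c \/ y = d) -> exists M, forall x, (a <= x <= b)%R ->
    (Cmod (f (x, y)) <= M)%R).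
  { intros y Hy. apply (segment_bounded (fun x => f (x, y))); [assumption|].
    intros x Hx e He. destruct (H (x, y)) with (eps := e) as [r [Hr H']]; [|assumption|].
    - destruct Hy; subst y; edge.
    - exists r. split; [assumption|]. intros t Ht. apply H'. now rewrite Cmod_hor. }
  assert (Y : forall x, (x = a \/ x = b) -> exists M, forall y, (c <= y <= d)%R ->
    (Cmod (f (x, y)) <= M)%R).
  { intros x Hx. apply (segment_bounded (fun y => f (x, y))); [assumption|].
    intros y Hy e He. destruct (H (x, y)) with (eps := e) as [r [Hr H']]; [|assumption|].
    - destruct Hx; subst x; edge.
    - exists r. split; [assumption|]. intros t Ht. apply H'. now rewrite Cmod_ver. }
  destruct (X c) as [M1 H1]; auto. destruct (X d) as [M2 H2]; auto.
  destruct (Y a) as [M3 H3]; auto. destruct (Y b) as [M4 H4]; auto.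
  exists (Rabs M1 + Rabs M2 + Rabs M3 + Rabs M4 + 1)%R.
  assert (P := Rabs_pos). split; [generalize (P M1) (P M2) (P M3) (P M4); lra|].
  intros [x y] [[W1 W2] E]. unfold Re, Im in *. simpl in *.
  destruct E as [->|[->|[->| ->]]];
    [generalize (H1 x W1)|generalize (H2 x W1)|generalize (H3 y W2)|generalize (H4 y W2)];
    generalize (P M1) (P M2) (P M3) (P M4) (Rle_abs M1) (Rle_abs M2) (Rle_abs M3) (Rle_abs M4);
    lra.
Qed.

Lemma Rabs_Re_le (z : C) : (Rabs (Re z) <= Cmod z)%R.
Proof. eapply Rle_trans; [apply Rmax_l|apply Rmax_Cmod]. Qed.

Lemma Rabs_Im_le (z : C) : (Rabs (Im z) <= Cmod z)%R.
Proof. eapply Rle_trans; [apply Rmax_r|apply Rmax_Cmod]. Qed.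

Lemma edge_dist (a b c d r : R) (z : C) :
  (a + r <= Re z <= b - r)%R -> (c + r <= Im z <= d - r)%R ->
  forall w, on_edge a b c d w -> (r <= Cmod (w - z))%R.
Proof.
  intros Hx Hy w [_ H].
  assert (R1 := Rabs_Re_le (w - z)). assert (I1 := Rabs_Im_le (w - z)).
  unfold Re, Im in *. simpl in R1, I1.
  destruct H as [H|[H|[H|H]]]; rewrite H in *; revert R1 I1; unfold Rabs;
    repeat destruct Rcase_abs; lra.
Qed.

Lemma interior_dist (a b c d : R) (z : C) :
  (a < Re z < b)%R -> (c < Im z < d)%R ->
  exists r : R, (0 < r)%R /\ (forall w, on_edge a b c d w -> (r <= Cmod (w - z))%R) /\
  forall u, (Cmod (u - z) < r)%R -> (a < Re u < b)%R /\ (c < Im u < d)%R.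
Proof.
  intros Hx Hy.
  set (r := Rmin (Rmin (Re z - a) (b - Re z)) (Rmin (Im z - c) (d - Im z))).
  assert (Hr : (0 < r /\ r <= Re z - a /\ r <= b - Re z /\ r <= Im z - c /\ r <= d - Im z)%R).
  { unfold r. repeat split.
    - repeat apply Rmin_pos; lra.
    - eapply Rle_trans; [apply Rmin_l|apply Rmin_l].
    - eapply Rle_trans; [apply Rmin_l|apply Rmin_r].
    - eapply Rle_trans; [apply Rmin_r|apply Rmin_l].
    - eapply Rle_trans; [apply Rmin_r|apply Rmin_r]. }
  exists r. split; [apply Hr|]. split.
  - apply edge_dist; lra.
  - intros u Hu. assert (R1 := Rabs_Re_le (u - z)). assert (I1 := Rabs_Im_le (u - z)).
    unfold Re, Im in *. simpl in R1, I1. revert R1 I1. unfold Rabs.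
    repeat destruct Rcase_abs; lra.
Qed.

Definition cauchy_transform (g : C -> C) (a b c d : R) (z : C) : C :=
  rect_int (fun w => g w * / (w - z)) a b c d.

Lemma cont_edge_pole (g : C -> C) (a b c d : R) (z : C) :
  (a < Re z < b)%R -> (c < Im z < d)%R -> cont_edge g a b c d ->
  cont_edge (fun w => g w * / (w - z)) a b c d.
Proof.
  intros Hx Hy Hg w Hw. apply cont_at_mult; [now apply Hg|].
  apply diff_at_cont, diff_at_pole. now apply (interior_not_edge a b c d).
Qed.

(** This is the identity [1/(w-u) - 1/(w-z) = (u-z)/((w-z)(w-u))] under the
    integral sign. It exhibits the difference quotient of a Cauchy transform as
    another Cauchy transform, so that differentiability reduces to continuity. *)
Lemma cauchy_transform_diff_quot (g : C -> C) (a b c d : R) (z u : C) :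
  (a < Re z < b)%R -> (c < Im z < d)%R -> (a < Re u < b)%R -> (c < Im u < d)%R ->
  cont_edge g a b c d ->
  cauchy_transform g a b c d u = cauchy_transform g a b c d z +
    cauchy_transform (fun w => g w * / (w - z)) a b c d u * (u - z).
Proof.
  intros Hx Hy Hx' Hy' Hg. unfold cauchy_transform.
  rewrite (Cmult_comm _ (u - z)), <- rect_int_lin; try lra.
  - apply rect_int_ext; try lra. intros w Hw.
    assert (N1 := interior_not_edge a b c d z w Hx Hy Hw).
    assert (N2 := interior_not_edge a b c d u w Hx' Hy' Hw).
    field. split; apply Cmod_gt_0; now apply Cmod_minus_pos.
  - now apply cont_edge_pole.
  - now apply cont_edge_pole; [| |apply cont_edge_pole].
Qed.

Lemma cauchy_transform_bound (g : C -> C) (a b c d M r : R) (z : C) :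
  (a < Re z < b)%R -> (c < Im z < d)%R -> cont_edge g a b c d -> (0 < r)%R ->
  (forall w, on_edge a b c d w -> (Cmod (g w) <= M)%R) ->
  (forall w, on_edge a b c d w -> (r <= Cmod (w - z))%R) ->
  (Cmod (cauchy_transform g a b c d z) <= 2 * ((b - a) + (d - c)) * (M / r))%R.
Proof.
  intros Hx Hy Hg Hr HM Hd. apply Cmod_rect_int_le; try lra.
  - now apply cont_edge_pole.
  - intros w Hw. assert (D := Hd w Hw).
    rewrite Cmod_mult, Cmod_inv by (apply Cmod_gt_0; lra).
    apply Rmult_le_compat; try apply Cmod_ge_0; [|now apply HM|].
    + apply Rlt_le, Rinv_0_lt_compat. lra.
    + now apply Rinv_le_contravar.
Qed.

Lemma cauchy_transform_cont (g : C -> C) (a b c d : R) (z : C) :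
  (a < Re z < b)%R -> (c < Im z < d)%R -> cont_edge g a b c d ->
  cont_at (cauchy_transform g a b c d) z.
Proof.
  intros Hx Hy Hg e He.
  destruct (interior_dist a b c d z Hx Hy) as [r [Hr [H1 H2]]].
  destruct (edge_bounded _ a b c d ltac:(lra) ltac:(lra) (cont_edge_pole g a b c d z Hx Hy Hg))
    as [M [HM HMb]].
  set (K := (2 * ((b - a) + (d - c)) * (M / (r / 2)))%R).
  assert (HK : (0 < K)%R).
  { apply Rmult_lt_0_compat; [lra|]. apply Rdiv_lt_0_compat; lra. }
  exists (Rmin (r / 2) (e / K)). split.
  - apply Rmin_pos; [lra|]. now apply Rdiv_lt_0_compat.
  - intros u Hu. assert (Hu1 := Rlt_le_trans _ _ _ Hu (Rmin_l _ _)).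
    assert (Hu2 := Rlt_le_trans _ _ _ Hu (Rmin_r _ _)).
    destruct (H2 u ltac:(lra)) as [Ux Uy].
    rewrite (cauchy_transform_diff_quot g a b c d z u) by assumption.
    replace (_ + _ - _) with
      (cauchy_transform (fun w => g w * / (w - z)) a b c d u * (u - z)) by ring.
    rewrite Cmod_mult.
    apply Rle_lt_trans with (K * Cmod (u - z))%R.
    + apply Rmult_le_compat_r; [apply Cmod_ge_0|].
      apply cauchy_transform_bound; try assumption; [now apply cont_edge_pole|lra|].
      intros w Hw. replace (w - u) with ((w - z) - (u - z)) by ring.
      generalize (H1 w Hw) (Cmod_triangle_inv (w - z) (u - z)). lra.
    + apply (Rmult_lt_compat_l K) in Hu2; [|assumption].
      replace (K * (e / K))%R with e in Hu2 by (field; lra). exact Hu2.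
Qed.

Lemma cauchy_transform_diff (g : C -> C) (a b c d : R) (z : C) :
  (a < Re z < b)%R -> (c < Im z < d)%R -> cont_edge g a b c d ->
  diff_at (cauchy_transform g a b c d) z.
Proof.
  intros Hx Hy Hg. exists (cauchy_transform (fun w => g w * / (w - z)) a b c d). split.
  - apply cauchy_transform_cont; try assumption. now apply cont_edge_pole.
  - destruct (interior_dist a b c d z Hx Hy) as [r [Hr [_ H2]]].
    exists r. split; [assumption|]. intros u Hu. destruct (H2 u Hu) as [Ux Uy].
    now apply cauchy_transform_diff_quot.
Qed.

Lemma winding_transform (a b c d : R) (z : C) : (a < Re z < b)%R -> (c < Im z < d)%R ->
  winding a b c d z = cauchy_transform (fun _ => 1) a b c d z.
Proof. intros Hx Hy. apply rect_int_ext; try lra. intros w _. ring. Qed.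

Definition unif_on (P : C -> Prop) (F : nat -> C -> C) (g : C -> C) : Prop :=
  forall eps : R, (0 < eps)%R -> exists N0 : nat, forall N, (N0 <= N)%nat ->
  forall w, P w -> (Cmod (F N w - g w) < eps)%R.

Lemma unif_limit_cont (F : nat -> C -> C) (g : C -> C) (s : C) (r : R) : (0 < r)%R ->
  (forall N, cont_at (F N) s) -> unif_on (fun w => (Cmod (w - s) < r)%R) F g -> cont_at g s.
Proof.
  intros Hr HF H e He. destruct (H (e / 3)%R) as [N HN]; [lra|].
  specialize (HN N (le_n N)). destruct (HF N (e / 3)%R) as [r' [Hr' H']]; [lra|].
  exists (Rmin r r'). split; [now apply Rmin_pos|]. intros w Hw.
  assert (A := HN w (Rlt_le_trans _ _ _ Hw (Rmin_l _ _))).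
  assert (B := H' w (Rlt_le_trans _ _ _ Hw (Rmin_r _ _))).
  assert (D := HN s ltac:(now rewrite Cmod_self_minus)).
  rewrite Cmod_minus_sym in A.
  replace (g w - g s) with ((g w - F N w) + ((F N w - F N s) + (F N s - g s))) by ring.
  eapply Rle_lt_trans; [apply Cmod_triangle|].
  generalize (Cmod_triangle (F N w - F N s) (F N s - g s)). lra.
Qed.

(** Cauchy's formula for the limit alone: it passes to the uniform limit before
    the limit is known to be differentiable. *)
Lemma unif_limit_cauchy (F : nat -> C -> C) (g : C -> C) (a b c d : R) (z : C) :
  (a < Re z < b)%R -> (c < Im z < d)%R ->
  (forall N w, in_rect a b c d w -> diff_at (F N) w) -> cont_edge g a b c d ->
  unif_on (in_rect a b c d) F g ->
  cauchy_transform g a b c d z = g z * winding a b c d z.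
Proof.
  intros Hx Hy HF Hg H.
  destruct (interior_dist a b c d z Hx Hy) as [r [Hr [H1 _]]].
  set (W := winding a b c d z). set (K := (2 * ((b - a) + (d - c)) / r + Cmod W)%R).
  assert (HK : (0 < K)%R).
  { unfold K. generalize (Cmod_ge_0 W).
    assert (0 < 2 * ((b - a) + (d - c)) / r)%R by (apply Rdiv_lt_0_compat; lra). lra. }
  assert (B : forall e, (0 < e)%R ->
    (Cmod (cauchy_transform g a b c d z - g z * W) <= K * e)%R).
  { intros e He. destruct (H e He) as [N HN]. specialize (HN N (le_n N)).
    assert (CF : cont_edge (F N) a b c d) by (intros w [Hw _]; apply diff_at_cont, HF, Hw).
    assert (E := cauchy_formula (F N) a b c d z Hx Hy (HF N)). fold W in E.
    assert (T : cauchy_transform g a b c d z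
      = F N z * W + (-1) * cauchy_transform (fun w => F N w + (-1) * g w) a b c d z).
    { rewrite <- E. unfold cauchy_transform. rewrite <- rect_int_lin; try lra.
      - apply rect_int_ext; try lra. intros w _. ring.
      - now apply cont_edge_pole.
      - apply cont_edge_pole; try assumption. intros w Hw.
        apply cont_at_plus; [now apply CF|]. apply cont_at_mult; [apply cont_at_const|now apply Hg]. }
    rewrite T.
    replace (_ + _ - _) with ((F N z - g z) * W
      + (-1) * cauchy_transform (fun w => F N w + (-1) * g w) a b c d z) by ring.
    eapply Rle_trans; [apply Cmod_triangle|]. rewrite !Cmod_mult.
    replace (Cmod (-1)) with 1%R
      by (rewrite Cmod_R, Rabs_left by lra; ring).
    assert (Q1 : (Cmod (cauchy_transform (fun w => F N w + -1 * g w)%C a b c d z)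
      <= 2 * ((b - a) + (d - c)) * (e / r))%R).
    { apply cauchy_transform_bound; try assumption.
      - intros w Hw. apply cont_at_plus; [now apply CF|].
        apply cont_at_mult; [apply cont_at_const|now apply Hg].
      - intros w [Hw _]. replace (F N w + -1 * g w) with (F N w - g w) by ring.
        left. now apply HN. }
    assert (Q2 : (Cmod (F N z - g z) * Cmod W <= e * Cmod W)%R).
    { apply Rmult_le_compat_r; [apply Cmod_ge_0|]. left. apply HN. split; lra. }
    unfold K. replace ((2 * (b - a + (d - c)) / r + Cmod W) * e)%R
      with (2 * (b - a + (d - c)) * (e / r) + e * Cmod W)%R by (field; lra). lra. }
  destruct (Ceq_dec (cauchy_transform g a b c d z) (g z * W)) as [E|N]; [assumption|].
  apply Cmod_minus_pos in N.
  generalize (B (Cmod (cauchy_transform g a b c d z - g z * W) / (2 * K))%R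
    ltac:(apply Rdiv_lt_0_compat; lra)).
  replace (K * _)%R with (Cmod (cauchy_transform g a b c d z - g z * W) / 2)%R
    by (field; lra). lra.
Qed.

(** By [unif_limit_cauchy] the limit is the quotient of two Cauchy transforms of
    continuous functions, which are differentiable. *)
Lemma weierstrass (F : nat -> C -> C) (g : C -> C) (s : C) (r : R) : (0 < r)%R ->
  (forall N w, (Cmod (w - s) < r)%R -> diff_at (F N) w) ->
  unif_on (fun w => (Cmod (w - s) < r)%R) F g -> diff_at g s.
Proof.
  intros Hr HF H.
  set (a := (Re s - r / 4)%R). set (b := (Re s + r / 4)%R).
  set (c := (Im s - r / 4)%R). set (d := (Im s + r / 4)%R).
  assert (Hx : (a < Re s < b)%R) by (unfold a, b; lra).
  assert (Hy : (c < Im s < d)%R) by (unfold c, d; lra).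
  assert (Hin : forall w, in_rect a b c d w -> (Cmod (w - s) < r)%R).
  { intros w [W1 W2]. eapply Rle_lt_trans; [apply Cmod_le_Re_Im|].
    unfold a, b, c, d, Re, Im in *. simpl. unfold Rabs. repeat destruct Rcase_abs; lra. }
  assert (Hg : cont_edge g a b c d).
  { intros w [Hw _]. apply Hin in Hw.
    apply (unif_limit_cont F g w (r - Cmod (w - s))); [lra| |].
    - intros N. now apply diff_at_cont, HF.
    - intros e He. destruct (H e He) as [N0 HN]. exists N0. intros N LN u Hu. apply HN; [assumption|].
      replace (u - s) with ((u - w) + (w - s)) by ring.
      generalize (Cmod_triangle (u - w) (w - s)). lra. }
  assert (HU : unif_on (in_rect a b c d) F g).
  { intros e He. destruct (H e He) as [N0 HN]. exists N0. intros N LN w Hw. now apply HN, Hin. }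
  destruct (interior_dist a b c d s Hx Hy) as [r' [Hr' [_ H']]].
  apply (diff_at_ext_loc (fun z => cauchy_transform g a b c d z
    * / cauchy_transform (fun _ => 1) a b c d z) g s r' Hr').
  - intros z Hz. destruct (H' z Hz) as [Zx Zy].
    rewrite (unif_limit_cauchy F g a b c d z), winding_transform; try assumption.
    + field. rewrite <- winding_transform by assumption. now apply winding_neq_0.
    + intros N w Hw. now apply HF, Hin.
  - apply diff_at_mult; [now apply cauchy_transform_diff|]. apply diff_at_inv.
    + apply cauchy_transform_diff; try assumption. intros w _. apply cont_at_const.
    + rewrite <- winding_transform by assumption. now apply winding_neq_0.
Qed.

(** For every [n] the function [f(w) / (w - p)^n] is differentiable on the square,
    as [f] vanishes near [p]. On the edges [|w - p| >= r], so Cauchy's formula bounds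
    its value at [z] by a constant times [r^(-n)]; thus [|f z|] is at most a
    constant times [(|z - p| / r)^n]. *)
Lemma identity_theorem_square (f : C -> C) (p z : C) (r delta : R) : (0 < delta)%R ->
  (forall w, in_rect (Re p - r) (Re p + r) (Im p - r) (Im p + r) w -> diff_at f w) ->
  (forall w, (Cmod (w - p) < delta)%R -> f w = 0) ->
  (Cmod (z - p) < r)%R -> f z = 0.
Proof.
  intros Hdelta Hf H0 Hz.
  destruct (Ceq_dec z p) as [->|Nz]; [apply H0; now rewrite Cmod_self_minus|].
  assert (Pz := Cmod_minus_pos _ _ Nz).
  set (a := (Re p - r)%R) in *. set (b := (Re p + r)%R) in *.
  set (c := (Im p - r)%R) in *. set (d := (Im p + r)%R) in *.
  assert (Hin : (a < Re z < b)%R /\ (c < Im z < d)%R).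
  { assert (R1 := Rabs_Re_le (z - p)). assert (I1 := Rabs_Im_le (z - p)).
    unfold a, b, c, d, Re, Im in *. simpl in R1, I1. revert R1 I1. unfold Rabs.
    repeat destruct Rcase_abs; lra. }
  destruct Hin as [Hx Hy].
  destruct (interior_dist a b c d z Hx Hy) as [rho [Hrho [H1 _]]].
  destruct (edge_bounded f a b c d ltac:(lra) ltac:(lra)
    ltac:(intros w [Hw _]; now apply diff_at_cont, Hf)) as [M [HM HMb]].
  set (W := winding a b c d z).
  assert (HW : (0 < Cmod W)%R) by (apply Cmod_gt_0; now apply winding_neq_0).
  set (K := (2 * ((b - a) + (d - c)) * (M / rho))%R).
  assert (HK : (0 < K)%R).
  { apply Rmult_lt_0_compat; [lra|]. now apply Rdiv_lt_0_compat. }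
  assert (Hr : (0 < r)%R) by lra.
  assert (B : forall n, (Cmod (f z) * Cmod W <= K * (Cmod (z - p) / r) ^ n)%R).
  { intros n. set (h := fun w => f w * / (w - p) ^ n).
    assert (Hh : forall w, in_rect a b c d w -> diff_at h w).
    { intros w Hw. destruct (Ceq_dec w p) as [->|N].
      - apply (diff_at_ext_loc (fun _ => 0) h p delta Hdelta); [|apply diff_at_const].
        intros u Hu. unfold h. rewrite (H0 u Hu). ring.
      - unfold h. apply diff_at_mult; [now apply Hf|]. apply diff_at_inv.
        + apply diff_at_pow, diff_at_minus; [apply diff_at_id|apply diff_at_const].
        + apply Cpow_nz, Cmod_gt_0. now apply Cmod_minus_pos. }
    assert (E := cauchy_formula h a b c d z Hx Hy Hh). fold W in E.
    assert (Q : (Cmod (h z * W) <= 2 * ((b - a) + (d - c)) * (M / r ^ n / rho))%R).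
    { rewrite <- E. apply cauchy_transform_bound; try assumption.
      - intros w [Hw _]. now apply diff_at_cont, Hh.
      - intros w Hw. unfold h.
        assert (D := edge_dist a b c d r p ltac:(unfold a, b; lra) ltac:(unfold c, d; lra) w Hw).
        assert (D' : (r ^ n <= Cmod (w - p) ^ n)%R) by (apply pow_incr; lra).
        assert (D0 : (0 < r ^ n)%R) by now apply pow_lt.
        rewrite Cmod_mult, Cmod_inv by (apply Cpow_nz, Cmod_gt_0; lra).
        rewrite Cmod_pow. apply Rmult_le_compat; try apply Cmod_ge_0; [|now apply HMb|].
        + apply Rlt_le, Rinv_0_lt_compat. lra.
        + now apply Rinv_le_contravar. }
    assert (Pn : (0 < Cmod (z - p) ^ n)%R) by now apply pow_lt.
    assert (Rn : (0 < r ^ n)%R) by now apply pow_lt.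
    unfold h in Q. rewrite !Cmod_mult, Cmod_inv, Cmod_pow in Q
      by (apply Cpow_nz, Cmod_gt_0; lra).
    apply (Rmult_le_compat_r (Cmod (z - p) ^ n)) in Q; [|lra].
    unfold Rdiv in *. rewrite Rpow_mult_distr, pow_inv.
    replace (Cmod (f z) * Cmod W)%R with
      (Cmod (f z) * / Cmod (z - p) ^ n * Cmod W * Cmod (z - p) ^ n)%R by (field; lra).
    eapply Rle_trans; [exact Q|]. unfold K. apply Req_le. unfold Rdiv. ring. }
  destruct (Ceq_dec (f z) 0) as [E|N]; [assumption|exfalso]. apply Cmod_gt_0 in N.
  assert (P : (0 < Cmod (f z) * Cmod W)%R) by now apply Rmult_lt_0_compat.
  destruct (pow_lt_1_zero (Cmod (z - p) / r)) with (y := (Cmod (f z) * Cmod W / K)%R)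
    as [n Hn].
  - rewrite Rabs_pos_eq by (apply Rlt_le, Rdiv_lt_0_compat; lra).
    apply Rlt_div_l; lra.
  - now apply Rdiv_lt_0_compat.
  - specialize (Hn n (le_n n)). specialize (B n).
    rewrite Rabs_pos_eq in Hn by (apply pow_le, Rlt_le, Rdiv_lt_0_compat; lra).
    apply (Rmult_lt_compat_l K) in Hn; [|assumption].
    replace (K * (Cmod (f z) * Cmod W / K))%R with (Cmod (f z) * Cmod W)%R in Hn
      by (field; lra). lra.
Qed.

(** * Continuation into a punctured half plane *)

Definition vanishes_near (f : C -> C) (p : C) : Prop :=
  exists d : R, (0 < d)%R /\ forall w, (Cmod (w - p) < d)%R -> f w = 0.

Lemma vanishes_near_step (f : C -> C) (p z : C) (r : R) :
  (forall w, in_rect (Re p - r) (Re p + r) (Im p - r) (Im p + r) w -> diff_at f w) ->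
  vanishes_near f p -> (Cmod (z - p) < r)%R -> vanishes_near f z.
Proof.
  intros Hf [d [Hd H0]] Hz. exists (r - Cmod (z - p))%R. split; [lra|].
  intros w Hw. apply (identity_theorem_square f p w r d Hd Hf H0).
  replace (w - p) with ((w - z) + (z - p)) by ring.
  generalize (Cmod_triangle (w - z) (z - p)). lra.
Qed.

Lemma vanishes_near_half_plane (f : C -> C) (p : C) (x : R) : (x < Re p)%R ->
  (forall w, (x < Re w)%R -> f w = 0) -> vanishes_near f p.
Proof.
  intros Hp H. exists (Re p - x)%R. split; [lra|]. intros w Hw. apply H.
  assert (R1 := Rabs_Re_le (w - p)). unfold Re in *. simpl in R1. revert R1.
  unfold Rabs. destruct Rcase_abs; lra.
Qed.

Lemma punctured_half_plane_off_axis (x : R) (w : C) :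
  (x < Re w)%R -> Im w <> 0%R -> punctured_half_plane x w.
Proof. intros H N. split; [assumption|]. intros ->. now apply N. Qed.

(** The horizontal line through [s] stays away from the puncture, so squares of one
    fixed size lead along it from [Re > 1] to [s]. *)
Lemma vanishes_off_axis (f : C -> C) (x0 : R) (s : C) :
  (forall w, punctured_half_plane x0 w -> diff_at f w) ->
  (forall w, (1 < Re w)%R -> f w = 0) ->
  (x0 < Re s)%R -> Im s <> 0%R -> vanishes_near f s.
Proof.
  intros Hf H1 Hx Hy.
  set (r := Rmin (Rabs (Im s) / 2) ((Re s - x0) / 2)).
  assert (Hr : (0 < r /\ r <= Rabs (Im s) / 2 /\ r <= (Re s - x0) / 2)%R).
  { unfold r. repeat split; [|apply Rmin_l|apply Rmin_r].
    generalize (Rabs_pos_lt _ Hy). intros. apply Rmin_pos; lra. }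
  clearbody r. destruct Hr as [R0 [R1 R2]].
  destruct (nfloor_ex (Rmax 0 ((1 - Re s) / (r / 2)))) as [m [_ Hm]]; [apply Rmax_l|].
  set (M := S m). assert (HM : (1 < Re s + INR M * (r / 2))%R).
  { assert (Q : ((1 - Re s) / (r / 2) < INR M)%R).
    { unfold M. rewrite S_INR. eapply Rle_lt_trans; [apply (Rmax_r 0)|exact Hm]. }
    apply Rlt_div_l in Q; lra. }
  clearbody M.
  (* The centres move left by half the radius, from [p 0] with real part above 1
     to [p M = s]. *)
  set (p := fun n => (Re s + (INR M - INR n) * (r / 2), Im s)%R : C).
  assert (V : forall n, (n <= M)%nat -> vanishes_near f (p n)).
  { induction n as [|n IH]; intros Hn.
    - apply (vanishes_near_half_plane f (p 0%nat) 1); [|assumption].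
      unfold p, Re; simpl. unfold Re in HM. lra.
    - apply (vanishes_near_step f (p n) (p (S n)) r); [|apply IH; lia|].
      + intros w [W1 W2]. apply Hf, punctured_half_plane_off_axis.
        * apply le_INR in Hn. rewrite S_INR in Hn.
          assert (0 <= (INR M - INR n) * (r / 2))%R by (apply Rmult_le_pos; lra).
          unfold p, Re in *; simpl fst in *. lra.
        * unfold p, Re, Im in *; simpl in *. intros E. rewrite E in W2.
          revert R1. unfold Rabs. destruct Rcase_abs; lra.
      + unfold p. rewrite Cmod_hor, S_INR. rewrite Rabs_left; lra. }
  replace s with (p M); [now apply V|].
  destruct s as [x y]. unfold p, Re, Im; simpl. f_equal. ring.
Qed.

(** A real point [x <> 1] lies in a square centred slightly above the axis that
    avoids 1, which reduces it to the previous case. *)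
Lemma identity_punctured_half_plane (f : C -> C) (x0 : R) :
  (forall w, punctured_half_plane x0 w -> diff_at f w) ->
  (forall w, (1 < Re w)%R -> f w = 0) ->
  forall s, punctured_half_plane x0 s -> f s = 0.
Proof.
  intros Hf H1 s [Hx Hs].
  assert (Z : forall p, vanishes_near f p -> f p = 0).
  { intros p [d [Hd H]]. apply H. now rewrite Cmod_self_minus. }
  destruct (Req_dec (Im s) 0) as [E|N]; [|now apply Z, (vanishes_off_axis f x0)].
  destruct s as [x y]. unfold Re, Im in *; simpl in *. subst y.
  assert (N : x <> 1%R) by (intros ->; now apply Hs).
  set (t := (Rmin (Rabs (x - 1)) (x - x0) / 4)%R).
  assert (Ht : (0 < t /\ t <= Rabs (x - 1) / 4 /\ t <= (x - x0) / 4)%R).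
  { assert (0 < Rabs (x - 1))%R by (apply Rabs_pos_lt; lra).
    unfold t. generalize (Rmin_l (Rabs (x - 1)) (x - x0)) (Rmin_r (Rabs (x - 1)) (x - x0)).
    assert (0 < Rmin (Rabs (x - 1)) (x - x0))%R by (apply Rmin_pos; lra). lra. }
  clearbody t. destruct Ht as [T0 [T1 T2]].
  apply Z, (vanishes_near_step f (x, t) (x, 0%R) (2 * t)).
  - intros w [W1 W2]. unfold Re, Im in *; simpl in *. apply Hf. split; [unfold Re; lra|].
    intros ->. simpl in *. revert T1. unfold Rabs. destruct Rcase_abs; lra.
  - apply (vanishes_off_axis f x0); try assumption; unfold Re, Im; simpl; lra.
  - rewrite Cmod_ver, Rabs_left; lra.
Qed.

(** * Complex powers of a positive real variable *)

Definition deriv_RC (f : R -> C) (t : R) (l : C) : Prop :=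
  is_derive (fun x => Re (f x)) t (Re l) /\ is_derive (fun x => Im (f x)) t (Im l).

(** The mean value theorem is applied to both components, hence the factor 2. *)
Lemma mean_value_RC (f df : R -> C) (a b M : R) : (a <= b)%R ->
  (forall t, (a <= t <= b)%R -> deriv_RC f t (df t) /\ (Cmod (df t) <= M)%R) ->
  (Cmod (f b - f a) <= 2 * M * (b - a))%R.
Proof.
  intros Hab H. destruct (Req_dec a b) as [->|N].
  { rewrite Cmod_self_minus. lra. }
  assert (Hab' : (a < b)%R) by lra.
  destruct (MVT_cor2 (fun x => Re (f x)) (fun x => Re (df x)) a b Hab')
    as [c1 [E1 H1]]; [intros t Ht; apply is_derive_Reals; now apply H|].
  destruct (MVT_cor2 (fun x => Im (f x)) (fun x => Im (df x)) a b Hab')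
    as [c2 [E2 H2]]; [intros t Ht; apply is_derive_Reals; now apply H|].
  eapply Rle_trans; [apply Cmod_le_Re_Im|].
  change (Re (f b - f a)) with (Re (f b) - Re (f a))%R.
  change (Im (f b - f a)) with (Im (f b) - Im (f a))%R.
  rewrite E1, E2, !Rabs_mult, (Rabs_pos_eq (b - a)) by lra.
  destruct (H c1 ltac:(lra)) as [_ B1]. destruct (H c2 ltac:(lra)) as [_ B2].
  generalize (Rabs_Re_le (df c1)) (Rabs_Im_le (df c2)). intros. nra.
Qed.

Lemma deriv_RC_lin (f g : R -> C) (k : C) (t : R) (l m : C) :
  deriv_RC f t l -> deriv_RC g t m -> deriv_RC (fun x => f x + k * g x) t (l + k * m).
Proof.
  intros [F1 F2] [G1 G2]. destruct k as [k1 k2]. split.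
  - exact (is_derive_plus _ _ _ _ _ F1 (is_derive_minus _ _ _ _ _
      (is_derive_scal _ _ k1 _ G1) (is_derive_scal _ _ k2 _ G2))).
  - exact (is_derive_plus _ _ _ _ _ F2 (is_derive_plus _ _ _ _ _
      (is_derive_scal _ _ k1 _ G2) (is_derive_scal _ _ k2 _ G1))).
Qed.

Lemma deriv_RC_const (k : C) (t : R) : deriv_RC (fun _ => k) t 0.
Proof. split; apply @is_derive_const. Qed.

Lemma deriv_RC_ext (f g : R -> C) (t : R) (l : C) :
  (forall x, f x = g x) -> deriv_RC f t l -> deriv_RC g t l.
Proof.
  intros E [D1 D2]. split.
  - apply (is_derive_ext (fun x => Re (f x))); [|assumption]. intros x. now rewrite E.
  - apply (is_derive_ext (fun x => Im (f x))); [|assumption]. intros x. now rewrite E.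
Qed.

Lemma deriv_RC_mult (k : C) (f : R -> C) (t : R) (l : C) :
  deriv_RC f t l -> deriv_RC (fun x => k * f x) t (k * l).
Proof.
  intros H. replace (k * l) with (0 + k * l) by ring.
  apply (deriv_RC_ext (fun x => 0 + k * f x)); [intros; ring|].
  apply (deriv_RC_lin (fun _ => 0)); [apply deriv_RC_const|assumption].
Qed.

Lemma deriv_RC_opp_id (t : R) : deriv_RC (fun x => - RtoC x) t (-1).
Proof.
  split.
  - assert (X := is_derive_opp _ _ _ (is_derive_id t)). exact X.
  - simpl. apply (is_derive_ext (fun _ => 0)%R); [intros; simpl; ring|].
    assert (X := @is_derive_const R_AbsRing R_NormedModule 0%R t). exact X.
Qed.

Lemma deriv_RC_Cexp (s : C) (u : R -> R) (t du : R) : is_derive u t du ->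
  deriv_RC (fun x => Cexp (s * RtoC (u x))) t (s * RtoC du * Cexp (s * RtoC (u t))).
Proof.
  intros Hu. destruct s as [a b]. unfold deriv_RC, Cexp, Re, Im; simpl. split.
  - auto_derive; [split; [now exists du|split; [now exists du|exact I]]|].
    replace (Derive _ t) with du by (symmetry; now apply is_derive_unique).
    unfold Rminus. ring.
  - auto_derive; [split; [now exists du|split; [now exists du|exact I]]|].
    replace (Derive _ t) with du by (symmetry; now apply is_derive_unique).
    unfold Rminus. ring.
Qed.

Lemma exp_monotone (x y : R) : (x <= y)%R -> (exp x <= exp y)%R.
Proof. intros [H| ->]; [left; now apply exp_increasing|apply Rle_refl]. Qed.

Lemma Cmod_Cexp (z : C) : Cmod (Cexp z) = exp (Re z).
Proof.
  unfold Cmod, Cexp; simpl.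
  replace (_ + _)%R with (exp (Re z) * exp (Re z) *
    (Rsqr (sin (Im z)) + Rsqr (cos (Im z))))%R by (unfold Rsqr; ring).
  rewrite sin2_cos2, Rmult_1_r. apply sqrt_square. left. apply exp_pos.
Qed.

Lemma Cexp_plus (z w : C) : Cexp (z + w) = Cexp z * Cexp w.
Proof.
  unfold Cexp, Re, Im. apply injective_projections; simpl;
    rewrite ?cos_plus, ?sin_plus, exp_plus; ring.
Qed.

Lemma Cexp_0 : Cexp 0 = 1.
Proof.
  unfold Cexp, Re, Im. simpl. rewrite exp_0, cos_0, sin_0.
  apply injective_projections; simpl; ring.
Qed.

Lemma Cexp_ray (h : C) (t : R) :
  deriv_RC (fun x => Cexp (h * RtoC x)) t (h * Cexp (h * RtoC t)).
Proof.
  assert (H := deriv_RC_Cexp h (fun x => x) t 1 (is_derive_id t)).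
  now rewrite Cmult_1_r in H.
Qed.

(** The mean value inequality along the segment from 0 to [h]. *)
Lemma Cexp_sub1_le (h : C) : (Cmod (Cexp h - 1) <= 2 * (Cmod h * exp (Cmod h)))%R.
Proof.
  assert (H := mean_value_RC (fun x => Cexp (h * RtoC x)) (fun x => h * Cexp (h * RtoC x))
    0 1 (Cmod h * exp (Cmod h)) ltac:(lra)).
  cbv beta in H. rewrite Cmult_1_r, Cmult_0_r, Cexp_0, Rminus_0_r, Rmult_1_r in H. apply H.
  intros t Ht. split; [apply Cexp_ray|].
  rewrite Cmod_mult, Cmod_Cexp. apply Rmult_le_compat_l; [apply Cmod_ge_0|].
  apply exp_monotone. eapply Rle_trans; [apply Rle_abs|]. eapply Rle_trans; [apply Rabs_Re_le|].
  rewrite Cmod_mult, Cmod_R, Rabs_pos_eq by lra. generalize (Cmod_ge_0 h). nra.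
Qed.

(** The mean value inequality for [exp (h t) - h t], whose derivative is small by
    [Cexp_sub1_le]. *)
Lemma Cexp_order2 (h : C) :
  (Cmod (Cexp h - 1 - h) <= 4 * (Cmod h * (Cmod h * exp (Cmod h))))%R.
Proof.
  assert (H := mean_value_RC (fun x => Cexp (h * RtoC x) + h * (- RtoC x))
    (fun x => h * Cexp (h * RtoC x) + h * (-1))
    0 1 (Cmod h * (2 * (Cmod h * exp (Cmod h)))) ltac:(lra)).
  cbv beta in H. rewrite Cmult_1_r, Cmult_0_r, Cexp_0, Rminus_0_r, Rmult_1_r in H.
  replace (Cexp h - 1 - h) with (Cexp h + h * - (1) - (1 + h * - 0)) by ring.
  eapply Rle_trans; [apply H|lra].
  intros t Ht. split.
  - apply deriv_RC_lin; [apply Cexp_ray|apply deriv_RC_opp_id].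
  - replace (h * Cexp (h * RtoC t) + h * (-1)) with (h * (Cexp (h * RtoC t) - 1)) by ring.
    rewrite Cmod_mult. apply Rmult_le_compat_l; [apply Cmod_ge_0|].
    eapply Rle_trans; [apply Cexp_sub1_le|].
    assert (Q : (Cmod (h * RtoC t) <= Cmod h)%R).
    { rewrite Cmod_mult, Cmod_R, Rabs_pos_eq by lra. generalize (Cmod_ge_0 h). nra. }
    apply Rmult_le_compat_l; [lra|].
    apply Rmult_le_compat; [apply Cmod_ge_0|left; apply exp_pos|assumption|now apply exp_monotone].
Qed.

Lemma diff_at_Cexp (z : C) : diff_at Cexp z.
Proof.
  set (q := fun w => if Ceq_dec w z then Cexp z else (Cexp w - Cexp z) / (w - z)).
  exists q. split.
  - intros e He. set (K := (4 * exp 1 * Cmod (Cexp z) + 1)%R).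
    assert (HK : (1 <= K)%R).
    { unfold K. generalize (Cmod_ge_0 (Cexp z)) (exp_pos 1). nra. }
    exists (Rmin 1 (e / K)). split.
    { apply Rmin_pos; [lra|]. apply Rdiv_lt_0_compat; lra. }
    intros w Hw. assert (W1 := Rlt_le_trans _ _ _ Hw (Rmin_l _ _)).
    assert (W2 := Rlt_le_trans _ _ _ Hw (Rmin_r _ _)). unfold q.
    destruct (Ceq_dec z z) as [_|N]; [|now elim N].
    destruct (Ceq_dec w z) as [->|N]; [now rewrite Cmod_self_minus|].
    assert (P := Cmod_minus_pos _ _ N). assert (N' : w - z <> 0) by now apply Cmod_gt_0.
    replace (Cexp w) with (Cexp z * Cexp (w - z)) by (rewrite <- Cexp_plus; f_equal; ring).
    set (h := w - z) in *.
    replace ((Cexp z * Cexp h - Cexp z) / h - Cexp z)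
      with (Cexp z * ((Cexp h - 1 - h) / h)) by now field.
    rewrite Cmod_mult, Cmod_div by assumption.
    assert (B := Cexp_order2 h).
    assert (B' : (Cmod (Cexp h - 1 - h) / Cmod h <= 4 * exp 1 * Cmod h)%R).
    { apply Rle_div_l; [assumption|]. eapply Rle_trans; [apply B|].
      assert (exp (Cmod h) <= exp 1)%R by (apply exp_monotone; lra). nra. }
    apply Rle_lt_trans with (K * Cmod h)%R.
    + unfold K. generalize (Cmod_ge_0 (Cexp z)). intros. nra.
    + apply (Rmult_lt_compat_l K) in W2; [|lra].
      replace (K * (e / K))%R with e in W2 by (field; lra). exact W2.
  - exists 1%R. split; [lra|]. intros w _. unfold q.
    destruct (Ceq_dec w z) as [->|N]; [ring|]. field.
    apply Cmod_gt_0. now apply Cmod_minus_pos.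
Qed.

Definition cpow (x : R) (s : C) : C := Cexp (s * RtoC (ln x)).

Lemma Cmod_cpow (x : R) (s : C) : Cmod (cpow x s) = Rpower x (Re s).
Proof.
  unfold cpow, Rpower. rewrite Cmod_Cexp. f_equal. destruct s. simpl. ring.
Qed.

Lemma cpow_1_r (x : R) : (0 < x)%R -> cpow x 1 = RtoC x.
Proof.
  intros Hx. unfold cpow, Cexp, Re, Im. apply injective_projections; simpl.
  - replace (1 * ln x - 0 * 0)%R with (ln x) by ring.
    replace (1 * 0 + 0 * ln x)%R with 0%R by ring. rewrite exp_ln, cos_0 by assumption. ring.
  - replace (1 * 0 + 0 * ln x)%R with 0%R by ring. rewrite sin_0. ring.
Qed.

Lemma cpow_plus (x : R) (s t : C) : cpow x (s + t) = cpow x s * cpow x t.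
Proof. unfold cpow. rewrite <- Cexp_plus. f_equal. ring. Qed.

Lemma cpow_mult (x y : R) (s : C) : (0 < x)%R -> (0 < y)%R ->
  cpow (x * y) s = cpow x s * cpow y s.
Proof.
  intros Hx Hy. unfold cpow. rewrite <- Cexp_plus. f_equal.
  rewrite ln_mult, RtoC_plus by assumption. ring.
Qed.

Lemma deriv_RC_cpow (x : R) (s : C) : (0 < x)%R ->
  deriv_RC (fun t => cpow t (- s)) x (- s * cpow x (- (s + 1))).
Proof.
  intros Hx. assert (H := deriv_RC_Cexp (- s) ln x (/ x) (is_derive_ln x Hx)).
  unfold cpow at 2. replace (- (s + 1)) with (- s + (- (1))) by ring.
  fold (cpow x (- s + - (1))). rewrite cpow_plus.
  assert (E : cpow x (- (1)) = RtoC (/ x)).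
  { assert (Q : cpow x (- (1)) * cpow x 1 = 1).
    { rewrite <- cpow_plus. replace (- (1) + 1) with (RtoC 0) by ring.
      unfold cpow. now rewrite Cmult_0_l, Cexp_0. }
    rewrite cpow_1_r in Q by assumption. rewrite RtoC_inv by lra.
    assert (RtoC x <> 0) by (intros E; injection E; lra).
    transitivity (cpow x (- (1)) * RtoC x * / RtoC x); [now field|]. rewrite Q. ring. }
  rewrite E. replace (- s * (cpow x (- s) * RtoC (/ x)))
    with (- s * RtoC (/ x) * Cexp (- s * RtoC (ln x))) by (unfold cpow; ring).
  exact H.
Qed.

(** * Finite complex sums *)

Definition csum (u : nat -> C) (n : nat) : C := sum_n_m u 1 n.

Lemma csum_0 (u : nat -> C) : csum u 0 = RtoC 0.
Proof. apply (@sum_n_m_zero C_AbelianMonoid). lia. Qed.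

Lemma csum_S (u : nat -> C) (n : nat) :
  csum u (S n) = csum u n + u (S n).
Proof. apply (@sum_n_Sm C_AbelianMonoid). lia. Qed.

Lemma csum_ext (u v : nat -> C) (n : nat) :
  (forall i, (1 <= i <= n)%nat -> u i = v i) -> csum u n = csum v n.
Proof.
  intros H. apply (@sum_n_m_ext_loc C_AbelianMonoid). exact H.
Qed.

Lemma csum_lin (u v : nat -> C) (k : C) (n : nat) :
  csum (fun i => u i + k * v i) n = csum u n + k * csum v n.
Proof.
  induction n as [|n IH]; [rewrite !csum_0; ring|]. rewrite !csum_S, IH. ring.
Qed.

Lemma csum_mult (u : nat -> C) (k : C) (n : nat) :
  csum (fun i => k * u i) n = k * csum u n.
Proof.
  induction n as [|n IH]; [rewrite !csum_0; ring|]. rewrite !csum_S, IH. ring.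
Qed.

Lemma csum_const (k : C) (n : nat) : csum (fun _ => k) n = RtoC (INR n) * k.
Proof.
  induction n as [|n IH]; [rewrite csum_0; simpl; ring|].
  rewrite csum_S, IH, S_INR, RtoC_plus. ring.
Qed.

Lemma csum_add (u : nat -> C) (p n : nat) :
  csum u (p + n) = csum u p + csum (fun i => u (p + i)%nat) n.
Proof.
  induction n as [|n IH]; [rewrite csum_0, Nat.add_0_r; ring|].
  rewrite Nat.add_succ_r, !csum_S, IH, Nat.add_succ_r. ring.
Qed.

Lemma Cmod_csum_le (u : nat -> C) (n : nat) (M : R) :
  (forall i, (1 <= i <= n)%nat -> (Cmod (u i) <= M)%R) ->
  (Cmod (csum u n) <= INR n * M)%R.
Proof.
  induction n as [|n IH]; intros H; [rewrite csum_0, Cmod_0; simpl; lra|].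
  rewrite csum_S, S_INR. eapply Rle_trans; [apply Cmod_triangle|].
  generalize (IH ltac:(intros; apply H; lia)) (H (S n) ltac:(lia)). lra.
Qed.

Lemma diff_at_csum (u : nat -> C -> C) (n : nat) (s : C) :
  (forall i, (1 <= i <= n)%nat -> diff_at (u i) s) ->
  diff_at (fun s => csum (fun i => u i s) n) s.
Proof.
  induction n as [|n IH]; intros H.
  - apply (diff_at_ext (fun _ => 0)); [intros; now rewrite csum_0|apply diff_at_const].
  - apply (diff_at_ext (fun s => csum (fun i => u i s) n + u (S n) s)).
    + intros w. now rewrite csum_S.
    + apply diff_at_plus; [apply IH; intros; apply H; lia|apply H; lia].
Qed.

Lemma deriv_RC_csum (u : nat -> R -> C) (du : nat -> C) (n : nat) (t : R) :
  (forall i, (1 <= i <= n)%nat -> deriv_RC (u i) t (du i)) ->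
  deriv_RC (fun x => csum (fun i => u i x) n) t (csum du n).
Proof.
  induction n as [|n IH]; intros H.
  - rewrite csum_0. apply (deriv_RC_ext (fun _ => 0)); [intros; now rewrite csum_0|apply deriv_RC_const].
  - rewrite csum_S.
    replace (csum du n + du (S n)) with (csum du n + 1 * du (S n)) by ring.
    apply (deriv_RC_ext (fun x => csum (fun i => u i x) n + 1 * u (S n) x)).
    + intros x. rewrite csum_S. ring.
    + apply deriv_RC_lin; [apply IH; intros; apply H; lia|apply H; lia].
Qed.

(** * Iterated differences of complex powers *)

Lemma acoef_lt (c i : nat) : (1 <= i < c)%nat -> acoef c i = 1.
Proof.
  intros H. unfold acoef. rewrite Nat.mod_small by lia.
  destruct (Nat.eqb_spec i 0); [lia|reflexivity].
Qed.

Lemma acoef_mul (c m : nat) : (1 <= c)%nat -> acoef c (c * m) = 1 - RtoC (INR c).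
Proof.
  intros H. unfold acoef. rewrite Nat.mul_comm, Nat.Div0.mod_mul. reflexivity.
Qed.

Lemma acoef_self (c : nat) : (1 <= c)%nat -> acoef c c = 1 - RtoC (INR c).
Proof. intros H. rewrite <- (acoef_mul c 1), Nat.mul_1_r by assumption. reflexivity. Qed.

Lemma acoef_periodic (c m i : nat) : acoef c (c * m + i) = acoef c i.
Proof.
  unfold acoef. rewrite (Nat.add_comm (c * m)), (Nat.mul_comm c m), Nat.Div0.mod_add.
  reflexivity.
Qed.

Lemma Cmod_acoef (c i : nat) : (2 <= c)%nat -> (1 <= Cmod (acoef c i) <= INR c)%R.
Proof.
  intros H. apply le_INR in H. simpl in H. unfold acoef. destruct Nat.eqb.
  - rewrite <- RtoC_minus, Cmod_R, Rabs_left1 by lra. lra.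
  - rewrite Cmod_1. lra.
Qed.

Lemma acoef_sum (c : nat) (v : nat -> C) : (1 <= c)%nat ->
  csum (fun i => acoef c i * v i) c = csum v c - RtoC (INR c) * v c.
Proof.
  intros H. destruct c as [|c]; [lia|]. rewrite !csum_S, acoef_self by lia.
  rewrite (csum_ext (fun i => acoef (S c) i * v i) v).
  - ring.
  - intros i Hi. rewrite acoef_lt by lia. ring.
Qed.

Lemma acoef_sum_const (c : nat) (k : C) : (1 <= c)%nat ->
  csum (fun i => acoef c i * k) c = RtoC 0.
Proof. intros H. rewrite (acoef_sum c (fun _ => k)), csum_const by assumption. ring. Qed.

(** [first_moment c] is the factor by which the difference operator approximates
    a derivative. *)
Definition first_moment (c : nat) : C := csum (fun i => acoef c i * RtoC (INR i)) c.

Lemma first_moment_neq_0 (c : nat) : (2 <= c)%nat -> first_moment c <> 0.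
Proof.
  intros H. unfold first_moment. rewrite acoef_sum by lia.
  assert (G : forall n, csum (fun i => RtoC (INR i)) n
    = RtoC (INR n * (INR n + 1) / 2)).
  { induction n as [|n IH]; [rewrite csum_0; simpl; f_equal; field|].
    rewrite csum_S, IH, <- RtoC_plus. f_equal. rewrite S_INR. field. }
  rewrite G, <- RtoC_mult, <- RtoC_minus. apply le_INR in H. simpl in H.
  intros E. injection E. nra.
Qed.

(** The iterated differences extended to a real argument, where they can be
    differentiated. *)
Fixpoint pdiff (c k : nat) (s : C) (x : R) : C :=
  match k with
  | O => cpow x (- s)
  | S k' => csum (fun i => acoef c i * pdiff c k' s (x + INR i)) c
  end.

Lemma gdiff_pow_pdiff (c k : nat) (s : C) (n : nat) :
  gdiff_pow c k s n = pdiff c k s (INR n).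
Proof.
  unfold gdiff_pow. revert n. induction k as [|k IH]; intros n; simpl; [reflexivity|].
  apply csum_ext. intros i Hi. now rewrite IH, plus_INR.
Qed.

(** Differentiation commutes with the difference operator, so it only shifts the
    exponent. This drives the inductions on [k] below. *)
Lemma deriv_RC_pdiff (c k : nat) (s : C) (x : R) : (0 < x)%R ->
  deriv_RC (pdiff c k s) x (- s * pdiff c k (s + 1) x).
Proof.
  revert x. induction k as [|k IH]; intros x Hx; simpl; [now apply deriv_RC_cpow|].
  rewrite <- csum_mult.
  apply (deriv_RC_csum (fun i t => acoef c i * pdiff c k s (t + INR i))).
  intros i Hi. generalize (pos_INR i). intros Pi.
  assert (D := IH (x + INR i)%R ltac:(lra)).
  set (l := - s * pdiff c k (s + 1) (x + INR i)) in *.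
  assert (D' : deriv_RC (fun t => pdiff c k s (t + INR i)) x l).
  { destruct D as [D1 D2]. split.
    - assert (X := is_derive_comp (fun t => Re (pdiff c k s t)) (fun t => t + INR i)%R x _ _ D1
        (is_derive_plus _ _ _ _ _ (is_derive_id x) (is_derive_const (INR i) x))).
      unfold scal, plus, zero, one in X; simpl in X. unfold mult, one in X; simpl in X.
      replace (Re l) with ((1 + 0) * Re l)%R by ring. exact X.
    - assert (X := is_derive_comp (fun t => Im (pdiff c k s t)) (fun t => t + INR i)%R x _ _ D2
        (is_derive_plus _ _ _ _ _ (is_derive_id x) (is_derive_const (INR i) x))).
      unfold scal, plus, zero, one in X; simpl in X. unfold mult, one in X; simpl in X.
      replace (Im l) with ((1 + 0) * Im l)%R by ring. exact X. }
  replace (- s * (acoef c i * pdiff c k (s + 1) (x + INR i))) with (acoef c i * l)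
    by (unfold l; ring).
  now apply deriv_RC_mult.
Qed.

Lemma Rpower_shift_le (c : nat) (x t e E : R) : (1 <= x)%R -> (x <= t <= x + INR c)%R ->
  (Rabs e <= E)%R -> (Rpower t e <= Rpower (1 + INR c) E * Rpower x e)%R.
Proof.
  intros Hx Ht He. assert (Pc := pos_INR c).
  replace t with ((t / x) * x)%R by (field; lra).
  assert (T1 : (1 <= t / x)%R) by (apply Rle_div_r; lra).
  assert (T2 : (t / x <= 1 + INR c)%R) by (apply Rle_div_l; [lra|nra]).
  rewrite <- Rpower_mult_distr by lra.
  apply Rmult_le_compat_r; [left; apply exp_pos|].
  unfold Rpower. apply exp_monotone.
  assert (L0 : (0 <= ln (t / x))%R) by (rewrite <- ln_1; apply ln_le; lra).
  assert (L1 : (ln (t / x) <= ln (1 + INR c))%R) by (apply ln_le; lra).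
  apply Rle_trans with (E * ln (t / x))%R.
  - apply Rmult_le_compat_r; [assumption|]. generalize (Rle_abs e). lra.
  - apply Rmult_le_compat_l; [|assumption]. generalize (Rabs_pos e). lra.
Qed.

Lemma weighted_sum_le (c : nat) (v : nat -> C) (M : R) : (2 <= c)%nat ->
  (forall i, (1 <= i <= c)%nat -> (Cmod (v i) <= M)%R) ->
  (Cmod (csum (fun i => acoef c i * v i)%C c) <= INR c * (INR c * M))%R.
Proof.
  intros Hc H. apply Cmod_csum_le. intros i Hi. rewrite Cmod_mult.
  apply Rmult_le_compat; try apply Cmod_ge_0; [apply Cmod_acoef; lia|now apply H].
Qed.

Lemma INR_index (c i : nat) : (1 <= i <= c)%nat -> (0 <= INR i <= INR c)%R.
Proof. intros [_ H]. split; [apply pos_INR|now apply le_INR]. Qed.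

(** One more difference costs a derivative by the mean value theorem, that is,
    the passage from [s] to [s + 1] at order [k]. The induction therefore quantifies over all
    [s] in a disc, whose radius grows by 1 at each step. *)
Lemma pdiff_upper (c k : nat) (R0 : R) : (2 <= c)%nat -> (0 <= R0)%R ->
  exists A : R, (0 < A)%R /\ forall (s : C) (x : R), (Cmod s <= R0)%R -> (1 <= x)%R ->
  (Cmod (pdiff c k s x) <= A * Rpower x (- (Re s + INR k)))%R.
Proof.
  intros Hc. revert R0. induction k as [|k IH]; intros R0 HR.
  { exists 1%R. split; [lra|]. intros s x _ Hx. simpl. rewrite Cmod_cpow.
    replace (- (Re s + 0))%R with (Re (- s)) by (destruct s; simpl; ring). lra. }
  destruct (IH (R0 + 1)%R ltac:(lra)) as [A [HA HB]].
  assert (Pc := pos_INR c).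
  (* [Q] compares the powers of two points at distance at most [c]. *)
  set (Q := Rpower (1 + INR c) (R0 + 1 + INR k)).
  assert (HQ : (0 < Q)%R) by apply exp_pos.
  exists (INR c * (INR c * (2 * (R0 * (A * Q)) * INR c)) + 1)%R.
  assert (Pk := pos_INR k).
  assert (0 <= R0 * (A * Q))%R by (apply Rmult_le_pos; nra).
  split. { assert (0 <= INR c * INR c * INR c * (R0 * (A * Q)))%R by
             (repeat apply Rmult_le_pos; nra). nra. }
  intros s x Hs Hx. simpl pdiff. rewrite S_INR.
  set (e := (- (Re s + (INR k + 1)))%R).
  assert (Px : (0 < Rpower x e)%R) by apply exp_pos.
  assert (Hs1 : (Cmod (s + 1) <= R0 + 1)%R).
  { eapply Rle_trans; [apply Cmod_triangle|]. rewrite Cmod_1. lra. }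
  (* The weights have sum zero, so the value at [x] can be subtracted. *)
  replace (csum (fun i => acoef c i * pdiff c k s (x + INR i)) c) with
    (csum (fun i => acoef c i * (pdiff c k s (x + INR i) - pdiff c k s x)) c).
  - eapply Rle_trans.
    + apply (weighted_sum_le c _ (2 * (R0 * (A * (Q * Rpower x e))) * INR c)%R Hc).
      intros i Hi. assert (Ii := INR_index c i Hi).
      eapply Rle_trans.
      * apply (mean_value_RC (pdiff c k s) (fun t => - s * pdiff c k (s + 1) t) x (x + INR i)
          (R0 * (A * (Q * Rpower x e)))); [lra|].
        intros t Ht. split; [apply deriv_RC_pdiff; lra|].
        rewrite Cmod_mult, Cmod_opp. apply Rmult_le_compat; try apply Cmod_ge_0; [assumption|].
        eapply Rle_trans; [apply HB; [assumption|lra]|].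
        apply Rmult_le_compat_l; [lra|].
        replace (- (Re (s + 1) + INR k))%R with e by (unfold e; destruct s; simpl; ring).
        apply Rpower_shift_le; [assumption|lra|].
        unfold e. rewrite Rabs_Ropp. eapply Rle_trans; [apply Rabs_triang|].
        rewrite (Rabs_pos_eq (INR k + 1)) by lra. generalize (Rabs_Re_le s). lra.
      * assert (0 <= 2 * (R0 * (A * (Q * Rpower x e))))%R.
        { apply Rmult_le_pos; [lra|]. repeat apply Rmult_le_pos; lra. }
        nra.
    + nra.
  - rewrite (csum_ext _ (fun i => acoef c i * pdiff c k s (x + INR i)
      + (-1) * (acoef c i * pdiff c k s x))) by (intros; ring).
    rewrite csum_lin, acoef_sum_const by lia. ring.
Qed.

(** The constant 4 instead of 1/2 comes from using [mean_value_RC] twice. *)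
Lemma taylor2_RC (f df d2f : R -> C) (a b M : R) : (a <= b)%R -> (0 <= M)%R ->
  (forall t, (a <= t <= b)%R ->
    deriv_RC f t (df t) /\ deriv_RC df t (d2f t) /\ (Cmod (d2f t) <= M)%R) ->
  (Cmod (f b - f a - df a * RtoC (b - a)) <= 4 * M * (b - a) * (b - a))%R.
Proof.
  intros Hab HM H.
  assert (E := mean_value_RC (fun t => f t + df a * (- RtoC t)) (fun t => df t + df a * (-1))
    a b (2 * M * (b - a)) Hab).
  cbv beta in E. rewrite RtoC_minus.
  replace (f b - f a - df a * (RtoC b - RtoC a))
    with (f b + df a * - RtoC b - (f a + df a * - RtoC a)) by ring.
  eapply Rle_trans; [apply E|right; ring].
  intros t Ht. split.
  - apply deriv_RC_lin; [now apply H|apply deriv_RC_opp_id].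
  - replace (df t + df a * (-1)) with (df t - df a) by ring.
    eapply Rle_trans; [apply (mean_value_RC df d2f a t M); [lra|]|nra].
    intros u Hu. destruct (H u ltac:(lra)) as [_ X]. exact X.
Qed.

(** To first order a difference is [first_moment c] times the derivative, which is
    [-s] times the difference of order [k] at [s + 1]; the error involves the second
    derivative and is smaller by a factor [1/x]. The constant is a product of the factors
    [-(first_moment c) (s + j)], nonzero by the hypothesis on [s]. *)
Lemma pdiff_asymptotic (c k : nat) (s : C) : (2 <= c)%nat ->
  (forall j, (j < k)%nat -> s + RtoC (INR j) <> 0) ->
  exists L : C, L <> 0 /\ exists B : R, (0 <= B)%R /\ forall x : R, (1 <= x)%R ->
  (Cmod (pdiff c k s x - L * cpow x (- (s + RtoC (INR k))))
    <= B * Rpower x (- (Re s + INR k + 1)))%R.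
Proof.
  intros Hc. revert s. induction k as [|k IH]; intros s Hs.
  { exists 1. split; [intros E; injection E; lra|]. exists 0%R. split; [lra|].
    intros x Hx. simpl pdiff. simpl INR. rewrite Cplus_0_r, Cmult_1_l, Cmod_self_minus. lra. }
  destruct (IH (s + 1)) as [L' [HL' [B' [HB' HA']]]].
  { intros j Hj. replace (s + 1 + RtoC (INR j)) with (s + RtoC (INR (S j)))
      by (rewrite S_INR, RtoC_plus; ring). apply Hs. lia. }
  assert (Hs0 : s <> 0).
  { intros E. apply (Hs 0%nat ltac:(lia)). rewrite E. simpl. ring. }
  set (K := first_moment c).
  destruct (pdiff_upper c k (Cmod (s + 1 + 1)) Hc (Cmod_ge_0 _)) as [A [HA HAb]].
  set (Q := Rpower (1 + INR c) (Cmod (s + 1 + 1) + INR k)).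
  assert (HQ : (0 < Q)%R) by apply exp_pos.
  assert (Pc := pos_INR c). assert (Pk := pos_INR k).
  set (S2 := Cmod (s * (s + 1))). assert (HS2 : (0 <= S2)%R) by apply Cmod_ge_0.
  exists (- (K * s * L')). split.
  { intros E. assert (E' : K * s * L' = 0).
    { replace (K * s * L') with (- - (K * s * L')) by ring. rewrite E. ring. }
    revert E'. repeat apply Cmult_neq_0; try assumption. now apply first_moment_neq_0. }
  exists (INR c * (INR c * (4 * (S2 * (A * Q)) * INR c * INR c)) + Cmod (K * s) * B')%R.
  assert (HSAQ : (0 <= S2 * (A * Q))%R) by (repeat apply Rmult_le_pos; lra).
  split.
  { apply Rplus_le_le_0_compat; repeat apply Rmult_le_pos; try lra; apply Cmod_ge_0. }
  intros x Hx.
  set (e := (- (Re s + INR (S k) + 1))%R). assert (Px : (0 < Rpower x e)%R) by apply exp_pos.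
  set (p := pdiff c k s). set (dp := fun t => - s * pdiff c k (s + 1) t).
  assert (Split : pdiff c (S k) s x
    = csum (fun i => acoef c i * (p (x + INR i)%R - p x - dp x * RtoC (INR i))) c + K * dp x).
  { unfold K, first_moment. simpl. fold p.
    rewrite (csum_ext (fun i => acoef c i * (p (x + INR i)%R - p x - dp x * RtoC (INR i)))
      (fun i => (acoef c i * p (x + INR i)%R + (-1) * (acoef c i * p x))
        + (- dp x) * (acoef c i * RtoC (INR i)))) by (intros; ring).
    rewrite !csum_lin, acoef_sum_const by lia. ring. }
  rewrite Split.
  replace (_ - - (K * s * L') * _)
    with (csum (fun i => acoef c i * (p (x + INR i)%R - p x - dp x * RtoC (INR i))) c
      + (- (K * s)) * (pdiff c k (s + 1) x - L' * cpow x (- (s + 1 + RtoC (INR k))))).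
  2: { unfold dp. rewrite S_INR, RtoC_plus.
       replace (s + 1 + RtoC (INR k)) with (s + (RtoC (INR k) + 1)) by ring. ring. }
  eapply Rle_trans; [apply Cmod_triangle|]. rewrite Rmult_plus_distr_r.
  apply Rplus_le_compat.
  - eapply Rle_trans.
    + apply (weighted_sum_le c _ (4 * (S2 * (A * (Q * Rpower x e))) * INR c * INR c)%R Hc).
      intros i Hi. assert (Ii := INR_index c i Hi).
      assert (HM : (0 <= S2 * (A * (Q * Rpower x e)))%R) by (repeat apply Rmult_le_pos; lra).
      replace (RtoC (INR i)) with (RtoC (x + INR i - x)) by (f_equal; ring).
      eapply Rle_trans.
      * apply (taylor2_RC p dp (fun t => - s * (- (s + 1) * pdiff c k (s + 1 + 1) t))
          x (x + INR i) (S2 * (A * (Q * Rpower x e)))); [lra|assumption|].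
        intros t Ht. split; [apply deriv_RC_pdiff; lra|].
        split; [apply deriv_RC_mult, deriv_RC_pdiff; lra|].
        replace (- s * (- (s + 1) * pdiff c k (s + 1 + 1) t))
          with (s * (s + 1) * pdiff c k (s + 1 + 1) t) by ring.
        rewrite Cmod_mult. fold S2. apply Rmult_le_compat_l; [assumption|].
        eapply Rle_trans; [apply HAb; [lra|lra]|]. apply Rmult_le_compat_l; [lra|].
        replace (- (Re (s + 1 + 1) + INR k))%R with e
          by (unfold e; rewrite S_INR; destruct s; simpl; ring).
        apply Rpower_shift_le; [assumption|lra|].
        replace e with (- (Re (s + 1 + 1) + INR k))%R
          by (unfold e; rewrite S_INR; destruct s; simpl; ring).
        rewrite Rabs_Ropp. eapply Rle_trans; [apply Rabs_triang|].
        rewrite (Rabs_pos_eq (INR k)) by lra. generalize (Rabs_Re_le (s + 1 + 1)). lra.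
      * replace (x + INR i - x)%R with (INR i) by ring.
        apply Rmult_le_compat; try lra; [|apply Rmult_le_compat_l; lra].
        apply Rmult_le_pos; lra.
    + right. ring.
  - rewrite Cmod_mult, Cmod_opp, Rmult_assoc. apply Rmult_le_compat_l; [apply Cmod_ge_0|].
    eapply Rle_trans; [apply HA'; assumption|]. right. f_equal. f_equal.
    unfold e. rewrite S_INR. destruct s; simpl. ring.
Qed.

(** Once [x] is large, the main term of [pdiff_asymptotic] is at least twice the
    error. *)
Lemma pdiff_lower (c k : nat) (s : C) : (2 <= c)%nat -> (Re s + INR k <= 1)%R ->
  (forall j, (j < k)%nat -> s + RtoC (INR j) <> 0) ->
  exists m X : R, (0 < m)%R /\ (1 <= X)%R /\
  forall x : R, (X <= x)%R -> (m / x <= Cmod (pdiff c k s x))%R.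
Proof.
  intros Hc Hk Hs. destruct (pdiff_asymptotic c k s Hc Hs) as [L [HL [B [HB H]]]].
  apply Cmod_gt_0 in HL. exists (Cmod L / 2)%R, (Rmax 1 (2 * B / Cmod L)).
  split; [lra|]. split; [apply Rmax_l|]. intros x Hx.
  assert (X1 := Rle_trans _ _ _ (Rmax_l _ _) Hx).
  assert (X2 := Rle_trans _ _ _ (Rmax_r _ _) Hx).
  specialize (H x X1). set (y := pdiff c k s x) in *.
  set (w := L * cpow x (- (s + RtoC (INR k)))) in *.
  assert (Hw : Cmod w = (Cmod L * Rpower x (- (Re s + INR k)))%R).
  { unfold w. rewrite Cmod_mult, Cmod_cpow.
    replace (Re (- (s + RtoC (INR k)))) with (- (Re s + INR k))%R;
      [reflexivity|destruct s; reflexivity]. }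
  replace (- (Re s + INR k + 1))%R with (- (Re s + INR k) + - (1))%R in H by ring.
  rewrite Rpower_plus, (Rpower_Ropp x 1), Rpower_1 in H by lra.
  set (q := Rpower x (- (Re s + INR k))) in *.
  assert (Hq : (/ x <= q)%R).
  { unfold q. rewrite <- (Rpower_1 x) at 1 by lra. rewrite <- Rpower_Ropp.
    apply Rle_Rpower; lra. }
  assert (Hix : (0 < / x)%R) by (apply Rinv_0_lt_compat; lra).
  apply Rle_div_l in X2; [|assumption].
  assert (Hb : (B * / x <= Cmod L / 2)%R).
  { apply (Rmult_le_reg_r x); [lra|]. rewrite Rmult_assoc, Rinv_l by lra. lra. }
  generalize (Cmod_triangle_inv w y). rewrite (Cmod_minus_sym w y). intros T.
  assert (Q1 : (B * (q * / x) <= q * (Cmod L / 2))%R).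
  { replace (B * (q * / x))%R with (q * (B * / x))%R by ring.
    apply Rmult_le_compat_l; lra. }
  unfold Rdiv at 1. assert (Q2 : (Cmod L / 2 * / x <= Cmod L / 2 * q)%R)
    by (apply Rmult_le_compat_l; lra).
  rewrite Hw in T. lra.
Qed.

(** * Summation by parts *)

Lemma csum_csum (u : nat -> C) (p : nat) :
  csum (csum u) p = RtoC (INR p + 1) * csum u p - csum (fun i => RtoC (INR i) * u i) p.
Proof.
  induction p as [|p IH]; [rewrite !csum_0; ring|].
  rewrite !csum_S, IH, S_INR, !RtoC_plus. ring.
Qed.

(** A window of length [c] shifted by [m] loses the first [m] terms and gains the [m]
    terms after position [c]. *)
Lemma csum_windows (b : nat -> C) (c : nat) :
  csum (fun m => csum (fun i => b (m + i)%nat) c) c =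
  RtoC (INR c + 1) * csum (fun i => b (c + i)%nat) c - csum b c
  + csum (fun i => RtoC (INR i) * b i) c - csum (fun i => RtoC (INR i) * b (c + i)%nat) c.
Proof.
  rewrite (csum_ext _ (fun m => (csum b c + 1 * csum (fun i => b (c + i)%nat) m)
    + (-1) * csum b m)).
  - rewrite !csum_lin, csum_const.
    change (csum (fun m => csum b m) c) with (csum (csum b) c).
    change (csum (fun m => csum (fun i => b (c + i)%nat) m) c)
      with (csum (csum (fun i => b (c + i)%nat)) c).
    rewrite !csum_csum, RtoC_plus. ring.
  - intros m _. assert (E1 := csum_add b m c). assert (E2 := csum_add b c m).
    rewrite (Nat.add_comm c m), E1 in E2.
    replace (csum (fun i => b (m + i)%nat) c)
      with (csum b m + csum (fun i => b (m + i)%nat) c - csum b m) by ring.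
    rewrite E2. ring.
Qed.

(** The weights are [c a_m + m - 1] for [1 <= m <= c], the correlations that the
    summation by parts misses next to an endpoint. *)
Definition boundary (c : nat) (b : nat -> C) (n : nat) : C :=
  csum (fun m => RtoC (INR c + INR m - 1) * b (n + m)%nat) c
  - RtoC (INR c) ^ 2 * b (n + c)%nat.

Lemma boundary_expand (c : nat) (b : nat -> C) (n : nat) :
  boundary c b n = RtoC (INR c) * csum (fun m => b (n + m)%nat) c
    + csum (fun m => RtoC (INR m) * b (n + m)%nat) c - csum (fun m => b (n + m)%nat) c
    - RtoC (INR c) ^ 2 * b (n + c)%nat.
Proof.
  unfold boundary.
  rewrite (csum_ext _ (fun m => RtoC (INR m) * b (n + m)%nat
    + (RtoC (INR c) - 1) * b (n + m)%nat)).
  - rewrite csum_lin. ring.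
  - intros m _. rewrite RtoC_minus, RtoC_plus. ring.
Qed.

(** Over one period the weights are 1 except for an extra [-c] at the last place,
    so the double sum reduces to the unweighted windows of [csum_windows]. *)
Lemma parts_one_block (c : nat) (b : nat -> C) : (1 <= c)%nat ->
  RtoC (INR c) * csum (fun n => acoef c n * b n) c
  + csum (fun n => acoef c n * csum (fun i => acoef c i * b (n + i)%nat) c) c
  = boundary c b 0 - boundary c b c.
Proof.
  intros Hc. rewrite !acoef_sum, !boundary_expand by assumption.
  rewrite (csum_ext (fun n => csum (fun i => acoef c i * b (n + i)%nat) c)
    (fun n => csum (fun i => b (n + i)%nat) c + - RtoC (INR c) * b (c + n)%nat)).
  - rewrite csum_lin, csum_windows.
    change (csum (fun m => b (0 + m)%nat) c) with (csum b c).
    change (csum (fun m => RtoC (INR m) * b (0 + m)%nat) c)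
      with (csum (fun m => RtoC (INR m) * b m) c).
    change (b (0 + c)%nat) with (b c). rewrite RtoC_plus. ring.
  - intros n _. rewrite (acoef_sum c (fun i => b (n + i)%nat)), (Nat.add_comm c n) by assumption.
    ring.
Qed.

(** The identity of [parts_one_block] telescopes over consecutive periods. *)
Lemma summation_by_parts (c : nat) (b : nat -> C) (N : nat) : (1 <= c)%nat ->
  RtoC (INR c) * csum (fun n => acoef c n * b n) (c * N)
  + csum (fun n => acoef c n * csum (fun i => acoef c i * b (n + i)%nat) c) (c * N)
  = boundary c b 0 - boundary c b (c * N).
Proof.
  intros Hc. induction N as [|N IH].
  - rewrite Nat.mul_0_r, !csum_0. ring.
  - rewrite Nat.mul_succ_r, !csum_add.
    rewrite (csum_ext (fun i => acoef c (c * N + i) * b (c * N + i)%nat)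
      (fun i => acoef c i * b (c * N + i)%nat)) by (intros; now rewrite acoef_periodic).
    rewrite (csum_ext (fun i => acoef c (c * N + i) *
        csum (fun i0 => acoef c i0 * b (c * N + i + i0)%nat) c)
      (fun i => acoef c i * csum (fun i0 => acoef c i0 * b (c * N + (i + i0))%nat) c)).
    + assert (P := parts_one_block c (fun n => b (c * N + n)%nat) Hc). cbv beta in P.
      assert (E0 : boundary c (fun n => b (c * N + n)%nat) 0 = boundary c b (c * N))
        by reflexivity.
      assert (E1 : boundary c (fun n => b (c * N + n)%nat) c = boundary c b (c * N + c)).
      { unfold boundary. f_equal; [apply csum_ext; intros m _|]; now rewrite Nat.add_assoc. }
      rewrite E0, E1 in P.
      rewrite Cmult_plus_distr_l.
      set (x1 := RtoC (INR c) * csum (fun n => acoef c n * b n) (c * N)) in *.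
      set (y1 := csum (fun n => acoef c n * csum (fun i => acoef c i * b (n + i)%nat) c) (c * N)) in *.
      transitivity ((x1 + y1) + (boundary c b (c * N) - boundary c b (c * N + c))).
      * rewrite <- P. ring.
      * rewrite IH. ring.
    + intros i _. rewrite acoef_periodic. f_equal. apply csum_ext. intros j _.
      now rewrite Nat.add_assoc.
Qed.

Lemma sum_lt_csum (k : nat) (f : nat -> C) : sum_lt k f = csum (fun m => f (m - 1)%nat) k.
Proof.
  destruct k as [|k]; [now rewrite csum_0|]. simpl.
  induction k as [|k IH].
  - rewrite csum_S, csum_0.
    assert (E := @sum_O C_AbelianMonoid f). etransitivity; [exact E|]. simpl. ring.
  - assert (E := @sum_Sn C_AbelianMonoid f k). etransitivity; [exact E|].
    rewrite csum_S. rewrite <- IH. simpl. now rewrite ?Nat.sub_0_r.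
Qed.

(** At [n = 0] the boundary term is the bracket in the summands of [head_sum]. *)
Lemma boundary_0_head (c : nat) (b : nat -> C) : (2 <= c)%nat ->
  sum_lt (c - 1) (fun i => RtoC (INR (c + i)) * b (i + 1)%nat) - (RtoC (INR c) - 1) ^ 2 * b c
  = boundary c b 0.
Proof.
  intros Hc. rewrite sum_lt_csum. unfold boundary.
  destruct c as [|c]; [lia|]. rewrite csum_S. replace (S c - 1)%nat with c by lia.
  rewrite (csum_ext _ (fun m => RtoC (INR (S c) + INR m - 1) * b (0 + m)%nat)).
  - change (b (0 + S c)%nat) with (b (S c)). rewrite RtoC_minus, RtoC_plus. ring.
  - intros m Hm. replace (m - 1 + 1)%nat with m by lia.
    simpl (0 + m)%nat. do 2 f_equal. rewrite plus_INR, minus_INR by lia. simpl (INR 1). ring.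
Qed.

Lemma Cmod_boundary_le (c : nat) (b : nat -> C) (n : nat) (e : R) : (1 <= c)%nat ->
  (forall m, (1 <= m <= c)%nat -> (Cmod (b (n + m)%nat) <= e)%R) ->
  (Cmod (boundary c b n) <= 3 * INR c ^ 2 * e)%R.
Proof.
  intros Hc H. assert (Hc' := le_INR 1 c Hc). simpl in Hc'.
  assert (He := Rle_trans _ _ _ (Cmod_ge_0 _) (H c ltac:(lia))).
  unfold boundary. eapply Rle_trans; [apply Cmod_triangle|]. rewrite Cmod_opp, Cmod_mult.
  assert (B1 : (Cmod (csum (fun m => (RtoC (INR c + INR m - 1) * b (n + m)%nat)%C) c)
    <= INR c * (2 * INR c * e))%R).
  { apply Cmod_csum_le. intros m Hm. assert (Im := INR_index c m Hm).
    assert (1 <= INR m)%R by (apply (le_INR 1); lia).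
    rewrite Cmod_mult, Cmod_R, Rabs_pos_eq by lra.
    apply Rmult_le_compat; try apply Cmod_ge_0; [lra|lra|now apply H]. }
  assert (B2 : (Cmod (RtoC (INR c) ^ 2) * Cmod (b (n + c)%nat) <= INR c ^ 2 * e)%R).
  { rewrite Cmod_pow, Cmod_R, Rabs_pos_eq by lra.
    apply Rmult_le_compat_l; [apply pow_le; lra|apply H; lia]. }
  nra.
Qed.

(** * Complex sequences and uniform limits *)

Definition cvg (u : nat -> C) (l : C) : Prop :=
  forall eps : R, (0 < eps)%R -> exists N0 : nat, forall N, (N0 <= N)%nat ->
  (Cmod (u N - l) < eps)%R.

Lemma filterlim_of_cvg (u : nat -> C) (l : C) :
  cvg u l -> filterlim u eventually (@locally C_UniformSpace l).
Proof.
  intros H P [eps HP]. destruct (H eps (cond_pos eps)) as [N0 HN].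
  exists N0. intros N LN. apply HP. apply C_NormedModule_mixin_compat1. now apply HN.
Qed.

Lemma cvg_of_filterlim (u : nat -> C) (l : C) :
  filterlim u eventually (@locally C_UniformSpace l) -> cvg u l.
Proof.
  intros H eps He.
  assert (Q : (0 < sqrt 2)%R) by (apply sqrt_lt_R0; lra).
  assert (He' : (0 < eps / sqrt 2)%R) by now apply Rdiv_lt_0_compat.
  destruct (H (ball l (mkposreal _ He'))) as [N0 HN]; [now exists (mkposreal _ He')|].
  exists N0. intros N LN. specialize (HN N LN).
  apply C_NormedModule_mixin_compat2 in HN. simpl in HN.
  replace (sqrt 2 * (eps / sqrt 2))%R with eps in HN by (field; lra). exact HN.
Qed.

Lemma cvg_const (l : C) : cvg (fun _ => l) l.
Proof. intros e He. exists 0%nat. intros. now rewrite Cmod_self_minus. Qed.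

Lemma cvg_ext (u v : nat -> C) (l : C) : (forall n, u n = v n) -> cvg u l -> cvg v l.
Proof. intros E H e He. destruct (H e He) as [N0 HN]. exists N0. intros N. rewrite <- E. apply HN. Qed.

Lemma cvg_subseq (u : nat -> C) (l : C) (c : nat) : (1 <= c)%nat ->
  cvg u l -> cvg (fun N => u (c * N)%nat) l.
Proof.
  intros Hc H e He. destruct (H e He) as [N0 HN]. exists N0. intros N LN. apply HN. nia.
Qed.

Lemma cvg_lin (u v : nat -> C) (l m k : C) :
  cvg u l -> cvg v m -> cvg (fun n => u n + k * v n) (l + k * m).
Proof.
  intros Hu Hv e He. assert (Pk := Cmod_ge_0 k).
  destruct (Hu (e / 2)%R) as [N1 H1]; [lra|].
  destruct (Hv (e / (2 * (Cmod k + 1)))%R) as [N2 H2]; [apply Rdiv_lt_0_compat; lra|].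
  exists (N1 + N2)%nat. intros N LN.
  specialize (H1 N ltac:(lia)). specialize (H2 N ltac:(lia)).
  replace (u N + k * v N - (l + k * m)) with ((u N - l) + k * (v N - m)) by ring.
  eapply Rle_lt_trans; [apply Cmod_triangle|]. rewrite Cmod_mult.
  apply (Rmult_lt_compat_l (Cmod k + 1)) in H2; [|lra].
  replace ((Cmod k + 1) * (e / (2 * (Cmod k + 1))))%R with (e / 2)%R in H2 by (field; lra).
  generalize (Cmod_ge_0 (v N - m)). nra.
Qed.

Lemma cvg_unique (u : nat -> C) (l m : C) : cvg u l -> cvg u m -> l = m.
Proof.
  intros H1 H2. destruct (Ceq_dec l m) as [E|N]; [assumption|exfalso].
  apply Cmod_minus_pos in N.
  destruct (H1 (Cmod (l - m) / 2)%R) as [N1 A1]; [lra|].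
  destruct (H2 (Cmod (l - m) / 2)%R) as [N2 A2]; [lra|].
  specialize (A1 (N1 + N2)%nat ltac:(lia)). specialize (A2 (N1 + N2)%nat ltac:(lia)).
  rewrite Cmod_minus_sym in A1. set (w := u (N1 + N2)%nat) in *.
  generalize (Cmod_triangle (l - w) (w - m)). replace (l - w + (w - m)) with (l - m) by ring. lra.
Qed.

(** A total limit operator, used to name the limit of a sequence of functions. *)
Definition clim (u : nat -> C) : C :=
  (real (Lim_seq (fun n => Re (u n))), real (Lim_seq (fun n => Im (u n)))).

Definition unif_cauchy_on (P : C -> Prop) (F : nat -> C -> C) : Prop :=
  forall eps : R, (0 < eps)%R -> exists N0 : nat, forall N M, (N0 <= N)%nat -> (N0 <= M)%nat ->
  forall s, P s -> (Cmod (F N s - F M s) < eps)%R.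

Lemma clim_correct (u : nat -> C) :
  (forall eps : R, (0 < eps)%R -> exists N0 : nat, forall N M, (N0 <= N)%nat -> (N0 <= M)%nat ->
     (Cmod (u N - u M) < eps)%R) -> cvg u (clim u).
Proof.
  intros H.
  assert (part : forall f : C -> R, (forall z w, (Rabs (f z - f w) <= Cmod (z - w))%R) ->
    is_lim_seq (fun n => f (u n)) (real (Lim_seq (fun n => f (u n))))).
  { intros f Hf. apply Lim_seq_correct'. apply ex_lim_seq_cauchy_corr.
    intros eps. destruct (H eps (cond_pos eps)) as [N0 HN]. exists N0. intros n m Hn Hm.
    eapply Rle_lt_trans; [apply Hf|]. now apply HN. }
  assert (PR := part Re (fun z w => Rabs_Re_le (z - w))).
  assert (PI := part Im (fun z w => Rabs_Im_le (z - w))).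
  intros e He. apply is_lim_seq_spec in PR, PI.
  destruct (PR (mkposreal (e / 2) ltac:(lra))) as [N1 H1].
  destruct (PI (mkposreal (e / 2) ltac:(lra))) as [N2 H2].
  exists (N1 + N2)%nat. intros N LN. eapply Rle_lt_trans; [apply Cmod_le_Re_Im|].
  specialize (H1 N ltac:(lia)). specialize (H2 N ltac:(lia)). simpl in H1, H2.
  change (Re (u N - clim u)) with (Re (u N) - real (Lim_seq (fun n => Re (u n))))%R.
  change (Im (u N - clim u)) with (Im (u N) - real (Lim_seq (fun n => Im (u n))))%R. lra.
Qed.

(** A uniformly Cauchy sequence converges uniformly as soon as [g] is a pointwise
    cluster value; the values along multiples of [c] will serve. *)
Lemma unif_cauchy_limit (P : C -> Prop) (F : nat -> C -> C) (g : C -> C) :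
  unif_cauchy_on P F ->
  (forall s, P s -> forall e, (0 < e)%R -> forall N0, exists N, (N0 <= N)%nat /\
    (Cmod (F N s - g s) < e)%R) -> unif_on P F g.
Proof.
  intros H Hg e He. destruct (H (e / 2)%R) as [N0 HN]; [lra|]. exists N0.
  intros N LN s Ps. destruct (Hg s Ps (e / 2)%R ltac:(lra) N0) as [M [LM HM]].
  specialize (HN N M LN LM s Ps).
  replace (F N s - g s) with ((F N s - F M s) + (F M s - g s)) by ring.
  eapply Rle_lt_trans; [apply Cmod_triangle|]. lra.
Qed.

Lemma unif_cauchy_clim (P : C -> Prop) (F : nat -> C -> C) :
  unif_cauchy_on P F -> unif_on P F (fun s => clim (fun N => F N s)).
Proof.
  intros H. apply unif_cauchy_limit; [assumption|]. intros s Ps e He N0.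
  destruct (clim_correct (fun N => F N s)) with (eps := e) as [N1 H1]; [|assumption|].
  - intros eps Heps. destruct (H eps Heps) as [N1 H1]. exists N1. intros N M LN LM. now apply H1.
  - exists (N0 + N1)%nat. split; [lia|]. apply H1. lia.
Qed.

(** * Comparison with the series of [n^(-p)] *)

Lemma Rpower_decreasing (x y e : R) : (0 < x)%R -> (x <= y)%R -> (e <= 0)%R ->
  (Rpower y e <= Rpower x e)%R.
Proof.
  intros Hx Hxy He. unfold Rpower. apply exp_monotone.
  assert (ln x <= ln y)%R by now apply ln_le. nra.
Qed.

Lemma INR_S_pos (n : nat) : (0 < INR (S n))%R.
Proof. apply lt_0_INR. lia. Qed.

(** The mean value theorem for [x^(1-p)]; it replaces the integral test. *)
Lemma power_telescope (p : R) (n : nat) : (1 < p)%R -> (1 <= n)%nat ->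
  (Rpower (INR (S n)) (- p) <=
    (Rpower (INR n) (1 - p) - Rpower (INR (S n)) (1 - p)) / (p - 1))%R.
Proof.
  intros Hp Hn. apply (le_INR 1) in Hn. simpl (INR 1) in Hn.
  destruct (MVT_cor2 (fun x => Rpower x (1 - p)) (fun x => (1 - p) * Rpower x (1 - p - 1))%R
    (INR n) (INR (S n))) as [x [E Hx]].
  - rewrite S_INR. lra.
  - intros x Hx. apply derivable_pt_lim_power. lra.
  - rewrite S_INR in *. apply Rle_div_r; [lra|].
    replace (1 - p - 1)%R with (- p)%R in E by ring.
    assert (Q := Rpower_decreasing x (INR n + 1) (- p) ltac:(lra) ltac:(lra) ltac:(lra)).
    nra.
Qed.

Lemma Rpower_small (q e : R) : (0 < q)%R -> (0 < e)%R ->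
  exists N : nat, (1 <= N)%nat /\ (Rpower (INR N) (- q) < e)%R.
Proof.
  intros Hq He. set (y := exp (- (ln e / q))).
  destruct (nfloor_ex y) as [n [_ Hn]]; [left; apply exp_pos|].
  exists (S n). split; [lia|]. rewrite <- (exp_ln e) by assumption.
  unfold Rpower. apply exp_increasing.
  assert (L : (- (ln e / q) < ln (INR (S n)))%R).
  { rewrite <- (ln_exp (- (ln e / q))). apply ln_increasing; [apply exp_pos|].
    rewrite S_INR. exact Hn. }
  apply (Rmult_lt_compat_l q) in L; [|assumption].
  replace (q * - (ln e / q))%R with (- ln e)%R in L by (field; lra). lra.
Qed.

Lemma unif_cauchy_of_increments (P : C -> Prop) (F : nat -> C -> C) (A p : R) :
  (0 < A)%R -> (1 < p)%R ->
  (forall n s, (1 <= n)%nat -> P s ->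
    (Cmod (F (S n) s - F n s) <= A * Rpower (INR n) (- p))%R) ->
  unif_cauchy_on P F.
Proof.
  intros HA Hp H.
  set (t := fun n => (A / (p - 1) * Rpower (INR n) (1 - p))%R).
  assert (HAp : (0 < A / (p - 1))%R) by (apply Rdiv_lt_0_compat; lra).
  assert (tail : forall M j s, (1 <= M)%nat -> P s ->
    (Cmod (F (S (M + j)) s - F (S M) s) <= t M - t (M + j)%nat)%R).
  { intros M j s HM Ps. induction j as [|j IH].
    - rewrite Nat.add_0_r, Cmod_self_minus. lra.
    - rewrite Nat.add_succ_r.
      replace (F (S (S (M + j))) s - F (S M) s) with
        ((F (S (S (M + j))) s - F (S (M + j)) s) + (F (S (M + j)) s - F (S M) s)) by ring.
      eapply Rle_trans; [apply Cmod_triangle|].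
      assert (Q := H (S (M + j)) s ltac:(lia) Ps).
      assert (T := power_telescope p (M + j) Hp ltac:(lia)).
      apply (Rmult_le_compat_l A) in T; [|lra]. unfold t in *. unfold Rdiv in *. lra. }
  intros e He.
  destruct (Rpower_small (p - 1) (e / 2 / (A / (p - 1)))) as [M [HM Hsmall]]; [lra| |].
  { apply Rdiv_lt_0_compat; lra. }
  assert (HtM : (t M < e / 2)%R).
  { unfold t. apply (Rmult_lt_compat_l (A / (p - 1))) in Hsmall; [|assumption].
    replace (A / (p - 1) * (e / 2 / (A / (p - 1))))%R with (e / 2)%R in Hsmall
      by (field; lra).
    replace (1 - p)%R with (- (p - 1))%R by ring. exact Hsmall. }
  assert (near : forall N s, (S M <= N)%nat -> P s -> (Cmod (F N s - F (S M) s) < e / 2)%R).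
  { intros N s LN Ps. replace N with (S (M + (N - S M))) by lia.
    eapply Rle_lt_trans; [now apply tail|].
    assert (0 < t (M + (N - S M))%nat)%R
      by (apply Rmult_lt_0_compat; [assumption|apply exp_pos]). lra. }
  exists (S M). intros N N' LN LN' s Ps.
  assert (A1 := near N s LN Ps). assert (A2 := near N' s LN' Ps).
  rewrite Cmod_minus_sym in A2.
  replace (F N s - F N' s) with ((F N s - F (S M) s) + (F (S M) s - F N' s)) by ring.
  eapply Rle_lt_trans; [apply Cmod_triangle|]. lra.
Qed.

Lemma ex_series_power (p : R) : (1 < p)%R ->
  ex_series (fun n : nat => Rpower (INR (S n)) (- p)).
Proof.
  intros Hp. set (a := fun n : nat => Rpower (INR (S n)) (- p)).
  assert (B : forall N, (sum_n a N <=
    1 + (1 - Rpower (INR (S N)) (1 - p)) / (p - 1))%R).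
  { induction N as [|N IH].
    - rewrite sum_O. unfold a. simpl INR. unfold Rpower. rewrite ln_1, !Rmult_0_r, exp_0.
      unfold Rdiv. rewrite Rminus_diag. lra.
    - rewrite sum_Sn. change plus with Rplus.
      assert (T := power_telescope p (S N) Hp ltac:(lia)). unfold a at 2.
      unfold Rdiv in *. lra. }
  destruct (ex_finite_lim_seq_incr (sum_n a) (1 + / (p - 1))) as [l Hl].
  - intros n. rewrite sum_Sn. change plus with Rplus.
    assert (0 < a (S n))%R by apply exp_pos. lra.
  - intros n. eapply Rle_trans; [apply B|].
    assert (0 < Rpower (INR (S n)) (1 - p))%R by apply exp_pos.
    assert (0 < / (p - 1))%R by (apply Rinv_0_lt_compat; lra). unfold Rdiv. nra.
  - exists l. exact Hl.
Qed.

(** The terms of index [n] to [2 n] add up to at least [m / 2]. *)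
Lemma not_ex_series_harmonic (b : nat -> R) (m : R) (N0 : nat) : (0 < m)%R ->
  (forall n, (N0 <= n)%nat -> (m / INR (S n) <= b n)%R) -> ~ ex_series b.
Proof.
  intros Hm H E. apply (@Cauchy_ex_series R_AbsRing R_CompleteNormedModule) in E.
  destruct (E (mkposreal (m / 4) ltac:(lra))) as [N HN].
  set (n := (S N + N0)%nat). specialize (HN n (n + n)%nat ltac:(lia) ltac:(lia)).
  assert (Pn : (1 <= INR n)%R) by (apply (le_INR 1); lia).
  assert (L : (sum_n_m (fun _ => m / INR (S (n + n))) n (n + n) <= sum_n_m b n (n + n))%R).
  { rewrite (sum_n_m_ext_loc b (fun k => Rmax (b k) (m / INR (S (n + n))))).
    - apply sum_n_m_le. intros k. apply Rmax_r.
    - intros k Hk. rewrite Rmax_left; [reflexivity|].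
      eapply Rle_trans; [|apply H; lia]. apply Rmult_le_compat_l; [lra|].
      apply Rinv_le_contravar; [apply INR_S_pos|]. apply le_INR. lia. }
  rewrite sum_n_m_const in L. replace (S (n + n) - n)%nat with (S n) in L by lia.
  assert (HN' : (Rabs (@sum_n_m R_AbelianMonoid b n (n + n)) < m / 4)%R) by exact HN.
  assert (Q := Rle_abs (@sum_n_m R_AbelianMonoid b n (n + n))).
  assert (X : (m / 2 <= INR (S n) * (m / INR (S (n + n))))%R).
  { rewrite !S_INR, plus_INR.
    replace ((INR n + 1) * (m / (INR n + INR n + 1)))%R
      with (m * ((INR n + 1) / (INR n + INR n + 1)))%R by (field; lra).
    apply Rmult_le_compat_l; [lra|]. apply Rle_div_r; lra. }
  apply (Rlt_irrefl (m / 4)). eapply Rle_lt_trans; [|exact HN'].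
  eapply Rle_trans; [|exact Q]. eapply Rle_trans; [|exact L]. lra.
Qed.

(** * Compact subsets of a half plane *)

Definition half_disc (x r : R) (s : C) : Prop := (x <= Re s)%R /\ (Cmod s <= r)%R.

Lemma open_of_radius (V : C -> Prop) :
  (forall s, V s -> exists r, (0 < r)%R /\ forall w, (Cmod (w - s) < r)%R -> V w) ->
  @open C_UniformSpace V.
Proof.
  intros H s Hs. destruct (H s Hs) as [r [Hr H']].
  assert (Q : (0 < sqrt 2)%R) by (apply sqrt_lt_R0; lra).
  assert (Hr' : (0 < r / sqrt 2)%R) by now apply Rdiv_lt_0_compat.
  exists (mkposreal _ Hr'). intros w Hw. apply H'.
  apply C_NormedModule_mixin_compat2 in Hw. simpl in Hw.
  replace (sqrt 2 * (r / sqrt 2))%R with r in Hw by (field; lra). exact Hw.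
Qed.

(** The sets [V n] below form an increasing open cover of the half plane, so a
    single one contains [K]. *)
Lemma compact_in_half_disc (K : C -> Prop) (x : R) : compact_set K ->
  (forall s, K s -> (x < Re s)%R) ->
  exists y r : R, (x < y)%R /\ (0 < r)%R /\ forall s, K s -> half_disc y r s.
Proof.
  intros HK Hx.
  set (V := fun (n : nat) (s : C) => (x + / INR (S n) < Re s)%R /\ (Cmod s < INR (S n))%R).
  assert (Vmono : forall n m s, (n <= m)%nat -> V n s -> V m s).
  { intros n m s Hnm [V1 V2].
    assert (L : (INR (S n) <= INR (S m))%R) by (apply le_INR; lia). split; [|lra].
    eapply Rle_lt_trans; [|exact V1]. apply Rplus_le_compat_l.
    apply Rinv_le_contravar; [apply INR_S_pos|assumption]. }
  destruct (HK nat V) as [l Hl].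
  - intros n. apply open_of_radius. intros s [V1 V2].
    exists (Rmin (Re s - (x + / INR (S n))) (INR (S n) - Cmod s)). split.
    + apply Rmin_pos; lra.
    + intros w Hw. assert (W1 := Rlt_le_trans _ _ _ Hw (Rmin_l _ _)).
      assert (W2 := Rlt_le_trans _ _ _ Hw (Rmin_r _ _)). split.
      * assert (Q := Rabs_Re_le (w - s)).
        change (Re (w - s)) with (Re w - Re s)%R in Q.
        revert Q. unfold Rabs. destruct Rcase_abs; lra.
      * generalize (Cmod_triangle_inv w s). lra.
  - intros s Hs. specialize (Hx s Hs).
    destruct (nfloor_ex (/ (Re s - x) + Cmod s)) as [n [_ Hn]].
    { assert (0 < / (Re s - x))%R by (apply Rinv_0_lt_compat; lra).
      generalize (Cmod_ge_0 s). lra. }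
    exists n. rewrite <- S_INR in Hn.
    assert (0 < / (Re s - x))%R by (apply Rinv_0_lt_compat; lra).
    assert (Q := Cmod_ge_0 s). split; [|lra].
    assert (/ INR (S n) < / / (Re s - x))%R.
    { apply Rinv_lt_contravar; [|lra]. apply Rmult_lt_0_compat; [assumption|apply INR_S_pos]. }
    rewrite Rinv_inv in H0. lra.
  - set (m := list_max l). exists (x + / INR (S m))%R, (INR (S m)).
    assert (0 < / INR (S m))%R by apply Rinv_0_lt_compat, INR_S_pos.
    split; [lra|]. split; [apply INR_S_pos|]. intros s Hs.
    destruct (Hl s Hs) as [n [Hn Vn]].
    assert (Hnm : (n <= m)%nat).
    { assert (F := proj1 (list_max_le l m) (le_n m)).
      rewrite Forall_forall in F. now apply F. }
    destruct (Vmono n m s Hnm Vn). split; lra.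
Qed.

(** * The differenced series and its limit *)

Definition sign_coef (c k : nat) : C := (-1) ^ k / RtoC (INR c) ^ k.

Lemma INR_C_neq_0 (c : nat) : (1 <= c)%nat -> RtoC (INR c) <> 0.
Proof. intros H E. injection E. apply (le_INR 1) in H. simpl in H. lra. Qed.

Lemma sign_coef_S (c k : nat) : (1 <= c)%nat ->
  sign_coef c (S k) = - (sign_coef c k / RtoC (INR c)).
Proof.
  intros Hc. assert (N := INR_C_neq_0 c Hc). unfold sign_coef. rewrite !Cpow_S. field.
  split; [now apply Cpow_nz|assumption].
Qed.

Lemma Cmod_sign_coef (c k : nat) : (1 <= c)%nat ->
  Cmod (sign_coef c k) = (/ INR c ^ k)%R.
Proof.
  intros Hc. assert (N := INR_C_neq_0 c Hc). unfold sign_coef.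
  rewrite Cmod_div by now apply Cpow_nz. rewrite !Cmod_pow, !Cmod_R, Rabs_left by lra.
  apply (le_INR 1) in Hc. simpl in Hc. rewrite Rabs_pos_eq by lra.
  replace (- -1)%R with 1%R by ring. rewrite pow1. unfold Rdiv. ring.
Qed.

Lemma Cmod_sign_coef_bounds (c k : nat) : (1 <= c)%nat -> (0 < Cmod (sign_coef c k) <= 1)%R.
Proof.
  intros Hc. rewrite Cmod_sign_coef by assumption. apply (le_INR 1) in Hc. simpl in Hc.
  assert (P : (1 <= INR c ^ k)%R) by now apply pow_R1_Rle.
  split; [apply Rinv_0_lt_compat; lra|]. rewrite <- Rinv_1. apply Rinv_le_contravar; lra.
Qed.

Lemma tail_sum_csum (c k M : nat) (s : C) :
  tail_sum c k M s = csum (fun n => sign_coef c k * acoef c n * gdiff_pow c k s n) M.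
Proof. reflexivity. Qed.

Lemma tail_sum_S (c k M : nat) (s : C) :
  tail_sum c k (S M) s = tail_sum c k M s + tail_term c k s (S M).
Proof. rewrite !tail_sum_csum, csum_S. reflexivity. Qed.

(** A block of [c] terms is a difference of the next order, by periodicity of the
    weights. *)
Lemma tail_sum_blocks (c k m : nat) (s : C) :
  tail_sum c k (c * S m) s = tail_sum c k (c * m) s
    + sign_coef c k * gdiff_pow c (S k) s (c * m).
Proof.
  rewrite !tail_sum_csum, Nat.mul_succ_r, csum_add. f_equal.
  rewrite (csum_ext _ (fun i => sign_coef c k * (acoef c i * gdiff_pow c k s (c * m + i)))).
  - rewrite csum_mult. reflexivity.
  - intros i _. rewrite acoef_periodic. ring.
Qed.

Lemma pdiff_half_disc (c k : nat) (x r : R) : (2 <= c)%nat -> (0 <= x + INR k)%R -> (0 < r)%R ->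
  exists A : R, (0 < A)%R /\ forall (s : C) (n m : nat), half_disc x r s ->
  (1 <= n)%nat -> (n <= m)%nat ->
  (Cmod (gdiff_pow c k s m) <= A * Rpower (INR n) (- (x + INR k)))%R.
Proof.
  intros Hc Hx Hr. destruct (pdiff_upper c k r Hc ltac:(lra)) as [A [HA HB]].
  exists A. split; [assumption|]. intros s n m [S1 S2] Hn Hm. rewrite gdiff_pow_pdiff.
  apply (le_INR 1) in Hn. simpl in Hn. apply le_INR in Hm.
  eapply Rle_trans; [apply HB; [assumption|lra]|]. apply Rmult_le_compat_l; [lra|].
  apply Rle_trans with (Rpower (INR m) (- (x + INR k))).
  - apply Rle_Rpower; lra.
  - apply Rpower_decreasing; lra.
Qed.

(** One function serves for every half plane: the limit along multiples of [c]
    exists in the largest of them and agrees with the full sum where that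
    converges. *)
Definition tail_limit (c k : nat) (s : C) : C := clim (fun N => tail_sum c k (c * N) s).

Lemma tail_blocks_unif (c k : nat) (x r : R) : (2 <= c)%nat -> (- INR k < x)%R -> (0 < r)%R ->
  unif_on (half_disc x r) (fun N => tail_sum c k (c * N)) (tail_limit c k).
Proof.
  intros Hc Hx Hr. apply unif_cauchy_clim.
  destruct (pdiff_half_disc c (S k) x r Hc ltac:(rewrite S_INR; lra) Hr) as [A [HA HB]].
  apply (unif_cauchy_of_increments _ _ A (x + INR (S k))); [assumption|rewrite S_INR; lra|].
  intros n s Hn Hs. rewrite tail_sum_blocks.
  replace (_ + _ - _) with (sign_coef c k * gdiff_pow c (S k) s (c * n)) by ring.
  rewrite Cmod_mult. destruct (Cmod_sign_coef_bounds c k ltac:(lia)) as [K1 K2].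
  assert (Q := HB s n (c * n)%nat Hs Hn ltac:(nia)).
  generalize (Cmod_ge_0 (gdiff_pow c (S k) s (c * n))). nra.
Qed.

Lemma tail_term_le (c k : nat) (x r : R) : (2 <= c)%nat -> (0 <= x + INR k)%R -> (0 < r)%R ->
  exists A : R, (0 < A)%R /\ forall (s : C) (n m : nat), half_disc x r s ->
  (1 <= n)%nat -> (n <= m)%nat ->
  (Cmod (tail_term c k s m) <= A * Rpower (INR n) (- (x + INR k)))%R.
Proof.
  intros Hc Hx Hr. destruct (pdiff_half_disc c k x r Hc Hx Hr) as [A [HA HB]].
  assert (Pc : (1 <= INR c)%R) by (apply (le_INR 1); lia).
  exists (INR c * A)%R. split; [nra|]. intros s n m Hs Hn Hm.
  change (tail_term c k s m) with (sign_coef c k * acoef c m * gdiff_pow c k s m).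
  rewrite !Cmod_mult, (Rmult_assoc (INR c)). destruct (Cmod_sign_coef_bounds c k ltac:(lia)) as [K1 K2].
  apply Rmult_le_compat; [apply Rmult_le_pos; apply Cmod_ge_0|apply Cmod_ge_0| |now apply HB].
  destruct (Cmod_acoef c m Hc) as [_ B]. generalize (Cmod_ge_0 (acoef c m)). nra.
Qed.

Lemma tail_unif (c k : nat) (x r : R) : (2 <= c)%nat -> (1 - INR k < x)%R -> (0 < r)%R ->
  unif_on (half_disc x r) (tail_sum c k) (tail_limit c k).
Proof.
  intros Hc Hx Hr. apply unif_cauchy_limit.
  - destruct (tail_term_le c k x r Hc ltac:(lra) Hr) as [A [HA HB]].
    apply (unif_cauchy_of_increments _ _ A (x + INR k)); [assumption|lra|].
    intros n s Hn Hs. rewrite tail_sum_S.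
    replace (_ + _ - _) with (tail_term c k s (S n)) by ring. apply HB; [assumption|assumption|lia].
  - intros s Hs e He N0.
    destruct (tail_blocks_unif c k x r Hc ltac:(lra) Hr e He) as [N1 H1].
    exists (c * (N0 + N1))%nat. split; [nia|]. apply H1; [lia|assumption].
Qed.

Lemma half_disc_self (s : C) (x : R) : (x < Re s)%R ->
  half_disc ((x + Re s) / 2) (Cmod s + 1) s.
Proof. intros H. split; lra. Qed.

Lemma tail_limit_cvg (c k : nat) (s : C) : (2 <= c)%nat -> (- INR k < Re s)%R ->
  cvg (fun N => tail_sum c k (c * N) s) (tail_limit c k s).
Proof.
  intros Hc Hs e He.
  destruct (tail_blocks_unif c k ((- INR k + Re s) / 2) (Cmod s + 1) Hc) with (eps := e)
    as [N0 HN]; [lra|generalize (Cmod_ge_0 s); lra|assumption|].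
  exists N0. intros N LN. apply HN; [assumption|]. now apply half_disc_self.
Qed.

Lemma ex_series_tail (c k : nat) (s : C) : (2 <= c)%nat -> (1 - INR k < Re s)%R ->
  ex_series (fun n : nat => Cmod (tail_term c k s (S n))).
Proof.
  intros Hc Hs. set (x := ((1 - INR k + Re s) / 2)%R).
  destruct (tail_term_le c k x (Cmod s + 1) Hc) as [A [HA HB]];
    [unfold x; lra|generalize (Cmod_ge_0 s); lra|].
  apply (@ex_series_le R_AbsRing R_CompleteNormedModule _
    (fun n => A * Rpower (INR (S n)) (- (x + INR k)))%R).
  - intros n. change (norm (Cmod (tail_term c k s (S n))))
      with (Rabs (Cmod (tail_term c k s (S n)))).
    rewrite Rabs_pos_eq by apply Cmod_ge_0. apply HB; [|lia|lia].
    now apply half_disc_self.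
  - apply (@ex_series_scal_l R_AbsRing R_NormedModule A). apply ex_series_power. unfold x. lra.
Qed.

(** In the strip, [s + j = 0] with [j < k] forces [j = k - 1], that is,
    [s = 1 - k]. *)
Lemma not_ex_series_tail (c k : nat) (s : C) : (2 <= c)%nat ->
  (- INR k < Re s <= 1 - INR k)%R -> (k = 0%nat \/ s <> RtoC (1 - INR k)) ->
  ~ ex_series (fun n : nat => Cmod (tail_term c k s (S n))).
Proof.
  intros Hc [Hs1 Hs2] Hk.
  assert (NZ : forall j, (j < k)%nat -> s + RtoC (INR j) <> 0).
  { intros j Hj E. destruct Hk as [->|Hk]; [lia|]. apply Hk.
    assert (Es : s = RtoC (- INR j)).
    { rewrite RtoC_opp. replace s with (s + RtoC (INR j) - RtoC (INR j)) by ring.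
      rewrite E. ring. }
    rewrite Es in *. rewrite re_RtoC in Hs1, Hs2. f_equal.
    assert (k = S j).
    { assert (L : (INR k < INR (S (S j)))%R) by (rewrite !S_INR; lra).
      apply INR_lt in L. lia. }
    subst k. rewrite S_INR. ring. }
  destruct (pdiff_lower c k s Hc ltac:(lra) NZ) as [m [X [Hm [HX HL]]]].
  destruct (Cmod_sign_coef_bounds c k ltac:(lia)) as [K1 _].
  destruct (nfloor_ex X) as [N0 [_ HN]]; [lra|].
  apply (not_ex_series_harmonic _ (Cmod (sign_coef c k) * m) N0).
  - now apply Rmult_lt_0_compat.
  - intros n Hn.
    change (tail_term c k s (S n)) with (sign_coef c k * acoef c (S n) * gdiff_pow c k s (S n)).
    rewrite !Cmod_mult, gdiff_pow_pdiff.
    assert (L : (X <= INR (S n))%R) by (apply le_INR in Hn; rewrite S_INR; lra).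
    specialize (HL (INR (S n)) L).
    destruct (Cmod_acoef c (S n) Hc) as [B _].
    assert (P0 := INR_S_pos n).
    assert (P1 : (0 < m / INR (S n))%R) by now apply Rdiv_lt_0_compat.
    replace (Cmod (sign_coef c k) * m / INR (S n))%R
      with (Cmod (sign_coef c k) * 1 * (m / INR (S n)))%R by (field; lra).
    apply Rmult_le_compat; try lra. apply Rmult_le_compat_l; lra.
Qed.

(** * Holomorphy of the head and of the tail *)

Lemma diff_at_gdiff_pow (c k : nat) (s : C) (n : nat) :
  diff_at (fun s => gdiff_pow c k s n) s.
Proof.
  apply (diff_at_ext (fun s => pdiff c k s (INR n)));
    [intros w; now rewrite gdiff_pow_pdiff|].
  generalize (INR n). induction k as [|k IH]; intros x; simpl.
  - apply (diff_at_comp (fun s => - s * RtoC (ln x)) Cexp); [|apply diff_at_Cexp].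
    apply diff_at_mult; [apply diff_at_opp, diff_at_id|apply diff_at_const].
  - apply (diff_at_csum (fun i s => acoef c i * pdiff c k s (x + INR i))).
    intros i _. apply diff_at_mult; [apply diff_at_const|apply IH].
Qed.

Lemma diff_at_tail_sum (c k M : nat) (s : C) : diff_at (tail_sum c k M) s.
Proof.
  apply (diff_at_csum (fun n s => sign_coef c k * acoef c n * gdiff_pow c k s n)).
  intros i _. apply diff_at_mult; [apply diff_at_const|apply diff_at_gdiff_pow].
Qed.

Lemma diff_at_sum_lt (k : nat) (f : nat -> C -> C) (s : C) :
  (forall j, diff_at (f j) s) -> diff_at (fun s => sum_lt k (fun j => f j s)) s.
Proof.
  intros H. apply (diff_at_ext (fun s => csum (fun m => f (m - 1)%nat s) k)).
  - intros w. now rewrite sum_lt_csum.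
  - apply (diff_at_csum (fun m s => f (m - 1)%nat s)). intros i _. apply H.
Qed.

Lemma diff_at_head_sum (c k : nat) (s : C) : diff_at (head_sum c k) s.
Proof.
  apply (diff_at_sum_lt k (fun j s => (-1) ^ j / RtoC (INR c) ^ (j + 1) *
    (sum_lt (c - 1) (fun i => RtoC (INR (c + i)) * gdiff_pow c j s (i + 1))
     - (RtoC (INR c) - 1) ^ 2 * gdiff_pow c j s c))).
  intros j. apply diff_at_mult; [apply diff_at_const|]. apply diff_at_minus.
  - apply (diff_at_sum_lt (c - 1) (fun i s => RtoC (INR (c + i)) * gdiff_pow c j s (i + 1))).
    intros i. apply diff_at_mult; [apply diff_at_const|apply diff_at_gdiff_pow].
  - apply diff_at_mult; [apply diff_at_const|apply diff_at_gdiff_pow].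
Qed.

Lemma diff_at_tail_limit (c k : nat) (s : C) : (2 <= c)%nat -> (- INR k < Re s)%R ->
  diff_at (tail_limit c k) s.
Proof.
  intros Hc Hs. set (r := ((Re s + INR k) / 2)%R). assert (Hr : (0 < r)%R) by (unfold r; lra).
  apply (weierstrass (fun N => tail_sum c k (c * N)) _ s r Hr).
  - intros N w _. apply diff_at_tail_sum.
  - intros e He.
    destruct (tail_blocks_unif c k (Re s - r) (Cmod s + r) Hc) with (eps := e) as [N0 HN];
      [unfold r; lra|generalize (Cmod_ge_0 s); lra|assumption|].
    exists N0. intros N LN w Hw. apply HN; [assumption|]. split.
    + assert (Q := Rabs_Re_le (w - s)). change (Re (w - s)) with (Re w - Re s)%R in Q.
      revert Q. unfold Rabs. destruct Rcase_abs; lra.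
    + generalize (Cmod_triangle_inv w s). lra.
Qed.

Lemma diff_at_zeta_c (zeta : C -> C) (c : nat) (s : C) :
  diff_at zeta s -> diff_at (zeta_c zeta c) s.
Proof.
  intros H. apply diff_at_mult; [|assumption]. apply diff_at_minus; [apply diff_at_const|].
  apply (diff_at_comp (fun s => (1 - s) * RtoC (ln (INR c))) Cexp); [|apply diff_at_Cexp].
  apply diff_at_mult; [|apply diff_at_const].
  apply diff_at_minus; [apply diff_at_const|apply diff_at_id].
Qed.

(** * The identity and its continuation *)

Lemma npow_mul (m n : nat) (s : C) : (1 <= m)%nat -> (1 <= n)%nat ->
  npow (m * n) s = npow m s * npow n s.
Proof.
  intros Hm Hn. unfold npow. rewrite mult_INR.
  apply (cpow_mult (INR m) (INR n) s); apply lt_0_INR; lia.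
Qed.

(** The weight [1 - c] at the multiples of [c] is 1, minus [c] times the sum over these
    multiples. *)
Lemma tail_sum_0 (c N : nat) (s : C) : (2 <= c)%nat ->
  tail_sum c 0 (c * N) s = csum (fun n => npow n (- s)) (c * N)
    + - npow c (1 - s) * csum (fun n => npow n (- s)) N.
Proof.
  intros Hc. rewrite tail_sum_csum.
  rewrite (csum_ext _ (fun n => acoef c n * npow n (- s))).
  2: { intros n _. unfold sign_coef, gdiff_pow. simpl. field. }
  assert (E : npow c (1 - s) = RtoC (INR c) * npow c (- s)).
  { change (cpow (INR c) (1 - s) = RtoC (INR c) * cpow (INR c) (- s)).
    unfold Cminus. rewrite cpow_plus, cpow_1_r by (apply lt_0_INR; lia). reflexivity. }
  induction N as [|N IH].
  - rewrite Nat.mul_0_r, !csum_0. ring.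
  - rewrite Nat.mul_succ_r, !csum_add, csum_S, IH.
    rewrite (csum_ext (fun i => acoef c (c * N + i) * npow (c * N + i) (- s))
      (fun i => acoef c i * npow (c * N + i) (- s))) by (intros; now rewrite acoef_periodic).
    rewrite (acoef_sum c (fun i => npow (c * N + i) (- s))), E by lia.
    rewrite <- Nat.mul_succ_r, npow_mul by lia. ring.
Qed.

Lemma head_sum_S (c k : nat) (s : C) : (2 <= c)%nat ->
  head_sum c (S k) s = head_sum c k s
    + sign_coef c k / RtoC (INR c) * boundary c (gdiff_pow c k s) 0.
Proof.
  intros Hc. unfold head_sum. rewrite !sum_lt_csum, csum_S. f_equal.
  replace (S k - 1)%nat with k by lia.
  rewrite <- boundary_0_head by assumption. f_equal.
  unfold sign_coef. rewrite Cpow_add_r, Cpow_1_r. assert (N := INR_C_neq_0 c ltac:(lia)). field.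
  split; [now apply Cpow_nz|assumption].
Qed.

Lemma tail_sum_parts (c k N : nat) (s : C) : (2 <= c)%nat ->
  head_sum c (S k) s + tail_sum c (S k) (c * N) s = head_sum c k s + tail_sum c k (c * N) s
    + sign_coef c k / RtoC (INR c) * boundary c (gdiff_pow c k s) (c * N).
Proof.
  intros Hc. assert (Nz := INR_C_neq_0 c ltac:(lia)).
  assert (P := summation_by_parts c (gdiff_pow c k s) N ltac:(lia)).
  rewrite head_sum_S, !tail_sum_csum by assumption.
  rewrite (csum_ext (fun n => sign_coef c k * acoef c n * gdiff_pow c k s n)
    (fun n => sign_coef c k * (acoef c n * gdiff_pow c k s n))) by (intros; ring).
  rewrite (csum_ext (fun n => sign_coef c (S k) * acoef c n * gdiff_pow c (S k) s n)
    (fun n => sign_coef c (S k) *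
      (acoef c n * csum (fun i => acoef c i * gdiff_pow c k s (n + i)%nat) c))).
  2: { intros n _. rewrite <- Cmult_assoc. reflexivity. }
  rewrite !csum_mult, sign_coef_S by lia.
  set (b0 := boundary c _ 0) in *. set (bN := boundary c _ (c * N)) in *.
  replace b0 with ((b0 - bN) + bN) by ring. rewrite <- P. field. assumption.
Qed.

Lemma boundary_cvg_0 (c k : nat) (s : C) : (2 <= c)%nat -> (1 < Re s)%R ->
  cvg (fun N => boundary c (gdiff_pow c k s) (c * N)) 0.
Proof.
  intros Hc Hs e He. assert (Pk := pos_INR k).
  assert (Pc : (1 <= INR c)%R) by (apply (le_INR 1); lia).
  destruct (pdiff_half_disc c k (Re s) (Cmod s + 1) Hc) as [A [HA HB]];
    [lra|generalize (Cmod_ge_0 s); lra|].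
  set (K := (3 * INR c ^ 2 * A)%R).
  assert (HK : (0 < K)%R).
  { apply Rmult_lt_0_compat; [|assumption]. apply Rmult_lt_0_compat; [lra|]. apply pow_lt. lra. }
  destruct (Rpower_small (Re s + INR k) (e / K)) as [N0 [HN0 Hsm]];
    [lra|now apply Rdiv_lt_0_compat|].
  exists N0. intros N LN. unfold Cminus. rewrite Copp_0, Cplus_0_r.
  eapply Rle_lt_trans.
  - apply (Cmod_boundary_le c _ _ (A * Rpower (INR N0) (- (Re s + INR k)))); [lia|].
    intros m Hm. apply HB; [split; lra|assumption|nia].
  - apply (Rmult_lt_compat_l K) in Hsm; [|assumption].
    replace (K * (e / K))%R with e in Hsm by (field; lra). unfold K in Hsm. lra.
Qed.

Lemma zeta_c_identity_abs (c : nat) (zeta : C -> C) (k : nat) (s : C) : (2 <= c)%nat ->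
  is_riemann_zeta zeta -> (1 < Re s)%R ->
  cvg (fun N => head_sum c k s + tail_sum c k (c * N) s) (zeta_c zeta c s).
Proof.
  intros Hc [Hz _] Hs. induction k as [|k IH].
  - assert (Z : cvg (fun N => csum (fun n => npow n (- s)) N) (zeta s)).
    { assert (Z0 := cvg_of_filterlim _ _ (Hz s Hs)). intros e He.
      destruct (Z0 e He) as [N0 HN]. exists (S N0). intros N LN.
      specialize (HN (N - 1)%nat ltac:(lia)).
      assert (E : sum_n (fun n => npow (S n) (- s)) (N - 1) = csum (fun n => npow n (- s)) N).
      { change (sum_lt (S (N - 1)) (fun n => npow (S n) (- s)) = csum (fun n => npow n (- s)) N).
        replace (S (N - 1)) with N by lia. rewrite sum_lt_csum. apply csum_ext.
        intros m Hm. now replace (S (m - 1)) with m by lia. }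
      rewrite <- E. exact HN. }
    apply (cvg_ext (fun N => csum (fun n => npow n (- s)) (c * N)
      + - npow c (1 - s) * csum (fun n => npow n (- s)) N)).
    { intros N. rewrite tail_sum_0 by assumption. unfold head_sum. simpl. ring. }
    unfold zeta_c. replace ((1 - npow c (1 - s)) * zeta s)
      with (zeta s + - npow c (1 - s) * zeta s) by ring.
    apply cvg_lin; [|assumption].
    apply (cvg_subseq (csum (fun n => npow n (- s)))); [lia|assumption].
  - apply (cvg_ext (fun N => head_sum c k s + tail_sum c k (c * N) s
      + sign_coef c k / RtoC (INR c) * boundary c (gdiff_pow c k s) (c * N))).
    { intros N. now rewrite tail_sum_parts. }
    replace (zeta_c zeta c s) with (zeta_c zeta c s + sign_coef c k / RtoC (INR c) * 0) by ring.
    apply cvg_lin; [assumption|now apply boundary_cvg_0].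
Qed.

(** Both sides are differentiable on the punctured half plane and agree for
    [Re s > 1]. *)
Lemma zeta_c_identity (c : nat) (zeta : C -> C) (k : nat) (s : C) : (2 <= c)%nat ->
  is_riemann_zeta zeta -> punctured_half_plane (- INR k) s ->
  zeta_c zeta c s = head_sum c k s + tail_limit c k s.
Proof.
  intros Hc Hz Hs.
  assert (Z : zeta_c zeta c s - (head_sum c k s + tail_limit c k s) = 0).
  { apply (identity_punctured_half_plane
      (fun s => zeta_c zeta c s - (head_sum c k s + tail_limit c k s)) (- INR k)); [| |assumption].
    - intros w [W1 W2]. apply diff_at_minus.
      + apply diff_at_zeta_c, diff_at_of_ex_derive. now apply (proj1 (proj2 Hz)).
      + apply diff_at_plus; [apply diff_at_head_sum|now apply diff_at_tail_limit].
    - intros w Hw. assert (Pk := pos_INR k).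
      assert (E : zeta_c zeta c w = head_sum c k w + 1 * tail_limit c k w).
      { apply (cvg_unique (fun N => head_sum c k w + 1 * tail_sum c k (c * N) w)).
        - apply (cvg_ext (fun N => head_sum c k w + tail_sum c k (c * N) w)); [intros; ring|].
          now apply zeta_c_identity_abs.
        - apply cvg_lin; [apply cvg_const|]. apply tail_limit_cvg; [assumption|lra]. }
      rewrite E. ring. }
  replace (zeta_c zeta c s)
    with (zeta_c zeta c s - (head_sum c k s + tail_limit c k s)
      + (head_sum c k s + tail_limit c k s)) by ring.
  rewrite Z. ring.
Qed.

Lemma unif_cvg_on_compacts_half_plane (F : nat -> C -> C) (g : C -> C) (x : R) :
  (forall y r, (x < y)%R -> (0 < r)%R -> unif_on (half_disc y r) F g) ->
  unif_cvg_on_compacts (punctured_half_plane x) F g.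
Proof.
  intros H K HK HU e He.
  destruct (compact_in_half_disc K x HK) as [y [r [Hy [Hr HKr]]]];
    [intros s Hs; now apply HU|].
  destruct (H y r Hy Hr e He) as [N0 HN]. exists N0. intros N LN z Hz. now apply HN, HKr.
Qed.

Theorem theorem5 (c : nat) (hc : (2 <= c)%nat)
    (zeta : C -> C) (hzeta : is_riemann_zeta zeta) :
  (forall k : nat, (1 <= k)%nat ->
     exists T : C -> C,
       holomorphic_on (punctured_half_plane (1 - INR k)) T /\
       unif_cvg_on_compacts (punctured_half_plane (1 - INR k)) (tail_sum c k) T /\
       forall s : C, punctured_half_plane (1 - INR k) s ->
         ex_series (fun n : nat => Cmod (tail_term c k s (S n))) /\
         filterlim (fun N : nat => tail_sum c k (c * N) s) eventually (locally (T s)) /\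
         zeta_c zeta c s = head_sum c k s + T s) /\
  (forall k : nat,
     (exists T : C -> C,
        holomorphic_on (punctured_half_plane (- INR k)) T /\
        unif_cvg_on_compacts (punctured_half_plane (- INR k))
          (fun N : nat => tail_sum c k (c * N)) T /\
        forall s : C, punctured_half_plane (- INR k) s ->
          filterlim (fun N : nat => tail_sum c k (c * N) s) eventually (locally (T s)) /\
          zeta_c zeta c s = head_sum c k s + T s) /\
     (forall s : C, (- INR k < Re s <= 1 - INR k)%R ->
        (k = 0%nat \/ s <> RtoC (1 - INR k)) ->
        ~ ex_series (fun n : nat => Cmod (tail_term c k s (S n))))) /\
  (forall s : C, punctured_half_plane (-1) s ->
     exists L : C,
       filterlim
         (fun N : nat =>
            sum_n_m (fun n : nat =>
              acoef c n *
              sum_n_m (fun i : nat => acoef c i * npow (n + i) (- s)) 1 c) 1 (c * N))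
         eventually (locally L) /\
       zeta_c zeta c s =
         1 / RtoC (INR c) *
         (sum_n (fun i : nat => RtoC (INR (c + i)) * npow (i + 1) (- s)) (c - 2)
          - (RtoC (INR c) - 1) ^ 2 * npow c (- s) - L)).
Proof.
  split; [|split].
  - intros k Hk. exists (tail_limit c k). split; [|split].
    + intros s [Hs _]. apply ex_derive_of_diff_at, diff_at_tail_limit; [assumption|lra].
    + apply unif_cvg_on_compacts_half_plane. intros y r. now apply tail_unif.
    + intros s [Hs Hs1]. split; [now apply ex_series_tail|]. split.
      * apply filterlim_of_cvg, tail_limit_cvg; [assumption|lra].
      * apply zeta_c_identity; [assumption|assumption|]. split; [lra|assumption].
  - intros k. split; [|intros s; now apply not_ex_series_tail].
    exists (tail_limit c k). split; [|split].
    + intros s [Hs _]. now apply ex_derive_of_diff_at, diff_at_tail_limit.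
    + apply unif_cvg_on_compacts_half_plane. intros y r. now apply tail_blocks_unif.
    + intros s Hs. split; [|now apply zeta_c_identity].
      apply filterlim_of_cvg, tail_limit_cvg; [assumption|apply Hs].
  - intros s Hs. assert (Nz := INR_C_neq_0 c ltac:(lia)).
    exists (- RtoC (INR c) * tail_limit c 1 s). split.
    + apply filterlim_of_cvg.
      apply (cvg_ext (fun N => 0 + (- RtoC (INR c)) * tail_sum c 1 (c * N) s)).
      * intros N. rewrite Cplus_0_l, tail_sum_csum, <- csum_mult.
        apply csum_ext. intros n _.
        change (gdiff_pow c 1 s n) with (csum (fun i => acoef c i * npow (n + i) (- s)) c).
        change (sum_n_m (fun i : nat => acoef c i * npow (n + i) (- s)) 1 c)
          with (csum (fun i => acoef c i * npow (n + i) (- s)) c).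
        unfold sign_coef. rewrite !Cpow_1_r. now field.
      * replace (- RtoC (INR c) * tail_limit c 1 s)
          with (0 + - RtoC (INR c) * tail_limit c 1 s) by ring.
        apply cvg_lin; [apply cvg_const|]. apply tail_limit_cvg; [assumption|].
        simpl. apply Hs.
    + rewrite (zeta_c_identity c zeta 1 s hc hzeta) by exact Hs.
      assert (E : head_sum c 1 s = 1 / RtoC (INR c) *
        (sum_lt (c - 1) (fun i => RtoC (INR (c + i)) * npow (i + 1) (- s))
          - (RtoC (INR c) - 1) ^ 2 * npow c (- s))).
      { unfold head_sum. rewrite sum_lt_csum, csum_S, csum_0. simpl minus.
        unfold gdiff_pow. simpl gdiff. rewrite Cpow_1_r. simpl Cpow. ring. }
      rewrite E. replace (c - 1)%nat with (S (c - 2)) by lia. simpl sum_lt.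
      field. assumption.
Qed.
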